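(* Let $\eta\in\mathbb{R}$ and let $f\in\mathcal{P}_U(\mathbb{S}^2)$ be an $L^r$-local minimiser of $\mathcal{F}|_{\mathcal{P}_U(\mathbb{S}^2)}$ for some $r\in[1,\infty]$. Then there exist a probability density $\hat f\in\mathcal{P}([-1,1])$ and $n\in\mathbb{S}^2$ so that $\frac1{2\pi}\hat f(p\cdot n)=f(p)$ and, for some $S,l\in\mathbb{R}$ and a normalising constant $Z>0$, $$\hat f(x)=\frac1Z\exp(lP_2(x))\max\left(SP_2(x)-\eta,0\right),$$ $$S=\int_{-1}^1P_2(x)\hat f(x)\,dx,\qquad l=\frac23\int_{-1}^1P_2(x)\frac{\hat f(x)}{SP_2(x)-\eta}\,dx.$$
   Context: $\mathbb{S}^2\subset\mathbb{R}^3$ is the unit sphere and $dp$ is the 2-dimensional Hausdorff measure on it. $\mathcal{P}(\mathbb{S}^2)=\{f\in L^1(\mathbb{S}^2): f\ge 0 \text{ a.e.},\ \int_{\mathbb{S}^2}f\,dp=1\}$, and $\mathcal{P}([-1,1])$ is the set of probability densities on $[-1,1]$. For fixed $\eta$, $$\mathcal{F}(f)=\int_{\mathbb{S}^2}f(p)\ln f(p)-f(p)\ln\left(\int_{\mathbb{S}^2}\left((p\cdot q)^2-\tfrac13\right)f(q)\,dq-\eta\right)dp,$$ where $-\ln$ is extended by $+\infty$ for non-positive arguments, $0\times(+\infty)=0$, $0\ln 0=0$. The uniaxial distributions are $\mathcal{P}_U(\mathbb{S}^2)=\{f\in\mathcal{P}(\mathbb{S}^2):\exists\,\tilde f:[-1,1]\to\mathbb{R},\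 e\in\mathbb{S}^2\text{ such that }f(p)=\tilde f(p\cdot e)\}$, and $P_2(x)=\frac12(3x^2-1)$ is the second Legendre polynomial. $f\in\mathcal{P}_U(\mathbb{S}^2)\cap L^r$ with $\mathcal{F}(f)<+\infty$ is an $L^r$-local minimiser of $\mathcal{F}|_{\mathcal{P}_U(\mathbb{S}^2)}$ if there is $\epsilon>0$ with $\mathcal{F}(f)\le\mathcal{F}(g)$ for all $g\in\mathcal{P}_U(\mathbb{S}^2)\cap L^r$ with $\|f-g\|_{L^r}<\epsilon$. The quotient $\hat f(x)/(SP_2(x)-\eta)$ is taken to be $0$ where $SP_2(x)\le\eta$ (where $\hat f$ vanishes). Equalities between densities are a.e.
   Formalization: The formula for S is corrected from S=∫P_2 f̂ dx to S=(2/3)∫P_2 f̂ dx: since y²-1/3=(2/3)P_2(y), the logarithm's argument is (2/3)(∫P_2 f̂)P_2(p·n)-η, and the printed version fails for minimisers with 0<η<2/3. *)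

(* Defs.v *)
From HB Require Import structures.
From mathcomp Require Import all_boot all_order all_algebra.
From mathcomp Require Import all_classical all_reals all_analysis.
Set Implicit Arguments.
Unset Strict Implicit.
Unset Printing Implicit Defensive.
Import Order.TTheory GRing.Theory Num.Theory.
Import numFieldNormedType.Exports.
Local Open Scope classical_set_scope.
Local Open Scope ring_scope.

(* The norm that the library puts on 'rV[R]_3 is the sup norm, so the
   Euclidean structure of R^3 is introduced explicitly. *)
Definition dot (R : realType) (u v : 'rV[R]_3) : R := \sum_i u 0 i * v 0 i.

Definition sphere (R : realType) : Type := {u : 'rV[R]_3 | dot u u == 1}.

Fact sphere_point_subproof (R : realType) :
  dot (delta_mx 0 0 : 'rV[R]_3) (delta_mx 0 0) == 1.
Proof.
rewrite /dot (bigD1 0)//= big1 ?addr0 ?mxE ?eqxx ?mulr1//.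
by move=> i i0; rewrite !mxE (negbTE i0) mulr0.
Qed.

HB.instance Definition _ (R : realType) := Choice.on (sphere R).
HB.instance Definition _ (R : realType) :=
  isPointed.Build (sphere R) 
    (exist (fun u : 'rV[R]_3 => dot u u == 1) _ (sphere_point_subproof R)).

Definition sdot (R : realType) (p q : sphere R) : R := dot (val p) (val q).

Definition sdist (R : realType) (p q : sphere R) : R :=
  Num.sqrt (dot (val p - val q) (val p - val q)).

Section hausdorff2.
Context (R : realType) (T : pointedType) (dist : T -> T -> R).
Implicit Types A U : set T.
Local Open Scope ereal_scope.

(* Inserting 0 gives the empty set diameter 0 (instead of -oo). *)
Definition diam U : \bar R :=
  ereal_sup (0 |` [set (dist x y)%:E | x in U & y in U]).

Definition delta_cover (delta : R) A : set ((set T)^nat) :=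
  [set U | A `<=` \bigcup_k U k /\ forall k, diam (U k) <= delta%:E].

(* pi / 4 * diam ^ 2 is the area of a planar disc of the given diameter: with
   this normalisation the measure agrees with the area on smooth surfaces. *)
Definition hausdorff2_pre (delta : R) A : \bar R :=
  ereal_inf [set \sum_(k <oo) (pi / 4)%:E * diam (U k) ^+ 2
            | U in delta_cover delta A].

Definition hausdorff2 A : \bar R :=
  ereal_sup [set hausdorff2_pre delta A | delta in [set d : R | (0 < d)%R]].

Let gauge U : \bar R := (pi / 4)%:E * diam U ^+ 2.

Lemma diam_ge0 U : 0 <= diam U.
Proof. by apply: ereal_sup_ubound; left. Qed.

Lemma diam0 : diam set0 = 0.
Proof.
apply/eqP; rewrite eq_le diam_ge0 andbT; apply: ge_ereal_sup => x [->//|].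
by move=> [y []].
Qed.

Let gauge_ge0 U : 0 <= gauge U.
Proof.
by rewrite mule_ge0 ?expe_ge0 ?diam_ge0// lee_fin divr_ge0 ?pi_ge0.
Qed.

Lemma hausdorff2_pre_ge0 delta A : 0 <= hausdorff2_pre delta A.
Proof.
apply: le_ereal_inf_tmp => _ [U _ <-]; apply: nneseries_ge0 => k _ _.
exact: gauge_ge0.
Qed.

Lemma le_hausdorff2_pre delta A B :
  A `<=` B -> hausdorff2_pre delta A <= hausdorff2_pre delta B.
Proof.
move=> AB; apply/ereal_inf_le_tmp => _ [U [BU dU] <-].
by exists U => //; split => //; apply: subset_trans AB BU.
Qed.

Lemma hausdorff2_pre0 delta : (0 < delta)%R -> hausdorff2_pre delta set0 = 0.
Proof.
move=> d0; apply/eqP; rewrite eq_le hausdorff2_pre_ge0 andbT.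
apply: ereal_inf_lbound; exists (fun=> set0).
  by split => // k; rewrite diam0 lee_fin ltW.
by rewrite eseries0// => k _ _; rewrite diam0 expe2 !mule0.
Qed.

Lemma hausdorff2_pre_sigma_subadditive delta :
  sigma_subadditive (hausdorff2_pre delta).
Proof.
move=> A.
have [[i ioo]|] := pselect (exists i, hausdorff2_pre delta (A i) = +oo).
  rewrite (eseries_pinfty _ _ ioo) ?leey// => n _.
  by rewrite -ltNye (lt_le_trans _ (hausdorff2_pre_ge0 _ _)).
rewrite -forallNE => Aoo.
suff add2e (e : {posnum R}) : hausdorff2_pre delta (\bigcup_n A n) <=
    \sum_(i <oo) hausdorff2_pre delta (A i) + e%:num%:E.
  by apply/lee_addgt0Pr => _/posnumP[].
rewrite (le_trans _ (epsilon_trick _ _ _))//; last first.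
  by move=> n; exact: hausdorff2_pre_ge0.
pose P n (B : (set T)^nat) := delta_cover delta (A n) B /\
  \sum_(k <oo) gauge (B k) <=
    hausdorff2_pre delta (A n) + (e%:num / (2 ^ n.+1)%:R)%:E.
have [G PG] : {G : ((set T)^nat)^nat & forall n, P n (G n)}.
  apply: (@choice _ _ P) => n; rewrite /P /hausdorff2_pre.
  set S := (X in ereal_inf X); move infS : (ereal_inf S) => iS.
  case: iS infS => [r Sr|Soo|Soo].
  - have en1 : (0 < e%:num / (2 ^ n.+1)%:R)%R by [].
    have /(lb_ereal_inf_adherent en1) : ereal_inf S \is a fin_num by rewrite Sr.
    move=> [x [B BA muBx] xS].
    by exists B; split => //; rewrite /gauge muBx -Sr; exact/ltW.
  - by have := Aoo n; rewrite /hausdorff2_pre Soo.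
  - by have := hausdorff2_pre_ge0 delta (A n); rewrite /hausdorff2_pre Soo.
have muG_ge0 x : 0 <= (gauge \o uncurry G) x by exact: gauge_ge0.
apply: (@le_trans _ _ (\esum_(i in setT) (gauge \o uncurry G) i)).
  rewrite /hausdorff2_pre; apply: ereal_inf_lbound => /=.
  have /card_esym/ppcard_eqP[f] := card_nat2.
  exists (uncurry G \o f).
    split => [|i]; last first.
      by rewrite /=; case: (f i) => a b /=; have [[_ +] _] := PG a; exact.
    apply: (@subset_trans _ (\bigcup_n \bigcup_k G n k)) => [t [i _]|].
      by move=> /((PG i).1.1) -[j _ ?]; exists i => //; exists j.
    move=> t [i _ [j _ Bijt]]; exists (f^-1%FUN (i, j)) => //=.
    by rewrite invK ?inE.
  rewrite -(esum_pred_image (gauge \o uncurry G) _ xpredT) ?[fun=> _]set_true//.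
  by rewrite image_eq.
rewrite (_ : esum _ _ = \sum_(i <oo) \sum_(j <oo ) gauge (G i j)); last first.
  pose J : nat -> set (nat * nat) := fun i => [set (i, j) | j in setT].
  rewrite (_ : setT = \bigcup_k J k); last first.
    by rewrite predeqE => -[a b]; split => // _; exists a => //; exists b.
  rewrite esum_bigcupT /=; last 2 first.
    - apply/trivIsetP => i j _ _ ij.
      rewrite predeqE => -[n m] /=; split => //= -[] [_] _ [<-{n} _].
      by move=> [m' _] [] /esym/eqP; rewrite (negbTE ij).
    - by move=> /= [n m]; exact: gauge_ge0.
  rewrite -(image_id [set: nat]) -fun_true esum_pred_image//; last first.
    by move=> n _; exact: esum_ge0.
  apply: eq_eseriesr => /= j _.
  rewrite -(esum_pred_image (gauge \o uncurry G) (pair j) predT)//=; last first.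
    by move=> ? ? _ _; exact: (@can_inj _ _ _ snd).
  by congr esum; rewrite predeqE => -[a b]; split; move=> [i _ <-]; exists i.
apply: lee_lim.
- apply: is_cvg_nneseries => n *.
  by apply: nneseries_ge0 => m *; exact: (muG_ge0 (n, m)).
- apply: is_cvg_nneseries => n *; apply: adde_ge0 => //.
  exact: hausdorff2_pre_ge0.
- by near=> n; apply: lee_sum => i _; exact: (PG i).2.
Unshelve. all: by end_near. Qed.

Lemma hausdorff2_0 : hausdorff2 set0 = 0.
Proof.
apply/eqP; rewrite eq_le; apply/andP; split.
  by apply: ge_ereal_sup => _ [d d0 <-]; rewrite hausdorff2_pre0.
by rewrite -(@hausdorff2_pre0 1%R)//; apply: ereal_sup_ubound; exists 1%R => /=; rewrite ?ltr01.
Qed.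

Lemma hausdorff2_ge0 A : 0 <= hausdorff2 A.
Proof.
apply: (le_trans (hausdorff2_pre_ge0 1%R A)).
by apply: ereal_sup_ubound; exists 1%R => /=; rewrite ?ltr01.
Qed.

Lemma le_hausdorff2 : {homo hausdorff2 : A B / A `<=` B >-> A <= B}.
Proof.
move=> A B AB; apply: ge_ereal_sup => _ [d d0 <-].
apply: (le_trans (le_hausdorff2_pre d AB)).
by apply: ereal_sup_ubound; exists d.
Qed.

Lemma hausdorff2_sigma_subadditive : sigma_subadditive hausdorff2.
Proof.
move=> A; apply: ge_ereal_sup => _ [d d0 <-].
apply: (le_trans (hausdorff2_pre_sigma_subadditive d A)).
apply: lee_nneseries => [i _ _|i _]; first exact: hausdorff2_pre_ge0.
by apply: ereal_sup_ubound; exists d.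
Qed.

HB.instance Definition _ := isOuterMeasure.Build R T hausdorff2
  hausdorff2_0 hausdorff2_ge0 le_hausdorff2 hausdorff2_sigma_subadditive.

End hausdorff2.

(* The sphere with the sigma-algebra of its Caratheodory-measurable sets for
   the 2-dimensional Hausdorff measure of the Euclidean (chordal) distance. *)
Definition S2 (R : realType) := caratheodory_type (hausdorff2 (@sdist R)).

HB.instance Definition _ (R : realType) := Measurable.on (S2 R).

Definition area (R : realType) : set (S2 R) -> \bar R := hausdorff2 (@sdist R).

HB.instance Definition _ (R : realType) := isMeasure.Build _ _ _ (@area R)
  (@caratheodory_measure0 _ _ (hausdorff2 (@sdist R)))
  (@caratheodory_measure_ge0 _ _ (hausdorff2 (@sdist R)))
  (@caratheodory_measure_sigma_additive _ _ (hausdorff2 (@sdist R))).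

Definition density d (T : measurableType d) (R : realType)
    (mu : {measure set T -> \bar R}) (D : set T) (f : T -> R) : Prop :=
  [/\ mu.-integrable D (EFin \o f),
      {ae mu, forall x, D x -> 0 <= f x} &
      (\int[mu]_(x in D) (f x)%:E = 1)%E].

Definition uniaxial_density (R : realType) (f : S2 R -> R) : Prop :=
  density (@area R) setT f /\
  exists (ft : R -> R) (e : S2 R), {ae @area R, forall p, f p = ft (sdot p e)}.

Definition neg_ln (R : realType) (x : R) : \bar R :=
  if 0 < x then (- ln x)%:E else +oo%E.

Definition available_volume (R : realType) (eta : R) (f : S2 R -> R)
    (p : S2 R) : R :=
  \int[@area R]_q ((sdot p q ^+ 2 - 1 / 3) * f q) - eta.

(* ln 0 = 0 and 0 * +oo = 0 in the library. *)
Definition free_energy (R : realType) (eta : R) (f : S2 R -> R) : \bar R :=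
  (\int[@area R]_p
    ((f p * ln (f p))%:E + (f p)%:E * neg_ln (available_volume eta f p)))%E.

Definition uniaxial_local_minimiser (R : realType) (eta : R) (r : \bar R)
    (f : S2 R -> R) : Prop :=
  [/\ uniaxial_density f,
      ('N[@area R]_r[EFin \o f] < +oo)%E,
      (free_energy eta f < +oo)%E &
      exists2 eps : R, 0 < eps &
        forall g : S2 R -> R, uniaxial_density g ->
          ('N[@area R]_r[EFin \o g] < +oo)%E ->
          ('N[@area R]_r[(fun p => (f p - g p)%:E)] < eps%:E)%E ->
          (free_energy eta f <= free_energy eta g)%E].

Definition P2 (R : realType) (x : R) : R := (3 * x ^+ 2 - 1) / 2.

Definition volume_quotient (R : realType) (eta S : R) (fhat : R -> R)
    (x : R) : R :=
  if S * P2 x <= eta then 0 else fhat x / (S * P2 x - eta).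

(* Main.v *)
(* Archimedes: the area of a band of the sphere is 2 pi times its height, so
   integrals of functions of [p . e] reduce to integrals over [-1, 1].  Upper
   bounds for the Hausdorff measure come from 1-Lipschitz parametrisations by
   planar strips, lower bounds from an isodiametric inequality in cylindrical
   coordinates.
   For a uniaxial density with axis [e] the available volume is
   [S P2(p . e) - eta], where [S] only depends on the axial mean of the density.
   Among densities of a given axial mean the energy is, up to a constant, the
   relative entropy with respect to a Gibbs density [e^(l P2) max(S P2 - eta, 0)]
   of that mean, so by convexity a local minimiser is this Gibbs density.  The
   formula for [l] is the stationarity of [3/2 l S - ln Z(l, S)] along the
   self-consistent pairs [(l, S)]; these can be found on both sides of the
   minimiser, and Jensen's inequality with the convexity of the positive part
   replaces differentiation. *)
From HB Require Import structures.
Require Import Defs.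
From mathcomp Require Import all_boot all_order all_algebra.
From mathcomp Require Import all_classical all_reals all_analysis.
From mathcomp Require Import measurable_realfun.
From mathcomp Require Import ring lra zify.
Set Implicit Arguments.
Unset Strict Implicit.
Unset Printing Implicit Defensive.
Import Order.TTheory GRing.Theory Num.Theory.
Import numFieldNormedType.Exports.
Local Open Scope classical_set_scope.
Local Open Scope ring_scope.

(** * Hausdorff measure of plane sets *)

(** Area is a Hausdorff measure, so even the measure of the unit square, the measurability of
    [p . e] and the area of a band must be extracted from covers. The lower bounds for the bands and
    the upper bound [4 pi] for the whole sphere suffice, because they add up without slack. In the
    variational half the obstacle is that the minimiser is not known to be bounded, nor positive
    wherever its volume is, so it cannot be perturbed freely. All comparisons therefore involve
    Gibbs densities, whose energies are finite and explicit. These are bounded, so that moving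
    towards one of them, or slightly changing its parameters, is a small move in every L^r. A Gibbs
    density of the right mean exists because level sets of [P2 (p . e)] are null: the minimiser has
    mass on both sides of its mean, and tilting the weight then moves the mean past any discrepancy.
    For [l], Jensen's inequality cancels the change of the energy that is of first order in [l],
    which leaves the variation of [Z] in [S]. The intermediate value theorem replaces an implicit
    function: it gives, for each [S'] near [S], some self-consistent [l'] close to [l]. *)

Section hausdorff_outer.
Context (R : realType).
Local Open Scope ereal_scope.

Lemma lee_expe2 (x y : \bar R) : 0 <= x -> x <= y -> x ^+ 2 <= y ^+ 2.
Proof. by move=> x0 xy; rewrite !expe2 lee_pmul. Qed.

Lemma gauge_ge0 (x : \bar R) : 0 <= x -> 0 <= (pi / 4)%:E * x ^+ 2.
Proof. by move=> x0; rewrite mule_ge0 ?lee_fin ?divr_ge0 ?pi_ge0// expe_ge0. Qed.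

Lemma diam_le (T : pointedType) (dist : T -> T -> R) (U : set T) (d : R) :
  (0 <= d)%R -> (forall x y, U x -> U y -> (dist x y <= d)%R) ->
  diam dist U <= d%:E.
Proof.
move=> d0 h; apply: ge_ereal_sup => _ [->|[x Ux [y Uy <-]]]; rewrite lee_fin//.
exact: h.
Qed.

Lemma dist_le_diam (T : pointedType) (dist : T -> T -> R) (U : set T) x y :
  U x -> U y -> (dist x y)%:E <= diam dist U.
Proof. by move=> Ux Uy; apply: ereal_sup_ubound; right; exists x => //; exists y. Qed.

Lemma le_diam (T : pointedType) (dist : T -> T -> R) (U V : set T) :
  U `<=` V -> diam dist U <= diam dist V.
Proof.
move=> UV; apply: ereal_sup_le => _ [->|[x Ux [y Uy <-]]]; first by left.
by right; exists x; [exact: UV|exists y; [exact: UV|]].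
Qed.

Lemma diam_image (T T' : pointedType) (d : T -> T -> R) (d' : T' -> T' -> R)
    (L : R) (phi : T -> T') (U : set T) : (0 < L)%R ->
  (forall x y, U x -> U y -> (d' (phi x) (phi y) <= L * d x y)%R) ->
  diam d' (phi @` U) <= L%:E * diam d U.
Proof.
move=> L0 h; apply: ge_ereal_sup => z [->|[_ [x Ux <-] [_ [y Uy <-] <-]]].
  by rewrite mule_ge0 ?diam_ge0// lee_fin ltW.
apply: (@le_trans _ _ (L * d x y)%:E); first by rewrite lee_fin h.
by rewrite EFinM lee_pmul2l// dist_le_diam.
Qed.

Lemma hausdorff2_pre_le (T : pointedType) (dist : T -> T -> R) (delta : R) A :
  (0 < delta)%R -> hausdorff2_pre dist delta A <= hausdorff2 dist A.
Proof. by move=> d0; apply: ereal_sup_ubound; exists delta. Qed.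

(** A cover of [A] of mesh [e / L], cut down to [A] because [phi] is controlled only there, is
    pushed by [phi] to a cover of the image of mesh [e]. *)
Lemma hausdorff2_lipschitz (T T' : pointedType) (d : T -> T -> R)
    (d' : T' -> T' -> R) (L : R) (phi : T -> T') (A : set T) : (0 < L)%R ->
  (forall x y, A x -> A y -> (d' (phi x) (phi y) <= L * d x y)%R) ->
  hausdorff2 d' (phi @` A) <= (L ^+ 2)%:E * hausdorff2 d A.
Proof.
move=> L0 h; apply: ge_ereal_sup => _ [e /= e0 <-].
have L20 : (0 < L ^+ 2)%R by rewrite exprn_gt0.
have Le0 : (0 < e / L)%R by rewrite divr_gt0.
apply: (@le_trans _ _ ((L ^+ 2)%:E * hausdorff2_pre d (e / L) A)); last first.
  by rewrite lee_pmul2l// hausdorff2_pre_le.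
rewrite -lee_pdivrMl//; apply: le_ereal_inf_tmp => _ [U [AU dU] <-].
rewrite lee_pdivrMl// -nneseriesZl//; last first.
  by move=> i _; rewrite mule_ge0 ?lee_fin ?divr_ge0 ?pi_ge0// expe_ge0 ?diam_ge0.
have dphi k : diam d' (phi @` (U k `&` A)) <= L%:E * diam d (U k).
  apply: le_trans (diam_image L0 (U := U k `&` A) (d := d) _) _.
    by move=> x y [_ Ax] [_ Ay]; exact: h.
  by rewrite lee_pmul2l// le_diam// => x [].
apply: (@le_trans _ _ (\sum_(k <oo) (pi / 4)%:E * diam d' (phi @` (U k `&` A)) ^+ 2)).
  apply: ereal_inf_lbound; exists (fun k => phi @` (U k `&` A)) => //; split.
    by move=> _ [x Ax <-]; have [k _ Uk] := AU _ Ax; exists k => //; exists x.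
  move=> k; apply: le_trans (dphi k) _.
  rewrite -(@lee_pmul2l _ L^-1%:E) ?lte_fin ?invr_gt0// muleA -EFinM.
  by rewrite mulVf ?gt_eqF// mul1e -EFinM mulrC.
apply: lee_nneseries => k _.
  by rewrite gauge_ge0 ?diam_ge0.
rewrite [leRHS]muleCA lee_pmul2l ?lte_fin ?divr_gt0 ?pi_gt0//.
rewrite (le_trans (lee_expe2 _ (dphi k))) ?diam_ge0//.
by rewrite EFin_expe !expe2 muleACA.
Qed.

(** The cover by [A] alone, padded with empty sets, is admissible because [d <= delta]. *)
Lemma hausdorff2_pre_diam (T : pointedType) (dist : T -> T -> R) (delta d : R) A :
  (0 <= d <= delta)%R -> diam dist A <= d%:E ->
  hausdorff2_pre dist delta A <= (pi / 4 * d ^+ 2)%:E.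
Proof.
move=> /andP[d0 dd] Ad.
apply: (@le_trans _ _ (\sum_(k <oo) (pi / 4)%:E *
    diam dist (if k is 0%N then A else set0) ^+ 2)).
  apply: ereal_inf_lbound; exists (fun k => if k is 0%N then A else set0) => //.
  split; first by move=> x Ax; exists 0%N.
  move=> [|k]; first by rewrite (le_trans Ad)// lee_fin.
  by rewrite diam0 lee_fin (le_trans d0).
rewrite nneseries_recl//; last first.
  by move=> k _; rewrite mule_ge0 ?lee_fin ?divr_ge0 ?pi_ge0// expe_ge0 ?diam_ge0.
rewrite eseries_cond eseries0 ?adde0; last first.
  by move=> [|k]// _ _; rewrite diam0 expe2 !mule0.
rewrite (EFinM (pi / 4)) lee_pmul2l ?lte_fin ?divr_gt0 ?pi_gt0//.
by rewrite EFin_expe lee_expe2 ?diam_ge0.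
Qed.

(** The mesh is bundled with its positivity, on which [hausdorff2_pre0] depends. The fixed-mesh
    infimum thus becomes an outer measure and can be estimated tile by tile. *)
Definition hausdorff2_preo (T : pointedType) (dist : T -> T -> R) (d : {posnum R}) :=
  hausdorff2_pre dist d%:num.

Lemma hausdorff2_preo0 (T : pointedType) (dist : T -> T -> R) (d : {posnum R}) :
  hausdorff2_preo dist d set0 = 0.
Proof. by rewrite /hausdorff2_preo hausdorff2_pre0. Qed.

HB.instance Definition _ (T : pointedType) (dist : T -> T -> R) (d : {posnum R}) :=
  isOuterMeasure.Build R T (hausdorff2_preo dist d)
    (hausdorff2_preo0 dist d) (hausdorff2_pre_ge0 dist d%:num)
    (@le_hausdorff2_pre _ _ dist d%:num)
    (@hausdorff2_pre_sigma_subadditive _ _ dist d%:num).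

End hausdorff_outer.

(** * Caratheodory's criterion for the Hausdorff measure *)

Section metric_outer.
Context (R : realType) (T : pointedType) (dist : T -> T -> R).
Local Open Scope ereal_scope.
Let H := hausdorff2 dist.

(** At a mesh below [e] no covering set meets both [A] and [B], so every cover of the union splits
    into a cover of each. *)
Lemma hausdorff2_separated (A B : set T) (e : R) : (0 < e)%R ->
  (forall x y, A x -> B y -> (e <= dist x y)%R) -> H A + H B <= H (A `|` B).
Proof.
move=> e0 AB.
have H0 C : 0 <= H C by exact: hausdorff2_ge0.
have pre0 d C : 0 <= hausdorff2_pre dist d C by exact: hausdorff2_pre_ge0.
(* One mesh [d < e] is enough: the infima grow as the mesh shrinks, so the two suprema on the left
   can be taken at a common mesh. *)
suff pre (d : R) : (0 < d < e)%R ->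
    hausdorff2_pre dist d A + hausdorff2_pre dist d B <= H (A `|` B).
  have preA (d d' : R) : (0 < d <= d')%R -> forall C, hausdorff2_pre dist d' C <= hausdorff2_pre dist d C.
    move=> /andP[d0 dd] C; apply: ereal_inf_le_tmp => _ [U [CU dU] <-].
    by exists U => //; split => // k; rewrite (le_trans (dU k))// lee_fin.
  have half (d : R) : (0 < d -> 0 < Num.min d (e / 2) < e)%R.
    move=> d0; rewrite lt_min d0 divr_gt0//= gt_min; apply/orP; right.
    by rewrite ltr_pdivrMr// ltr_pMr// ltr1n.
  have [->|HB] := eqVneq (H (A `|` B)) +oo; first by rewrite leey.
  have finAB (d : R) : (0 < d < e)%R -> hausdorff2_pre dist d B \is a fin_num.
    move=> de; rewrite ge0_fin_numE//; apply: (@le_lt_trans _ _ (H (A `|` B))).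
      by apply: le_trans (pre d de); rewrite leeDr.
    by rewrite ltey.
  have HBfin : H B \is a fin_num.
    rewrite ge0_fin_numE//; apply: (@le_lt_trans _ _ (H (A `|` B))); last by rewrite ltey.
    by apply: le_hausdorff2; exact: subsetUr.
  rewrite -leeBrDr//; apply: ge_ereal_sup => _ [d1 /= d10 <-].
  rewrite leeBrDr// addeC.
  have [pinf|pfin] := eqVneq (hausdorff2_pre dist d1 A) +oo.
    have : hausdorff2_pre dist d1 A <= H (A `|` B).
      by rewrite (le_trans (hausdorff2_pre_le _ _ d10))// le_hausdorff2.
    by rewrite pinf leye_eq (negbTE HB).
  have pAfin : hausdorff2_pre dist d1 A \is a fin_num by rewrite ge0_fin_numE// ltey.
  rewrite -leeBrDr//; apply: ge_ereal_sup => _ [d2 /= d20 <-].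
  rewrite leeBrDr// addeC.
  pose d : R := Num.min (Num.min d1 d2) (e / 2)%R.
  have d0e : (0 < d < e)%R by apply: half; rewrite lt_min d10.
  apply: le_trans (pre d d0e); have /andP[d0 _] := d0e.
  by apply: leeD; apply: preA; rewrite d0/= /d !ge_min lexx ?orbT.
move=> /andP[d0 de]; apply: le_trans (hausdorff2_pre_le _ _ d0).
apply: le_ereal_inf_tmp => _ [U [ABU dU] <-].
pose UA k := if `[< U k `&` A !=set0 >] then U k else set0.
pose UB k := if `[< U k `&` A !=set0 >] then set0 else U k.
apply: (@le_trans _ _ (\sum_(k <oo) (pi / 4)%:E * diam dist (UA k) ^+ 2 +
                       \sum_(k <oo) (pi / 4)%:E * diam dist (UB k) ^+ 2)).
  apply: leeD; apply: ereal_inf_lbound.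
    exists UA => //; split=> [x Ax|k]; last first.
      by rewrite /UA; case: ifP => // _; rewrite diam0 lee_fin ltW.
    have [|k _ Ukx] := ABU x; first by left.
    exists k => //; rewrite /UA; case: asboolP => // -[]; by exists x.
  exists UB => //; split=> [x Bx|k]; last first.
    by rewrite /UB; case: ifP => // _; rewrite diam0 lee_fin ltW.
  have [|k _ Ukx] := ABU x; first by right.
  exists k => //; rewrite /UB; case: asboolP => // -[y [Uky Ay]].
  have := le_trans (dist_le_diam dist Uky Ukx) (dU k).
  by rewrite lee_fin => /(le_trans (AB _ _ Ay Bx)); rewrite leNgt de.
rewrite -nneseriesD; [|by move=> k _; rewrite gauge_ge0 ?diam_ge0..].
apply: lee_nneseries => k _.
  by rewrite adde_ge0// gauge_ge0 ?diam_ge0.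
by rewrite /UA /UB; case: ifP => _; rewrite diam0 (expe2 0) !mule0 ?adde0 ?add0e.
Qed.

(** Rings whose indices differ by at least two are a positive distance apart, so the measure is
    superadditive over the even rings and over the odd rings separately. *)
Lemma le_hausdorff2_sum_rings (X : set T) (r : nat -> set T) (e : nat -> R) :
  (forall n, 0 < e n)%R -> (forall n, r n `<=` X) ->
  (forall n m x y, (n.+1 < m)%N -> r n x -> r m y -> (e n <= dist x y)%R) ->
  forall n, \sum_(i < n) H (r i.*2) <= H X /\ \sum_(i < n) H (r i.*2.+1) <= H X.
Proof.
move=> e0 rX sep n.
have gen : forall (f : nat -> nat), (forall i j, (i < j)%N -> ((f i).+1 < f j)%N) ->
    \sum_(i < n) H (r (f i)) <= H X.
  move=> f fi.
  have fi' i j : (i <= j)%N -> ((f i) <= f j)%N.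
    by rewrite leq_eqVlt => /predU1P[->//|/fi/ltnW/ltnW].
  suff: forall m, (m <= n)%N -> \sum_(n - m <= i < n) H (r (f i)) <=
      H (\bigcup_(i in [set i | (n - m <= i)%N]) r (f i)).
    move=> /(_ n (leqnn _)); rewrite subnn big_mkord => /le_trans; apply.
    by apply: le_hausdorff2 => x [i _]; exact: rX.
  elim=> [_|m IH mn]; first by rewrite subn0 big_geq// hausdorff2_ge0.
  have lt : (n - m.+1 < n)%N by rewrite ltn_subrL (leq_ltn_trans _ mn).
  rewrite big_ltn// -subSn// subSS.
  apply: (@le_trans _ _ (H (r (f (n - m.+1)%N)) +
      H (\bigcup_(i in [set i | (n - m <= i)%N]) r (f i)))).
    by rewrite leeD2l// IH// ltnW.
  apply: le_trans.
    apply: (@hausdorff2_separated _ _ (e (f (n - m.+1)%N))); first exact: e0.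
    move=> x y rx [i /= ni ry]; apply: sep rx ry; apply: fi.
    by apply: leq_trans ni; rewrite -subSn// subSS.
  apply: le_hausdorff2 => x [rx|[i /= ni ry]].
    by exists (n - m.+1)%N => //=.
  by exists i => //=; rewrite (leq_trans _ ni)// leq_sub2l.
split; first by apply: (gen (fun i => i.*2)) => i j ij; lia.
by apply: (gen (fun i => i.*2.+1)) => i j ij; lia.
Qed.

(** For [H X] finite, the part of [X] where [u > c] is approximated by the part where
    [u > c + 1 / (n + 1)], which is separated from the sublevel set. The error lies in the rings of
    index at least [n]; their measures are summable, so it tends to 0. *)
Lemma lipschitz_caratheodory (u : T -> R) (c : R) :
  (forall x y, u x - u y <= dist x y)%R ->
  (hausdorff2 dist).-caratheodory [set x | (u x <= c)%R].
Proof.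
move=> ulip; apply: le_caratheodory_measurable => X.
change (H (X `&` [set x | (u x <= c)%R]) + H (X `&` ~` [set x | (u x <= c)%R]) <= H X).
have [->|HX] := eqVneq (H X) +oo; first by rewrite leey.
have HX' : H X < +oo by rewrite ltey.
pose r n := X `&` [set x | (c + n.+2%:R^-1 < u x <= c + n.+1%:R^-1)%R].
(* Variation of [u] across ring [n + 1], which separates ring [n] from all the rings after it. *)
pose e n : R := (n.+2%:R^-1 - n.+3%:R^-1)%R.
have e0 n : (0 < e n)%R by rewrite subr_gt0 ltf_pV2 ?posrE// ltr_nat.
have rX n : r n `<=` X by move=> x [].
have sep n m x y : (n.+1 < m)%N -> r n x -> r m y -> (e n <= dist x y)%R.
  move=> nm [_ /= /andP[ux _]] [_ /= /andP[_ uy]].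
  apply: le_trans (ulip x y); rewrite /e.
  have : (m.+1%:R^-1 <= n.+3%:R^-1 :> R)%R by rewrite lef_pV2 ?posrE// ler_nat.
  move: ux uy; move: (u x) (u y) (n.+2%:R^-1)%R (n.+3%:R^-1)%R (m.+1%:R^-1)%R.
  by move=> a b a1 a2 a3; lra.
have sums := le_hausdorff2_sum_rings e0 rX sep.
have r0 k : 0 <= H (r k) by exact: hausdorff2_ge0.
have tot : \sum_(k <oo) H (r k) < +oo.
  apply: (@le_lt_trans _ _ (H X + H X)); last by rewrite lte_add_pinfty.
  apply: lime_le; first exact: is_cvg_nneseries.
  apply: nearW => n; rewrite big_mkord.
  apply: (@le_trans _ _ (\sum_(i < n.*2) H (r i))).
    rewrite -!(big_mkord xpredT (fun i => H (r i))).
    by apply: lee_sum_nneg_natr => //; rewrite -addnn leq_addr.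
  have -> : \sum_(i < n.*2) H (r i) =
      \sum_(i < n) H (r i.*2) + \sum_(i < n) H (r i.*2.+1).
    elim: n => [|n IH]; first by rewrite double0 !big_ord0 adde0.
    by rewrite doubleS !big_ord_recr/= IH -!addeA; congr (_ + _); rewrite addeCA.
  by have [s1 s2] := sums n; exact: leeD.
have tail := nneseries_tail_cvg tot (fun k _ => r0 k).
have step n : H (X `&` [set x | (u x <= c)%R]) + H (X `&` ~` [set x | (u x <= c)%R]) <=
    H X + \sum_(n <= k <oo) H (r k).
  pose Q := X `&` [set x | (c + n.+1%:R^-1 < u x)%R].
  have PQ : H (X `&` [set x | (u x <= c)%R]) + H Q <= H X.
    apply: (@le_trans _ _ (H (X `&` [set x | (u x <= c)%R] `|` Q))); last first.
      by apply: le_hausdorff2 => x [[]|[]].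
    rewrite addeC (setUC (X `&` _) Q); apply: (@hausdorff2_separated _ _ n.+1%:R^-1) => //.
    move=> x y [_ /= ux] [_ /= uy]; apply: le_trans (ulip x y).
    by move: ux uy; move: (u x) (u y) (n.+1%:R^-1)%R => a b a1; lra.
  have QR : H (X `&` ~` [set x | (u x <= c)%R]) <= H Q + \sum_(n <= k <oo) H (r k).
    apply: le_trans (leeD2l _ (outer_measure_sigma_subadditive_tail _ n r)).
    apply: le_trans (outer_measureU2 _ _ _); apply: le_hausdorff2 => x [Xx /= /negP].
    rewrite -ltNge => cu.
    have [h|h] := ltP (c + n.+1%:R^-1)%R (u x); [by left|right].
    have d0 : (0 < u x - c)%R by rewrite subr_gt0.
    have D0 : (0 <= (u x - c)^-1)%R by rewrite invr_ge0 ltW.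
    have hn : (n.+1%:R <= (u x - c)^-1)%R.
      by rewrite -[leLHS]invrK lef_pV2 ?posrE ?invr_gt0//; move: h; move: (u x) (n.+1%:R^-1)%R => a b; lra.
    have := truncn_itv D0.
    have : (n.+1 <= Num.truncn (u x - c)^-1)%N by rewrite truncn_ge_nat.
    case: (Num.truncn _) => // k; rewrite ltnS => nk /andP[k1 k2].
    exists k => /=; first by apply/negP; rewrite -leqNgt.
    split=> //=; apply/andP; split.
      by rewrite -ltrBrDl -[ltRHS]invrK ltf_pV2 ?posrE ?invr_gt0.
    by rewrite -lerBlDl -[leLHS]invrK lef_pV2 ?posrE ?invr_gt0.
  apply: le_trans (leeD2l _ QR) _; rewrite addeA; exact: leeD2r.
rewrite -[leRHS]adde0; apply: (cvge_ge _ (cvgeD _ (cvg_cst (H X)) tail)).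
  exact: nearW.
by rewrite fin_num_adde_defl.
Qed.

End metric_outer.

(** * Trigonometric inequalities and quarter-circle sums *)

Section trigonometry.
Context (R : realType).
Implicit Types x y t : R.

Lemma is_derive_le (f df : R -> R) (a b : R) : a <= b ->
  (forall x, is_derive x 1 f (df x)) ->
  (forall x, a <= x <= b -> 0 <= df x) -> f a <= f b.
Proof.
move=> ab fdf df0; rewrite -subr_ge0.
have [|c] := @MVT_segment R f df a b ab (fun x _ => fdf x).
  apply: derivable_within_continuous => x _; exact: (@ex_derive _ _ _ _ _ _ _ (fdf x)).
by rewrite in_itv/= => cab ->; rewrite mulr_ge0 ?df0// subr_ge0.
Qed.

Lemma sin_le x : 0 <= x -> sin x <= x.
Proof.
move=> x0; rewrite -subr_ge0.
have := @is_derive_le (fun t => t - sin t) (fun t => 1 - cos t) 0 x x0.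
rewrite sin0 subr0; apply => t _; last by rewrite subr_ge0 cos_le1.
Qed.

Lemma sqr_sin_le x : sin x ^+ 2 <= x ^+ 2.
Proof.
have nn y : 0 <= y -> sin y ^+ 2 <= y ^+ 2.
  move=> y0; rewrite -[leLHS]real_normK ?num_real// ler_sqr ?nnegrE//.
  rewrite ler_norml sin_le// andbT.
  have : 0 + sin 0 <= y + sin y.
    apply: (@is_derive_le (fun t => t + sin t) (fun t => 1 + cos t)) => // t _.
  by rewrite sin0; lra.
have [/nn//|/ltW x0] := leP 0 x.
by have := nn (- x); rewrite sinN !sqrrN; apply; rewrite oppr_ge0.
Qed.

Lemma mul_cos_le_sin x : 0 <= x <= pi -> x * cos x <= sin x.
Proof.
move=> /andP[x0 xpi]; rewrite -subr_ge0.
have := @is_derive_le (fun t => sin t - t * cos t) (fun t => t * sin t) 0 x x0.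
rewrite sin0 mul0r subr0; apply => t; last first.
  by move=> /andP[t0 tx]; rewrite mulr_ge0// sin_ge0_pi// t0 (le_trans tx).
apply: is_derive_eq; rewrite !scaler1 /GRing.scale/=; ring.
Qed.

(** For [t] in [[0, pi / 2]], the area under [sqrt (1 - x^2)] between 0 and [sin t]. *)
Definition quarter_area t : R := (t + sin t * cos t) / 2.

Lemma is_derive_quarter_area t : is_derive t 1 quarter_area (cos t ^+ 2).
Proof.
rewrite /quarter_area; apply: is_derive_eq; rewrite /GRing.scale/=.
have := cos2Dsin2 t; set c := cos t; set s := sin t => cs.
by rewrite (_ : s * - s = c ^+ 2 - 1); [field|rewrite -cs; ring].
Qed.

(** On [[a, b]] the derivative [cos^2] lies between [cos b] times and [cos a] times the derivative
    of [sin]. *)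
Lemma quarter_area_le (a b : R) : 0 <= a -> a <= b -> b <= pi / 2 ->
  cos b * (sin b - sin a) <= quarter_area b - quarter_area a <= cos a * (sin b - sin a).
Proof.
move=> a0 ab b2.
have cos_mono (u v : R) : 0 <= u -> u <= v -> v <= pi / 2 -> 0 <= cos v <= cos u.
  move=> u0 uv v2; rewrite cos_ge0_pihalf/=; last first.
    by rewrite v2 andbT (le_trans _ (le_trans u0 uv))// oppr_le0 divr_ge0 ?pi_ge0.
  have pi2 : pi / 2 <= pi :> R by rewrite ler_pdivrMr// ler_peMr ?pi_ge0// ler1n.
  rewrite leNgt ltr_cos ?in_itv/= -?leNgt ?u0 ?(le_trans u0 uv)/=//.
  - by rewrite (le_trans v2).
  - by rewrite (le_trans uv)// (le_trans v2).
apply/andP; split.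
  rewrite -subr_ge0.
  have := @is_derive_le (fun t => quarter_area t - cos b * sin t)
    (fun t => cos t ^+ 2 - cos b * cos t) a b ab.
  move=> h; have {h} : quarter_area a - cos b * sin a <= quarter_area b - cos b * sin b.
    apply: h => t.
      have := is_derive_quarter_area t => ?; apply: is_derive_eq.
      by rewrite /GRing.scale/=; ring.
    move=> /andP[at_ tb]; have /andP[c0 cc] := cos_mono _ _ (le_trans a0 at_) tb b2.
    by rewrite expr2 -mulrBl mulr_ge0 ?subr_ge0// (le_trans c0).
  by rewrite mulrBr; lra.
have := @is_derive_le (fun t => cos a * sin t - quarter_area t)
    (fun t => cos a * cos t - cos t ^+ 2) a b ab.
move=> h; have {h} : cos a * sin a - quarter_area a <= cos a * sin b - quarter_area b.
  apply: h => t.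
    have := is_derive_quarter_area t => ?; apply: is_derive_eq.
    by rewrite /GRing.scale/=; ring.
  move=> /andP[at_ tb]; have /andP[c0 cc] := cos_mono _ _ a0 at_ (le_trans tb b2).
  by rewrite expr2 -mulrBl mulr_ge0 ?subr_ge0.
by rewrite mulrBr; lra.
Qed.

(** Lower and upper Riemann sums of [sqrt (1 - x^2)] on [[0, 1]]. In the angles [asin (j / n)] the
    cells become increments of [quarter_area], which telescope to [pi / 4]. *)
Lemma quarter_circle_sums (n : nat) : (0 < n)%N ->
  \sum_(j < n) Num.sqrt (1 - (j.+1%:R / n%:R) ^+ 2) / n%:R <= pi / 4 :> R /\
  pi / 4 <= \sum_(j < n) Num.sqrt (1 - (j%:R / n%:R) ^+ 2) / n%:R :> R.
Proof.
move=> n0; have n0' : 0 < n%:R :> R by rewrite ltr0n.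
pose th (j : nat) : R := asin (j%:R / n%:R).
have itv (j : nat) : (j <= n)%N -> 0 <= (j%:R / n%:R : R) <= 1.
  by move=> jn; rewrite divr_ge0//= ler_pdivrMr// mul1r ler_nat.
have itv' (j : nat) : (j <= n)%N -> -1 <= (j%:R / n%:R : R) <= 1.
  by move=> /itv/andP[j0 ->]; rewrite andbT (le_trans _ j0)// lerN10.
have sinth j : (j <= n)%N -> sin (th j) = j%:R / n%:R.
  by move=> jn; rewrite /th asinK// in_itv/= itv'.
have costh j : (j <= n)%N -> cos (th j) = Num.sqrt (1 - (j%:R / n%:R) ^+ 2).
  by move=> jn; rewrite /th cos_asin// itv'.
have th_itv j : (j <= n)%N -> - (pi / 2) <= th j <= pi / 2.
  by move=> jn; rewrite asin_geNpi2 ?asin_lepi2 ?itv'.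
have th_le i j : (i <= j)%N -> (j <= n)%N -> th i <= th j.
  move=> ij jn; have iN := leq_trans ij jn.
  rewrite leNgt -ltr_sin ?in_itv/= ?th_itv// !sinth// -leNgt.
  by rewrite ler_pM2r ?invr_gt0// ler_nat.
have th0 : th 0%N = 0.
  rewrite /th mul0r -[in LHS](sin0 R) sinK// in_itv/=.
  by rewrite oppr_le0 divr_ge0 ?pi_ge0.
have thn : th n = pi / 2.
  rewrite /th divff ?gt_eqF// -[in LHS]sin_pihalf sinK// in_itv/= lexx andbT.
  by rewrite ge0_cp// divr_ge0 ?pi_ge0.
have th_ge0 j : (j <= n)%N -> 0 <= th j by move=> jn; rewrite -th0 th_le.
have tele : pi / 4 = \sum_(j < n) (quarter_area (th j.+1) - quarter_area (th j)) :> R.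
  rewrite -(big_mkord xpredT (fun j => quarter_area (th j.+1) - quarter_area (th j))).
  rewrite telescope_sumr// thn th0 /quarter_area cos_pihalf sin0 mulr0 mul0r.
  by rewrite !addr0 mul0r subr0; field.
have step (j : 'I_n) : Num.sqrt (1 - (j.+1%:R / n%:R) ^+ 2) / n%:R <=
    quarter_area (th j.+1) - quarter_area (th j) <=
    Num.sqrt (1 - (j%:R / n%:R) ^+ 2) / n%:R.
  have jn := ltn_ord j.
  have := @quarter_area_le (th j) (th j.+1).
  rewrite th_ge0 ?th_le ?(ltnW jn)// => /(_ isT isT).
  have /andP[_ ->] := th_itv _ jn => /(_ isT).
  rewrite !sinth ?costh ?(ltnW jn)//.
  by rewrite -mulrBl -natrB// subSnn mul1r.
by rewrite tele; split; apply: ler_sum => j _; have /andP[] := step j.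
Qed.

End trigonometry.

Section meshes.
Context (R : realType).

Lemma mesh (n : nat) (w x : R) : (0 < n)%N -> 0 < w -> 0 <= x <= w ->
  exists2 i, (i < n)%N & i%:R * (w / n%:R) <= x <= i.+1%:R * (w / n%:R).
Proof.
move=> n0 w0 /andP[x0 xw]; have n0' : 0 < n%:R :> R by rewrite ltr0n.
have s0 : 0 < w / n%:R by rewrite divr_gt0.
have y0 : 0 <= x / (w / n%:R) by rewrite divr_ge0// ltW.
have /andP[i1 i2] := truncn_itv y0; set i := Num.truncn _ in i1 i2.
have {}i1 : i%:R * (w / n%:R) <= x by rewrite -ler_pdivlMr.
have {}i2 : x <= i.+1%:R * (w / n%:R) by rewrite -ler_pdivrMr// ltW.
have [iltn|nlei] := ltnP i n; first by exists i => //; rewrite i1.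
(* Truncation overshoots to [n] only at the right end point, which belongs to the last cell. *)
have xE : x = w.
  apply/eqP; rewrite eq_le xw/= (le_trans _ i1)//.
  by rewrite mulrCA ler_peMr ?(ltW w0)// ler_pdivlMr// mul1r ler_nat.
case: n n0 n0' s0 y0 @i i1 i2 nlei => // n *; exists n => //.
rewrite xE [X in _ <= _ <= X]mulrCA divff ?mulr1 ?lexx ?andbT; last by rewrite pnatr_eq0.
by rewrite mulrCA ler_piMr ?(ltW w0)// ler_pdivrMr// mul1r ler_nat.
Qed.

Lemma outer_measure_le_sum (T : Type) (mu : {outer_measure set T -> \bar R})
    (A : set T) (n : nat) (F : nat -> set T) :
  (forall x, A x -> exists2 i, (i < n)%N & F i x) ->
  (mu A <= \sum_(i < n) mu (F i))%E.
Proof.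
move=> AF; apply: le_trans (outer_measure_subadditive mu F n).
apply: le_outer_measure => x /AF[i ilt Fx].
by rewrite -bigcup_mkord; exists i.
Qed.

Lemma lee_sum_ord_cst (n : nat) (F : 'I_n -> \bar R) (c : R) :
  (forall i, F i <= c%:E)%E -> (\sum_(i < n) F i <= (n%:R * c)%:E)%E.
Proof.
move=> Fc; apply: (@le_trans _ _ (\sum_(i < n) c%:E)%E); first exact: lee_sum.
by rewrite sumEFin lee_fin sumr_const card_ord mulr_natl.
Qed.

End meshes.

(** * Planar rectangles *)

Section plane.
Context (R : realType).
Implicit Types (p q : R * R).

Definition plane_dist (p q : R * R) : R :=
  Num.sqrt ((p.1 - q.1) ^+ 2 + (p.2 - q.2) ^+ 2).

Definition rectangle (a b w h : R) : set (R * R) :=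
  [set p | a <= p.1 <= a + w /\ b <= p.2 <= b + h].

Local Notation H := (hausdorff2 plane_dist).
Local Notation Q := (rectangle 0 0 1 1).

Lemma plane_dist_le p q (d : R) : 0 <= d ->
  (p.1 - q.1) ^+ 2 + (p.2 - q.2) ^+ 2 <= d ^+ 2 -> plane_dist p q <= d.
Proof.
by move=> d0 h; rewrite /plane_dist -[leRHS]ger0_norm// -sqrtr_sqr ler_wsqrtr.
Qed.

Lemma hausdorff2_square (a b s : R) : 0 < s ->
  (H (rectangle a b s s) <= (s ^+ 2)%:E * H Q)%E.
Proof.
move=> s0; pose phi p : R * R := (a + s * p.1, b + s * p.2).
apply: le_trans (@hausdorff2_lipschitz _ _ _ plane_dist plane_dist s phi Q s0 _).
  apply: le_hausdorff2 => -[x y] [/= xI yI].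
  exists ((x - a) / s, (y - b) / s); last first.
    by rewrite /phi/=; congr pair; field; rewrite gt_eqF.
  by split=> /=; rewrite add0r ler_pdivlMr// ler_pdivrMr//; lra.
move=> p q _ _; apply: plane_dist_le; first by rewrite mulr_ge0 ?sqrtr_ge0// ltW.
rewrite exprMn sqr_sqrtr ?addr_ge0 ?sqr_ge0//= /phi/=.
by rewrite le_eqVlt; apply/orP; left; apply/eqP; ring.
Qed.

Lemma diam_square (a b s : R) : 0 < s ->
  (diam plane_dist (rectangle a b s s) <= (2 * s)%:E)%E.
Proof.
move=> s0; have s20 : 0 <= 2 * s by rewrite mulr_ge0// ltW.
apply: diam_le => // -[x y] [x' y'] [/= hx hy] [/= hx' hy'].
apply: plane_dist_le => //=; rewrite exprMn.
have h1 : (x - x') ^+ 2 <= s ^+ 2 by rewrite -subr_ge0 subr_sqr mulr_ge0; lra.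
have h2 : (y - y') ^+ 2 <= s ^+ 2 by rewrite -subr_ge0 subr_sqr mulr_ge0; lra.
have := sqr_ge0 s; lra.
Qed.

(** Stated for any outer measure, since it serves both for [H] and for its approximations at fixed
    mesh. *)
Lemma outer_measure_tiles (mu : {outer_measure set (R * R) -> \bar R})
    (a b w h c : R) (n m : nat) : (0 < n)%N -> (0 < m)%N -> 0 < w -> 0 < h ->
  (forall i j : nat, mu (rectangle (a + i%:R * (w / n%:R)) (b + j%:R * (h / m%:R))
     (w / n%:R) (h / m%:R)) <= c%:E)%E ->
  (mu (rectangle a b w h) <= (n%:R * m%:R * c)%:E)%E.
Proof.
move=> n0 m0 w0 h0 tile.
have row (i : nat) :
    (mu (rectangle (a + i%:R * (w / n%:R)) b (w / n%:R) h) <= (m%:R * c)%:E)%E.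
  apply: le_trans (outer_measure_le_sum (n := m) mu (F := fun j =>
    rectangle (a + i%:R * (w / n%:R)) (b + j%:R * (h / m%:R))
     (w / n%:R) (h / m%:R)) _) _.
    move=> -[x y] [/= xI yI].
    have [|j jm yj] := @mesh R m h (y - b) m0 h0; first by lra.
    by exists j => //; split=> //=; rewrite -natr1 mulrDl mul1r in yj; lra.
  exact: lee_sum_ord_cst.
apply: le_trans (outer_measure_le_sum (n := n) mu (F := fun i =>
    rectangle (a + i%:R * (w / n%:R)) b (w / n%:R) h) _) _.
  move=> -[x y] [/= xI yI].
  have [|i im xi] := @mesh R n w (x - a) n0 w0; first by lra.
  by exists i => //; split=> //=; rewrite -natr1 mulrDl mul1r in xi; lra.
by rewrite -mulrA; exact: lee_sum_ord_cst.
Qed.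

(** A crude bound will do: [n^2] tiles of diameter at most [2 / n] cost [pi]. Finiteness is what
    allows the inequality for [k] in [k_le1] to be solved. *)
Lemma hausdorff2_unit_square_lty : (H Q < +oo)%E.
Proof.
apply: (@le_lt_trans _ _ pi%:E); last by rewrite ltry.
apply: ge_ereal_sup => _ [d /= d0 <-].
pose n := (Num.truncn (2 / d)).+1.
have n0 : 0 < n%:R :> R by rewrite ltr0n.
have nd : 2 / n%:R <= d.
  by rewrite ler_pdivrMr// [leRHS]mulrC -ler_pdivrMr// ltW// truncnS_gt.
have : (hausdorff2_preo plane_dist (PosNum d0) Q <=
    (n%:R * n%:R * (pi / 4 * (2 / n%:R) ^+ 2))%:E)%E.
  apply: outer_measure_tiles => // i j; rewrite mul1r.
  apply: hausdorff2_pre_diam; first by rewrite nd divr_ge0// ltW.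
  by apply: diam_square; rewrite invr_gt0.
move=> /le_trans; apply; rewrite lee_fin le_eqVlt; apply/orP; left; apply/eqP.
by field; rewrite gt_eqF.
Qed.

Let k := fine (H Q).

Let HQE : H Q = k%:E.
Proof. by rewrite fineK// ge0_fin_numE ?hausdorff2_ge0// hausdorff2_unit_square_lty. Qed.

Let k_ge0 : 0 <= k. Proof. by rewrite -lee_fin -HQE hausdorff2_ge0. Qed.

Let hausdorff2_rectangle_k (a b w h : R) : 0 < w -> 0 < h ->
  (H (rectangle a b w h) <= (k * (w * h))%:E)%E.
Proof.
move=> w0 h0; apply/lee_addgt0Pr => e e0; have {}e0 : 0 < (e : R) := e0.
(* Squares of side [s <= 1] overshoot the rectangle to at most [(w + s) (h + s)]; after
   multiplication by [k] the excess is at most [s C]. *)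
pose C := k * (w + h + 1) + 1.
have C0 : 0 < C by rewrite ltr_wpDl// mulr_ge0//; lra.
pose s := Num.min 1 (e / C).
have s0 : 0 < s by rewrite lt_min ltr01 divr_gt0.
have s1 : s <= 1 by rewrite ge_min lexx.
have sC : s * C <= e by rewrite -ler_pdivlMr// ge_min lexx orbT.
have bound (v : R) : 0 < v -> v / (Num.truncn (v / s)).+1%:R <= s /\
    (Num.truncn (v / s)).+1%:R * s <= v + s.
  move=> v0; have q0 : 0 <= v / s by rewrite divr_ge0// ltW.
  have /andP[t1 t2] := truncn_itv q0; split.
    by rewrite ler_pdivrMr// mulrC -ler_pdivrMr// ltW.
  by rewrite -natr1 mulrDl mul1r lerD2r -ler_pdivlMr.
have [n1 n2] := bound _ w0; have [m1 m2] := bound _ h0.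
set n := (Num.truncn (w / s)).+1 in n1 n2; set m := (Num.truncn (h / s)).+1 in m1 m2.
apply: (@le_trans _ _ (n%:R * m%:R * (s ^+ 2 * k))%:E).
  apply: outer_measure_tiles => // i j.
  rewrite EFinM -HQE.
  apply: le_trans (hausdorff2_square (a + i%:R * (w / n%:R)) (b + j%:R * (h / m%:R)) s0).
  apply: le_hausdorff2 => -[x y] [/= /andP[xl xr] /andP[yl yr]].
  by rewrite /rectangle/= xl yl/= (le_trans xr) ?(le_trans yr) ?lerD2l.
rewrite -EFinD lee_fin.
have -> : n%:R * m%:R * (s ^+ 2 * k) = (n%:R * s) * (m%:R * s) * k by ring.
apply: (@le_trans _ _ ((w + s) * (h + s) * k)).
  by rewrite ler_wpM2r// ler_pM// mulr_ge0// ltW.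
have -> : (w + s) * (h + s) * k = k * (w * h) + s * (k * (w + h + s)) by ring.
rewrite lerD2l (le_trans _ sC)// ler_pM2l// /C.
by rewrite (@le_trans _ _ (k * (w + h + 1)))// ?lerDl// ler_wpM2l// lerD2l.
Qed.

(** In each of [n] vertical strips the corner lies in the rectangle above the lower end of the arc;
    the heights of these rectangles form a quarter-circle sum, with an error of order [1 / n]. *)
Let hausdorff2_corner_k (r : R) : 0 < r ->
  (H [set p | [/\ 0 <= p.1 <= r, 0 <= p.2 <= r & r ^+ 2 < p.1 ^+ 2 + p.2 ^+ 2]%R]
   <= (k * r ^+ 2 * (1 - pi / 4))%:E)%E.
Proof.
move=> r0; apply/lee_addgt0Pr => e e0; have {}e0 : 0 < (e : R) := e0.
pose n := (Num.truncn (k * r ^+ 2 / e)).+1.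
have n0 : 0 < n%:R :> R by rewrite ltr0n.
have ne : k * r ^+ 2 / n%:R <= e.
  by rewrite ler_pdivrMr// [leRHS]mulrC -ler_pdivrMr// ltW// truncnS_gt.
pose y (i : nat) : R := Num.sqrt (1 - (i%:R / n%:R) ^+ 2).
have yn i : (i < n)%N -> y i.+1 < 1.
  move=> iltn; rewrite -[ltRHS]sqrtr1 ltr_sqrt// ltrBlDr ltrDl exprn_gt0//.
  by rewrite divr_gt0.
pose F (i : nat) := rectangle (i%:R * (r / n%:R)) (r * y i.+1) (r / n%:R) (r * (1 - y i.+1)).
apply: (@le_trans _ _ (\sum_(i < n) H (F i))%E).
  apply: (@outer_measure_le_sum _ _ _ _ n F) => -[x z] /= [xI zI xz].
  have [//|i iltn /andP[xi1 xi2]] := @mesh R n r x _ r0 xI; exists i => //.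
  have yz : r * y i.+1 <= z.
    have [h|h] := leP 0 (1 - (i.+1%:R / n%:R) ^+ 2 : R); last first.
      rewrite /y ler0_sqrtr ?mulr0; last exact: ltW.
      by case/andP: zI.
    have z0 : 0 <= z by case/andP: zI.
    rewrite -ler_sqr ?nnegrE ?mulr_ge0 ?sqrtr_ge0 ?(ltW r0)// exprMn sqr_sqrtr//.
    have x2 : x ^+ 2 <= (i.+1%:R * (r / n%:R)) ^+ 2.
      by rewrite ler_sqr ?nnegrE ?mulr_ge0 ?divr_ge0 ?ler0n ?(ltW r0)//; case/andP: xI.
    have -> : r ^+ 2 * (1 - (i.+1%:R / n%:R) ^+ 2) = r ^+ 2 - (i.+1%:R * (r / n%:R)) ^+ 2.
      by field; rewrite gt_eqF.
    by lra.
  split=> /=; first by rewrite xi1/= (le_trans xi2)// -natr1 mulrDl mul1r.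
  by case/andP: zI => z0 z1; rewrite yz/=; lra.
have Fk (i : 'I_n) : (H (F i) <= (k * r ^+ 2 * (n%:R^-1 - y i.+1 / n%:R))%:E)%E.
  apply: le_trans (hausdorff2_rectangle_k _ _ _ _) _.
  - by rewrite divr_gt0.
  - by rewrite mulr_gt0// subr_gt0 yn.
  by rewrite lee_fin le_eqVlt; apply/orP; left; apply/eqP; ring.
apply: le_trans; first by apply: lee_sum => i _; exact: (Fk i).
rewrite sumEFin -EFinD lee_fin -mulr_sumr sumrB sumr_const card_ord -[_ *+ n]mulr_natl divff ?gt_eqF//.
have [_ q4] := @quarter_circle_sums R n isT.
(* The sum over right end points is the sum over left end points without its first term [1 / n],
   since [y 0 = 1] and [y n = 0]. *)
have shift : \sum_(i < n) y i.+1 / n%:R = \sum_(i < n) y i / n%:R - n%:R^-1.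
  rewrite -[in RHS](big_mkord xpredT (fun i => y i / n%:R)).
  rewrite big_nat_recl//= big_mkord -!(big_mkord xpredT (fun i => y i.+1 / n%:R)).
  rewrite [in LHS]big_nat_recr//=.
  by rewrite /y mul0r expr0n subr0 sqrtr1 divff ?gt_eqF// expr1n subrr sqrtr0 mul0r mul1r; ring.
rewrite shift.
apply: (@le_trans _ _ (k * r ^+ 2 * (1 - (pi / 4 - n%:R^-1)))).
  by apply: ler_wpM2l; [rewrite mulr_ge0 ?sqr_ge0|rewrite lerD2l lerN2 lerD2r].
have -> : k * r ^+ 2 * (1 - (pi / 4 - n%:R^-1)) =
  k * r ^+ 2 * (1 - pi / 4) + k * r ^+ 2 / n%:R by ring.
by rewrite lerD2l.
Qed.

Let hausdorff2_square_minus_disc_k (a b r : R) : 0 < r ->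
  (H (rectangle (a - r) (b - r) (2 * r) (2 * r) `\`
     [set p | (p.1 - a) ^+ 2 + (p.2 - b) ^+ 2 <= r ^+ 2]%R)
   <= (k * (2 * r) ^+ 2 * (1 - pi / 4))%:E)%E.
Proof.
move=> r0; set E := [set p : R * R | [/\ 0 <= p.1 <= r, 0 <= p.2 <= r & r ^+ 2 < p.1 ^+ 2 + p.2 ^+ 2]%R].
(* The two binary digits of [i] choose the signs of the coordinates, that is, the corner of the
   square. *)
pose sg (i : nat) : R := if odd i then -1 else 1.
have sg2 i : sg i ^+ 2 = 1 by rewrite /sg; case: ifP; rewrite ?sqrrN expr1n.
pose phi (i : nat) (p : R * R) : R * R := (a + sg i * p.1, b + sg i./2 * p.2).
apply: (@le_trans _ _ (\sum_(i < 4) H (phi i @` E))%E).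
  apply: (@outer_measure_le_sum _ _ _ _ 4 (fun i => phi i @` E)) => -[x y] [[/= xI yI] /negP]; rewrite -ltNge => xy.
  have gen i : (sg i * (x - a) = `|x - a|) -> (sg i./2 * (y - b) = `|y - b|) -> (phi i @` E) (x, y).
    move=> hx hy; exists (`|x - a|, `|y - b|); last first.
      rewrite /phi/= -hx -hy !mulrA -!expr2 !sg2 !mul1r.
      by congr pair; ring.
    rewrite /E/= !normr_ge0/= !real_normK ?num_real//; split=> //; rewrite ler_norml; lra.
  have [x0|x0] := leP 0 (x - a); have [y0|y0] := leP 0 (y - b).
  - by exists 0%N => //; apply: gen; rewrite /sg/= mul1r ger0_norm.
  - by exists 2%N => //; apply: gen; rewrite /sg/= ?mul1r ?mulN1r ?(ger0_norm x0) ?(ltr0_norm y0).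
  - by exists 1%N => //; apply: gen; rewrite /sg/= ?mul1r ?mulN1r ?(ltr0_norm x0) ?(ger0_norm y0).
  - by exists 3%N => //; apply: gen; rewrite /sg/= ?mul1r ?mulN1r ?(ltr0_norm x0) ?(ltr0_norm y0).
have Fk (i : 'I_4) : (H (phi i @` E) <= (k * r ^+ 2 * (1 - pi / 4))%:E)%E.
  apply: le_trans (hausdorff2_corner_k r0).
  apply: le_trans (@hausdorff2_lipschitz _ _ _ plane_dist plane_dist 1 (phi i) E ltr01 _) _.
    move=> p q _ _; rewrite mul1r; apply: plane_dist_le; first exact: sqrtr_ge0.
    rewrite sqr_sqrtr ?addr_ge0 ?sqr_ge0//= /phi/=.
    have -> : a + sg i * p.1 - (a + sg i * q.1) = sg i * (p.1 - q.1) by ring.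
    have -> : b + sg i./2 * p.2 - (b + sg i./2 * q.2) = sg i./2 * (p.2 - q.2) by ring.
    by rewrite !exprMn !sg2 !mul1r.
  by rewrite expr1n mul1e.
apply: le_trans (lee_sum_ord_cst Fk) _; rewrite lee_fin.
by rewrite le_eqVlt; apply/orP; left; apply/eqP; ring.
Qed.

(* Tiling the unit square by small squares and covering each of them by its
   inscribed disc and a remainder bounds its measure [k] by
   [pi / 4 + (1 - pi / 4) * k]. *)
Let k_le1 : k <= 1.
Proof.
suff : (H Q <= (pi / 4 + k * (1 - pi / 4))%:E)%E.
  rewrite HQE lee_fin => h; have := pi_gt0 R => p0.
  have p4 : 0 < pi / 4 :> R by rewrite divr_gt0.
  by rewrite -(ler_pM2r p4) mul1r; move: h; rewrite mulrBr mulr1; lra.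
apply: ge_ereal_sup => _ [d /= d0 <-].
pose n := (Num.truncn (1 / d)).+1.
have n0 : 0 < n%:R :> R by rewrite ltr0n.
have nd : n%:R^-1 <= d.
  by rewrite -[leLHS]mul1r ler_pdivrMr// mulrC -ler_pdivrMr// ltW// truncnS_gt.
pose r : R := (2 * n%:R)^-1.
have r0 : 0 < r by rewrite invr_gt0 mulr_gt0.
have r2 : 2 * r = n%:R^-1 by rewrite /r; field; rewrite gt_eqF.
have : (hausdorff2_preo plane_dist (PosNum d0) Q <=
    (n%:R * n%:R * (pi / 4 * n%:R^-1 ^+ 2 + k * n%:R^-1 ^+ 2 * (1 - pi / 4)))%:E)%E.
  apply: outer_measure_tiles => // i j; rewrite !mul1r !add0r.
  pose a := i%:R / n%:R + r; pose b := j%:R / n%:R + r.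
  pose D : set (R * R) := [set p | (p.1 - a) ^+ 2 + (p.2 - b) ^+ 2 <= r ^+ 2]%R.
  have -> : rectangle (i%:R / n%:R) (j%:R / n%:R) n%:R^-1 n%:R^-1 =
      rectangle (a - r) (b - r) (2 * r) (2 * r) by rewrite /a /b !addrK r2.
  apply: (@le_trans _ _ (hausdorff2_preo plane_dist (PosNum d0)
     (D `|` (rectangle (a - r) (b - r) (2 * r) (2 * r) `\` D)))).
    by apply: le_outer_measure => x Rx; have [Dx|nDx] := pselect (D x); [left|right].
  apply: le_trans (outer_measureU2 _ _ _) _; rewrite EFinD; apply: leeD.
    (* The inscribed disc enters as a single covering set of diameter [1 / n], whose cost is its
       Euclidean area by the normalisation [pi / 4]. Only the remainder is estimated through [k]. *)
    apply: hausdorff2_pre_diam; first by rewrite nd invr_ge0 ltW.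
    apply: diam_le; first by rewrite invr_ge0 ltW.
    move=> -[x y] [x' y'] /= h h'; apply: plane_dist_le; first by rewrite invr_ge0 ltW.
    rewrite -r2 exprMn/=.
    (* Parallelogram identity: two points within [r] of the centre are within [2 r] of each
       other. *)
    have e1 := sqr_ge0 ((x - a) + (x' - a)); have e2 := sqr_ge0 ((y - b) + (y' - b)).
    have -> : (x - x') ^+ 2 = 2 * (x - a) ^+ 2 + 2 * (x' - a) ^+ 2 - (x - a + (x' - a)) ^+ 2 by ring.
    have -> : (y - y') ^+ 2 = 2 * (y - b) ^+ 2 + 2 * (y' - b) ^+ 2 - (y - b + (y' - b)) ^+ 2 by ring.
    by rewrite /D/= in h h'; lra.
  apply: le_trans (hausdorff2_pre_le _ _ _) _ => //.
  by rewrite -r2; exact: hausdorff2_square_minus_disc_k.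
move=> /le_trans; apply; rewrite lee_fin le_eqVlt; apply/orP; left; apply/eqP.
by field; rewrite gt_eqF.
Qed.

Lemma hausdorff2_rectangle (a b w h : R) : 0 < w -> 0 < h ->
  (H (rectangle a b w h) <= (w * h)%:E)%E.
Proof.
move=> w0 h0; apply: le_trans (hausdorff2_rectangle_k _ _ w0 h0) _.
by rewrite lee_fin ler_piMl ?k_le1// mulr_ge0 ?ltW.
Qed.

End plane.

(** * Coordinates and reflections of the sphere *)

Section dot_product.
Context (R : realType).
Implicit Types (u v w : 'rV[R]_3) (p q e : sphere R).

Lemma dotC u v : dot u v = dot v u.
Proof. by apply: eq_bigr => i _; rewrite mulrC. Qed.

Lemma dotDl u v w : dot (u + v) w = dot u w + dot v w.
Proof. by rewrite /dot -big_split/=; apply: eq_bigr => i _; rewrite !mxE mulrDl. Qed.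

Lemma dotZl (a : R) u v : dot (a *: u) v = a * dot u v.
Proof. by rewrite /dot mulr_sumr; apply: eq_bigr => i _; rewrite !mxE mulrA. Qed.

Lemma dotDr u v w : dot u (v + w) = dot u v + dot u w.
Proof. by rewrite dotC dotDl !(dotC u). Qed.

Lemma dotZr (a : R) u v : dot u (a *: v) = a * dot u v.
Proof. by rewrite dotC dotZl dotC. Qed.

Lemma dotBl u v w : dot (u - v) w = dot u w - dot v w.
Proof. by rewrite dotDl -scaleN1r dotZl mulN1r. Qed.

Lemma dotBr u v w : dot u (v - w) = dot u v - dot u w.
Proof. by rewrite dotC dotBl !(dotC u). Qed.

Lemma dot_ge0 u : 0 <= dot u u.
Proof. by apply: sumr_ge0 => i _; rewrite -expr2 sqr_ge0. Qed.

Lemma dot_eq0 u : dot u u = 0 -> u = 0.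
Proof.
move=> /eqP; rewrite psumr_eq0 => [/allP h|i _]; last by rewrite -expr2 sqr_ge0.
apply/rowP => i; rewrite mxE; have := h i (mem_index_enum i).
by rewrite /= -expr2 sqrf_eq0 => /eqP.
Qed.

Lemma sdotC p q : sdot p q = sdot q p.
Proof. exact: dotC. Qed.

Lemma sdotpp p : sdot p p = 1.
Proof. exact: (eqP (valP p)). Qed.

Lemma sdistE p q : sdist p q = Num.sqrt (2 - 2 * sdot p q).
Proof.
rewrite /sdist !dotBl !dotBr; congr Num.sqrt.
rewrite -/(sdot p p) -/(sdot q q) -/(sdot p q) -/(sdot q p) !sdotpp (sdotC q p); ring.
Qed.

Lemma sdot_le1 p q : -1 <= sdot p q <= 1.
Proof.
have := dot_ge0 (val p - val q); have := dot_ge0 (val p + val q).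
rewrite !dotBl !dotBr !dotDl !dotDr.
rewrite -/(sdot p p) -/(sdot q q) -/(sdot p q) -/(sdot q p) !sdotpp (sdotC q p) => h1 h2.
lra.
Qed.

Lemma dot_sqr_le u v : dot u v ^+ 2 <= dot u u * dot v v.
Proof.
have [/eqP v0|v0] := eqVneq (dot v v) 0.
  by rewrite (dot_eq0 (eqP v0)) -(scale0r 0) !dotZr !mul0r expr0n mulr0.
have vp : 0 < dot v v by rewrite lt_def v0 dot_ge0.
have := dot_ge0 (u - (dot u v / dot v v) *: v).
rewrite !dotBl !dotBr !dotZl !dotZr (dotC v u) => h.
rewrite -ler_pdivrMr// -subr_ge0; apply: le_trans h _.
by rewrite le_eqVlt; apply/orP; left; apply/eqP; field.
Qed.

Lemma sdot_lipschitz e p q : sdot p e - sdot q e <= sdist p q.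
Proof.
apply: le_trans (ler_norm _) _; rewrite /sdist -sqrtr_sqr ler_wsqrtr//.
rewrite /sdot -dotBl (le_trans (dot_sqr_le _ _))// -/(sdot e e) sdotpp mulr1//.
Qed.

Lemma reflection_subproof w p :
  dot (val p - (2 * dot (val p) w / dot w w) *: w)
      (val p - (2 * dot (val p) w / dot w w) *: w) == 1.
Proof.
rewrite !dotBl !dotBr !dotZl !dotZr -/(sdot p p) sdotpp (dotC w (val p)).
have [->|w0] := eqVneq (dot w w) 0; first by rewrite invr0 !mulr0 !mul0r !subr0.
by apply/eqP; field.
Qed.

(* For [w = 0] this is the identity since [x / 0 = 0]. *)
Definition reflection w p : sphere R :=
  exist (fun u => dot u u == 1) _ (reflection_subproof w p).

Lemma sdot_reflection w p q : sdot (reflection w p) (reflection w q) = sdot p q.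
Proof.
rewrite /sdot/= !dotBl !dotBr !dotZl !dotZr (dotC w (val q)).
have [->|w0] := eqVneq (dot w w) 0; first by rewrite invr0 !mulr0 !mul0r !subr0.
by field.
Qed.

Lemma sdot_reflectionl w p q : sdot (reflection w p) q =
  sdot p q - 2 * dot (val p) w / dot w w * dot w (val q).
Proof. by rewrite /sdot/= dotBl dotZl. Qed.

Lemma sdot_reflection_self e p : sdot (reflection (val e) p) e = - sdot p e.
Proof.
rewrite sdot_reflectionl -/(sdot p e) -/(sdot e e) sdotpp divr1 mulr1; ring.
Qed.

Lemma reflectionK w : involutive (reflection w).
Proof.
move=> p; apply: val_inj => /=; rewrite dotBl dotZl.
have [w0|w0] := eqVneq (dot w w) 0; first by rewrite w0 invr0 !mulr0 !scale0r !subr0.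
rewrite -addrA -opprD -scalerDl.
have -> : 2 * dot (val p) w / dot w w + 2 * (dot (val p) w - 2 * dot (val p) w / dot w w * dot w w) / dot w w = 0 by field.
by rewrite scale0r subr0.
Qed.

Lemma sdist_reflection w p q : sdist (reflection w p) (reflection w q) = sdist p q.
Proof. by rewrite !sdistE sdot_reflection. Qed.

(** Reflection in the plane bisecting [p] and [q]; if [p = q] the normal vanishes and the reflection
    is the identity. Any axis can thus be exchanged for any other without changing areas. *)
Lemma reflection_swap p q : reflection (val p - val q) p = q.
Proof.
apply: val_inj => /=; rewrite dotBr !dotBl !dotBr.
rewrite -/(sdot p p) -/(sdot q q) -/(sdot p q) -/(sdot q p) !sdotpp (sdotC q p).
have [pq|pq] := eqVneq (sdot p q) 1.
  have : dot (val p - val q) (val p - val q) = 0.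
    rewrite !dotBl !dotBr -/(sdot p p) -/(sdot q q) -/(sdot p q) -/(sdot q p).
    by rewrite !sdotpp (sdotC q p) pq; ring.
  by move=> /dot_eq0 pq0; rewrite pq0 scaler0 subr0; apply/eqP; rewrite -subr_eq0 pq0.
have -> : 2 * (1 - sdot p q) / (1 - sdot p q - (sdot p q - 1)) = 1.
  rewrite (_ : 1 - sdot p q - _ = 2 * (1 - sdot p q)); last by ring.
  by rewrite divff// mulf_neq0// ?pnatr_eq0// subr_eq0 eq_sym.
by rewrite scale1r opprB addrC subrK.
Qed.

(** An isometry is 1-Lipschitz, which gives one inequality; the involution turns it into the
    other. *)
Lemma area_reflection w (A : set (S2 R)) :
  area (reflection w @^-1` A) = area A.
Proof.
have im B : reflection w @^-1` B = reflection w @` B.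
  apply/seteqP; split => p /=; first by exists (reflection w p) => //; rewrite reflectionK.
  by move=> [q Bq <-]; rewrite reflectionK.
have le B : (area (reflection w @^-1` B) <= area B)%E.
  rewrite im; apply: le_trans (@hausdorff2_lipschitz _ _ _ (@sdist R) (@sdist R) 1
    (reflection w) B ltr01 _) _; last by rewrite expr1n mul1e.
  by move=> p q _ _; rewrite sdist_reflection mul1r.
apply/eqP; rewrite eq_le le/=; apply: le_trans (le _).
by rewrite -comp_preimage (_ : _ \o _ = id)//; apply/funext => p /=; rewrite reflectionK.
Qed.

Lemma measurable_S2 (A : set (S2 R)) :
  measurable A <-> (hausdorff2 (@sdist R)).-caratheodory A.
Proof. by []. Qed.

(** The Caratheodory condition involves only the outer measure, which reflections preserve. *)
Lemma measurable_reflection w :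
  measurable_fun [set: S2 R] (reflection w : S2 R -> S2 R).
Proof.
move=> _ A mA; rewrite setTI; apply/measurable_S2 => X.
have /measurable_S2/(_ (reflection w @^-1` X)) := mA.
have KK B : reflection w @^-1` (reflection w @^-1` B) = B.
  by apply/seteqP; split => p; rewrite /= reflectionK.
have HE B : hausdorff2 (@sdist R) B = hausdorff2 (@sdist R) (reflection w @^-1` B).
  by apply/esym; exact: area_reflection.
rewrite -HE => ->; congr (_ + _)%E; rewrite [RHS]HE preimage_setI ?KK//.
by rewrite -preimage_setC KK.
Qed.

Lemma measurable_sdot e : measurable_fun [set: S2 R] (fun p : S2 R => sdot p e).
Proof.
apply: (measurability _ (measurable_realfun.RGenOInfty.measurableE R)) => _ [_ [c ->] <-].
rewrite setTI (_ : _ @^-1` _ = ~` [set p : S2 R | sdot p e <= c]); last first.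
  by apply/seteqP; split => p /=; rewrite in_itv/= andbT ltNge => /negP.
apply: measurableC; apply/measurable_S2.
by apply: (@lipschitz_caratheodory _ _ (@sdist R) (fun p => sdot p e)) => p q; exact: sdot_lipschitz.
Qed.

End dot_product.

(** * Latitude and longitude *)

Section spherical_coordinates.
Context (R : realType).

Definition vec3 (a b c : R) : 'rV[R]_3 := \row_i nth 0 [:: a; b; c] i.

Lemma dot_vec3 a b c a' b' c' :
  dot (vec3 a b c) (vec3 a' b' c') = a * a' + b * b' + c * c'.
Proof. by rewrite /dot !big_ord_recr big_ord0/= !mxE/= add0r. Qed.

Lemma vec3E (u : 'rV[R]_3) : u = vec3 (u 0 0) (u 0 1) (u 0 2).
Proof.
apply/rowP => -[[|[|[|//]]] i3]; rewrite mxE/=; congr (u _ _); exact: val_inj.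
Qed.

Lemma sph_subproof (a t : R) :
  dot (vec3 (cos a * cos t) (cos a * sin t) (sin a))
      (vec3 (cos a * cos t) (cos a * sin t) (sin a)) == 1.
Proof.
rewrite dot_vec3; apply/eqP; have := cos2Dsin2 a; have := cos2Dsin2 t => ht ha.
transitivity (cos a ^+ 2 * (cos t ^+ 2 + sin t ^+ 2) + sin a ^+ 2); first by ring.
by rewrite ht mulr1.
Qed.

(** [a] is the latitude and [t] the longitude. *)
Definition sph (a t : R) : sphere R :=
  exist (fun u => dot u u == 1) _ (sph_subproof a t).

Lemma axis_subproof (i : 'I_3) : dot (delta_mx 0 i : 'rV[R]_3) (delta_mx 0 i) == 1.
Proof.
rewrite /dot (bigD1 i)//= big1 ?addr0 ?mxE ?eqxx ?mulr1// => j ji.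
by rewrite !mxE (negbTE ji) mulr0.
Qed.

Definition axis (i : 'I_3) : sphere R :=
  exist (fun u => dot u u == 1) _ (axis_subproof i).

Lemma sdot_axis (p : sphere R) i : sdot p (axis i) = val p 0 i.
Proof.
rewrite /sdot /dot/= (bigD1 i)//= big1 ?addr0 ?mxE ?eqxx ?mulr1// => j ji.
by rewrite mxE (negbTE ji) andbF mulr0.
Qed.

Lemma sdot_sph_axis a t : [/\ sdot (sph a t) (axis 0) = cos a * cos t,
  sdot (sph a t) (axis 1) = cos a * sin t & sdot (sph a t) (axis 2) = sin a].
Proof. by split; rewrite sdot_axis mxE. Qed.

(** Haversine formula: a latitude term, plus a longitude term weighted by the radii of the two
    parallels. *)
Lemma sdist_sph a t a' t' : sdist (sph a t) (sph a' t') ^+ 2 =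
  4 * sin ((a - a') / 2) ^+ 2 + 4 * (cos a * cos a') * sin ((t - t') / 2) ^+ 2.
Proof.
have /andP[_ le1] := sdot_le1 (sph a t) (sph a' t').
rewrite sdistE sqr_sqrtr; last by lra.
rewrite /sdot/= dot_vec3.
have half (x : R) : 2 * sin (x / 2) ^+ 2 = 1 - cos x.
  have -> : cos x = cos (x / 2) ^+ 2 *+ 2 - 1.
    by rewrite -cos_mulr2n mulr2n -splitr.
  by have := cos2Dsin2 (x / 2); lra.
have -> : 4 * sin ((a - a') / 2) ^+ 2 = 2 * (1 - cos (a - a')) by rewrite -half; ring.
have -> : 4 * (cos a * cos a') * sin ((t - t') / 2) ^+ 2 =
  2 * (cos a * cos a') * (1 - cos (t - t')) by rewrite -half; ring.
by rewrite !cosB; ring.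
Qed.

Lemma sph_surj (p : sphere R) : 0 <= sdot p (axis 1) ->
  exists a t, [/\ - (pi / 2) <= a <= pi / 2, 0 <= t <= pi & p = sph a t].
Proof.
rewrite sdot_axis; have := sdotpp p; rewrite /sdot {1 2}(vec3E (val p)) dot_vec3.
set x := val p 0 0; set y := val p 0 1; set z := val p 0 2 => xyz y0.
have z1 : -1 <= z <= 1.
  by rewrite -ler_norml -(@expr_le1 _ 2)// real_normK ?num_real//; have := sqr_ge0 x; have := sqr_ge0 y; rewrite !expr2; lra.
have ca : cos (asin z) = Num.sqrt (x ^+ 2 + y ^+ 2).
  by rewrite cos_asin//; congr Num.sqrt; rewrite !expr2; lra.
have [r0|r0] := eqVneq (x ^+ 2 + y ^+ 2) 0.
  have x0 : x = 0.
    by apply/eqP; rewrite -sqrf_eq0; have := sqr_ge0 x; have := sqr_ge0 y; have := r0 => h1 h2 h3; apply/eqP; lra.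
  have y0' : y = 0.
    by apply/eqP; rewrite -sqrf_eq0; have := sqr_ge0 x; have := sqr_ge0 y; have := r0 => h1 h2 h3; apply/eqP; lra.
  (* At the poles the longitude is arbitrary; 0 is taken. *)
  exists (asin z), 0; split; rewrite ?asin_geNpi2 ?asin_lepi2 ?lexx ?pi_ge0//.
  apply: val_inj; rewrite /= [LHS]vec3E -/x -/y -/z ca r0 sqrtr0 !mul0r x0 y0'.
  by rewrite asinK// in_itv.
pose r := Num.sqrt (x ^+ 2 + y ^+ 2).
have rp : 0 < r by rewrite sqrtr_gt0 lt_def r0 addr_ge0// sqr_ge0.
have r2 : r ^+ 2 = x ^+ 2 + y ^+ 2 by rewrite sqr_sqrtr// addr_ge0// sqr_ge0.
have xr : -1 <= x / r <= 1.
  rewrite -ler_norml -(@expr_le1 _ 2)// real_normK ?num_real// expr_div_n.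
  by rewrite ler_pdivrMr ?exprn_gt0// mul1r r2 lerDl sqr_ge0.
exists (asin z), (acos (x / r)); split.
- by rewrite asin_geNpi2 ?asin_lepi2.
- by rewrite acos_ge0 ?acos_lepi.
apply: val_inj; rewrite /= [LHS]vec3E -/x -/y -/z ca -/r.
rewrite acosK ?in_itv// sin_acos// asinK ?in_itv//.
have -> : 1 - (x / r) ^+ 2 = (y / r) ^+ 2.
  by rewrite !expr_div_n; apply/eqP; rewrite subr_eq addrC -mulrDl -r2 divff// gt_eqF// exprn_gt0.
rewrite sqrtr_sqr ger0_norm; last by rewrite divr_ge0// ltW.
by rewrite !(mulrC r) !divfK// gt_eqF.
Qed.

Lemma cos_lipschitz (a b : R) : a <= b -> `|cos b - cos a| <= b - a.
Proof.
move=> ab; rewrite ler_norml; apply/andP; split.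
  have : a + cos a <= b + cos b; last by lra.
  apply: (@is_derive_le R (fun t => t + cos t) (fun t => 1 - sin t)) => // t _.
have : a - cos a <= b - cos b; last by lra.
apply: (@is_derive_le R (fun t => t - cos t) (fun t => 1 + sin t)) => // t.
by apply: is_derive_eq; rewrite opprK.
Qed.

Lemma cos_mul_le_sinB (a b : R) : a <= b -> (cos a - (b - a)) * (b - a) <= sin b - sin a.
Proof.
move=> ab; pose m := cos a - (b - a).
have : sin a - m * a <= sin b - m * b; last by rewrite -/m mulrBr; lra.
apply: (@is_derive_le R (fun t => sin t - m * t) (fun t => cos t - m)) => // t.
  by apply: is_derive_eq; rewrite /GRing.scale/= mulr1.
move=> /andP[at_ tb]; have := cos_lipschitz at_; rewrite ler_norml /m => /andP[h _].
lra.
Qed.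

End spherical_coordinates.

(** * Areas of spherical bands *)

Section area_upper_bound.
Context (R : realType).

Definition strip (a w : R) : set (sphere R) :=
  [set p | exists b t : R, [/\ a <= b <= a + w, 0 <= t <= pi & p = sph b t]].

(** Scaling longitudes by [cos a + w], an upper bound for the radii of the parallels in the strip,
    turns it into a planar rectangle, from which the map [psi] to the sphere is 1-Lipschitz. *)
Lemma area_strip (a w : R) : 0 < w -> - (pi / 2) <= a -> a + w <= pi / 2 ->
  (hausdorff2 (@sdist R) (strip a w) <=
   (w * (pi * (cos a + w)))%:E)%E.
Proof.
move=> w0 a0 aw; have pi0 : 0 < pi :> R := pi_gt0 R.
have ca : 0 <= cos a by rewrite cos_ge0_pihalf// a0/= (le_trans _ aw)// lerDl ltW.
have M0 : 0 < cos a + w by rewrite ltr_wpDl.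
have cM b : a <= b <= a + w -> 0 <= cos b <= cos a + w.
  move=> /andP[ab baw]; rewrite cos_ge0_pihalf/=; last first.
    by rewrite (le_trans a0)// (le_trans baw).
  have := cos_lipschitz ab; rewrite ler_norml => /andP[_ h].
  by move: h baw; lra.
pose psi (q : R * R) : sphere R := sph q.1 (q.2 / (cos a + w)).
have h0 : 0 < pi * (cos a + w) by rewrite mulr_gt0.
apply: le_trans (hausdorff2_rectangle a 0 w0 h0).
rewrite -[leRHS]mul1e -[X in (X%:E * _)%E](expr1n _ 2).
apply: le_trans (@hausdorff2_lipschitz _ _ _ (@plane_dist R) (@sdist R) 1 psi _ ltr01 _).
  apply: le_hausdorff2 => _ [b [t [ab t0 ->]]].
  exists (b, t * (cos a + w)); last by rewrite /psi/= mulfK// gt_eqF.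
  split => //=; case/andP: t0 => t0 tpi; rewrite mulr_ge0 ?(ltW M0)//= add0r.
  by rewrite ler_pM2r.
move=> [b t] [b' t'] [/= bI _] [/= bI' _]; rewrite mul1r.
rewrite -ler_sqr ?nnegrE ?sqrtr_ge0// sdist_sph /plane_dist sqr_sqrtr ?addr_ge0 ?sqr_ge0//=.
have /andP[c0 c1] := cM _ bI; have /andP[c0' c1'] := cM _ bI'.
have s1 := sqr_sin_le ((b - b') / 2).
have s2 := sqr_sin_le ((t / (cos a + w) - t' / (cos a + w)) / 2).
apply: lerD; first by move: s1; rewrite expr_div_n; lra.
have cc : cos b * cos b' <= (cos a + w) ^+ 2 by rewrite expr2 ler_pM.
apply: (@le_trans _ _ (4 * (cos b * cos b') * ((t / (cos a + w) - t' / (cos a + w)) / 2) ^+ 2)).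
  by rewrite ler_wpM2l// !mulr_ge0.
have -> : ((t / (cos a + w) - t' / (cos a + w)) / 2) ^+ 2 = (t - t') ^+ 2 / (4 * (cos a + w) ^+ 2).
  by field; rewrite gt_eqF.
rewrite mulrA ler_pdivrMr; last by rewrite mulr_gt0// exprn_gt0.
by rewrite [leLHS]mulrC ler_wpM2l ?sqr_ge0// ler_pM2l.
Qed.

Lemma area_half_le : (hausdorff2 (@sdist R) [set p | (0 <= sdot p (axis R 1%R))%R]
  <= (2 * pi)%:E)%E.
Proof.
have pi0 : 0 < pi :> R := pi_gt0 R.
apply/lee_addgt0Pr => e' e0'; have [e e0 ->] : exists2 e : R, 0 < e & e' = e by exists e'.
(* The bounds for [n] strips of height [w = pi / n] add up to a telescoping [2 pi] plus the error
   [2 pi^2 w]. *)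
pose n := (Num.truncn (2 * pi ^+ 3 / e)).+1.
have n0 : 0 < n%:R :> R by rewrite ltr0n.
pose w : R := pi / n%:R.
have w0 : 0 < w by rewrite divr_gt0.
have we : 2 * pi ^+ 2 * w <= e.
  rewrite /w mulrA ler_pdivrMr// [leRHS]mulrC -ler_pdivrMr// ltW//.
  by rewrite -mulrA -exprSr truncnS_gt.
pose al (i : nat) : R := - (pi / 2) + i%:R * w.
have alS i : al i.+1 = al i + w by rewrite /al -natr1; ring.
have aln : al n = pi / 2 by rewrite /al /w; field; rewrite gt_eqF.
pose F (i : nat) := strip (al i) w.
apply: (@le_trans _ _ (\sum_(i < n) hausdorff2 (@sdist R) (F i))%E).
  apply: (@outer_measure_le_sum _ _ (hausdorff2 (@sdist R)) _ n F) => p /= y0.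
  have [a [t [aI tI ->]]] := sph_surj y0.
  have [||i iltn aI'] := @mesh R n pi (a + pi / 2) _ pi0; [by []|by lra|].
  exists i => //; exists a, t; split => //; rewrite -alS /al -/w in aI' *.
  by lra.
have Fi (i : 'I_n) : (hausdorff2 (@sdist R) (F i) <= (w * (pi * (cos (al i) + w)))%:E)%E.
  apply: area_strip => //.
    by rewrite /al lerDl mulr_ge0// ltW.
  by rewrite -alS -aln /al lerD2l ler_pM2r// ler_nat.
apply: le_trans; first by apply: lee_sum => i _; exact: Fi.
rewrite sumEFin -EFinD lee_fin.
have step (i : 'I_n) : w * (pi * (cos (al i) + w)) <=
    pi * (sin (al i.+1) - sin (al i)) + 2 * pi * w ^+ 2.
  have := @cos_mul_le_sinB R (al i) (al i.+1).
  rewrite alS lerDl (ltW w0) => /(_ isT); rewrite addrAC subrr add0r => h.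
  rewrite -(ler_pM2l pi0) in h; move: h; rewrite mulrBl mulrBr -expr2 => h.
  by rewrite expr2 in h *; lra.
apply: le_trans; first by apply: ler_sum => i _; exact: step.
rewrite big_split/= -mulr_sumr sumr_const card_ord.
rewrite -(big_mkord xpredT (fun i => sin (al i.+1) - sin (al i))) telescope_sumr// aln.
rewrite /al mul0r addr0 sinN sin_pihalf.
have -> : 2 * pi * w ^+ 2 *+ n = 2 * pi ^+ 2 * w.
  by rewrite -mulr_natr /w; field; rewrite gt_eqF.
lra.
Qed.

Lemma area_sphere_le : (area [set: S2 R] <= (4 * pi)%:E)%E.
Proof.
pose H := hausdorff2 (@sdist R).
pose A := [set p : sphere R | 0 <= sdot p (axis R 1%R)].
have : (H [set: sphere R] <= H A + H (reflection (val (axis R 1%R)) @^-1` A))%E.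
  apply: le_trans (outer_measureU2 _ _ _); apply: le_hausdorff2 => p _.
  have [h|h] := leP 0 (sdot p (axis R 1%R)); [by left|right].
  change (0 <= sdot (reflection (val (axis R 1)) p) (axis R 1))%R.
  by rewrite sdot_reflection_self oppr_ge0 ltW.
move=> /le_trans; apply; rewrite [X in (_ + X)%E]area_reflection.
have -> : 4 * pi = 2 * pi + 2 * pi :> R by ring.
by rewrite EFinD; apply: leeD; exact: area_half_le.
Qed.

End area_upper_bound.

(** * Widths of subsets of the line *)

Section widths.
Context (R : realType).
Implicit Types (A B : set R).

(* [width set0 = 0] because [sup set0 = inf set0 = 0]. *)
Definition width A : R := sup A - inf A.

Lemma width_set0 : width set0 = 0 :> R.
Proof. by rewrite /width sup0 inf0 subrr. Qed.

(** Add [sup A - inf B <= K] and [sup B - inf A <= K]. For two slices of one set this does the work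
    of Steiner symmetrisation. *)
Lemma widthD_le A B (K : R) : A !=set0 -> B !=set0 ->
  (forall x y, A x -> B y -> `|x - y| <= K) -> width A + width B <= 2 * K.
Proof.
move=> A0 B0 AB.
have supA : sup A <= inf B + K.
  apply: ge_sup => // x Ax; rewrite -lerBlDr; apply: lb_le_inf => // y By.
  by have := AB _ _ Ax By; rewrite ler_norml => /andP[_ h]; lra.
have supB : sup B <= inf A + K.
  apply: ge_sup => // y By; rewrite -lerBlDr; apply: lb_le_inf => // x Ax.
  by have := AB _ _ Ax By; rewrite ler_norml => /andP[h _]; lra.
by rewrite /width; lra.
Qed.

Lemma width_hull A (r : R) : A !=set0 -> (forall x y, A x -> A y -> `|x - y| <= r) ->
  A `<=` `[inf A, sup A] /\ width A <= r.
Proof.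
move=> A0 Ar; split; last by have := widthD_le A0 A0 Ar; lra.
move=> x Ax; rewrite /= in_itv/=; apply/andP; split.
  apply: ge_inf => //; exists (x - r) => y Ay.
  by have := Ar _ _ Ax Ay; rewrite ler_norml => /andP[_ h]; lra.
apply: ub_le_sup => //; exists (x + r) => y Ay.
by have := Ar _ _ Ax Ay; rewrite ler_norml => /andP[h _]; lra.
Qed.

Lemma width_ge0 A (r : R) : (forall x y, A x -> A y -> `|x - y| <= r) -> 0 <= width A.
Proof.
move=> Ar; have [->|/set0P A0] := eqVneq A set0; first by rewrite width_set0.
have [AI _] := width_hull A0 Ar; case: A0 => x /AI; rewrite /= in_itv/= => /andP[h1 h2].
by rewrite subr_ge0 (le_trans h1).
Qed.

(** Covering sets are arbitrary, so their slices need not be measurable; the closed hull is. *)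
Lemma width_cover A (r : R) : (forall x y, A x -> A y -> `|x - y| <= r) ->
  exists I : set R, [/\ measurable I, A `<=` I & (lebesgue_measure I = (width A)%:E)%E].
Proof.
move=> Ar; have [->|/set0P A0] := eqVneq A set0.
  by exists set0; split => //; rewrite measure0 width_set0.
have [AI _] := width_hull A0 Ar; have w0 := width_ge0 Ar.
exists `[inf A, sup A]%classic; split => //.
rewrite lebesgue_measure_itv/= lte_fin; case: ltP => // h.
by congr (_%:E); apply/eqP; rewrite eq_le w0 /width subr_le0.
Qed.

End widths.

(** * An isodiametric inequality in latitude and longitude *)

Section isodiametric.
Context (R : realType).

Lemma mul_le_sqr_mean (u v k : R) : (u + v) ^+ 2 <= (2 * k) ^+ 2 -> u * v <= k ^+ 2.
Proof. by have := sqr_ge0 (u - v); rewrite !expr2; lra. Qed.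

(** From [(y / 2) cos (y / 2) <= sin (y / 2)] follows [x^2 <= (4 + x^2) sin^2 (x / 2)]. With
    [pi < 4] this first yields [x^2 <= 5 d^2], which is then put back into the factor [4 + x^2]. *)
Lemma sqr_le_chord (x d : R) : `|x| <= pi -> 4 * sin (x / 2) ^+ 2 <= d ^+ 2 ->
  x ^+ 2 <= (1 + 2 * d ^+ 2) * (4 * sin (x / 2) ^+ 2).
Proof.
move=> xpi h.
have main (y : R) : 0 <= y <= pi -> y ^+ 2 <= (4 + y ^+ 2) * sin (y / 2) ^+ 2.
  move=> /andP[y0 ypi]; have y20 : 0 <= y / 2 by rewrite divr_ge0.
  have y2 : y / 2 <= pi / 2 by rewrite ler_pM2r.
  have c0 : 0 <= cos (y / 2).
    by apply: cos_ge0_pihalf; rewrite y2 andbT (le_trans _ y20)// oppr_le0 divr_ge0 ?pi_ge0.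
  have := @mul_cos_le_sin R (y / 2); rewrite y20 (le_trans y2) => [/(_ isT) hc|]; last first.
    by rewrite ler_pdivrMr// ler_peMr ?pi_ge0// ler1n.
  have : (y / 2 * cos (y / 2)) ^+ 2 <= sin (y / 2) ^+ 2.
    by rewrite ler_sqr ?nnegrE ?mulr_ge0// (le_trans _ hc)// mulr_ge0.
  have := cos2Dsin2 (y / 2); move: (sin _) (cos _) => s c cs.
  have -> : (y / 2 * c) ^+ 2 = y ^+ 2 / 4 * (1 - s ^+ 2).
    by rewrite -[X in X - _]cs addrK; field.
  by rewrite mulrDl mulrBr mulr1; lra.
have {main} : x ^+ 2 <= (4 + x ^+ 2) * sin (x / 2) ^+ 2.
  have := main `|x|; rewrite normr_ge0 xpi => /(_ isT).
  rewrite real_normK ?num_real//; have [x0|x0] := leP 0 x.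
    by rewrite ger0_norm.
  by rewrite ltr0_norm// mulNr sinN sqrrN.
have pi4 : pi < 4 :> R by have /andP[_] := pihalf_02 R; rewrite ltr_pdivrMr//; lra.
have x16 : x ^+ 2 <= 16.
  have -> : 16 = 4 ^+ 2 :> R by ring.
  rewrite -[leLHS]real_normK ?num_real// ler_sqr ?nnegrE//.
  by rewrite (le_trans xpi)// ltW.
have := sqr_ge0 (sin (x / 2)); move: h x16; move: (sin _ ^+ 2) (d ^+ 2) (x ^+ 2) => s D X.
move=> h x16 s0 hX.
have X5 : X <= 5 * D.
  apply: (le_trans hX); apply: (@le_trans _ _ ((4 + 16) * s)); last by lra.
  by rewrite ler_wpM2r// lerD2l.
apply: (le_trans hX); have -> : (1 + 2 * D) * (4 * s) = (4 + 8 * D) * s by ring.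
by rewrite ler_wpM2r//; lra.
Qed.

Variables (a0 a1 c : R).
Hypotheses (ha0 : - (pi / 2) <= a0) (ha1 : a1 <= pi / 2) (c0 : 0 < c) (c1 : c <= 1).
Hypothesis (hc : forall a, a0 <= a <= a1 -> c <= cos a).

Definition slice (U : set (sphere R)) (a : R) : set R :=
  [set t | 0 < t < pi /\ U (sph a t)].

Section one_set.
Variables (U : set (sphere R)) (d e D : R).
Hypotheses (d0 : 0 <= d) (Ud : (diam (@sdist R) U <= d%:E)%E)
  (he : 2 * d ^+ 2 / c ^+ 2 <= e) (D0 : 0 <= D) (D2 : D ^+ 2 = (1 + e) * d ^+ 2).

(** Up to the factor [1 + e] the chord dominates the distance in latitude and rescaled longitude.
    The longitude chord is bounded only after division by [cos a * cos a' >= c^2], hence the form of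
    [he]. *)
Let coords_close a a' t t' : a0 <= a <= a1 -> a0 <= a' <= a1 ->
  slice U a t -> slice U a' t' ->
  (a - a') ^+ 2 + cos a * cos a' * (t - t') ^+ 2 <= D ^+ 2.
Proof.
move=> aI aI' [tI Ut] [tI' Ut'].
have ca := hc aI; have ca' := hc aI'.
have cc : c ^+ 2 <= cos a * cos a' by rewrite expr2 ler_pM// ltW.
have cc0 : 0 < cos a * cos a' by apply: lt_le_trans cc; rewrite exprn_gt0.
have c20 : 0 < c ^+ 2 by rewrite exprn_gt0.
have c21 : c ^+ 2 <= 1 by rewrite expr_le1// ltW.
have : sdist (sph a t) (sph a' t') ^+ 2 <= d ^+ 2.
  rewrite ler_sqr ?nnegrE ?sqrtr_ge0// -lee_fin.
  exact: le_trans (dist_le_diam _ Ut Ut') Ud.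
rewrite sdist_sph.
have pi0 : 0 < pi :> R := pi_gt0 R.
have s1 : 0 <= 4 * sin ((a - a') / 2) ^+ 2 by rewrite mulr_ge0// sqr_ge0.
have s2 : 0 <= 4 * sin ((t - t') / 2) ^+ 2 by rewrite mulr_ge0// sqr_ge0.
have -> : 4 * (cos a * cos a') * sin ((t - t') / 2) ^+ 2 =
  (cos a * cos a') * (4 * sin ((t - t') / 2) ^+ 2) by ring.
move=> h.
have h1 : (a - a') ^+ 2 <= (1 + e) * (4 * sin ((a - a') / 2) ^+ 2).
  apply: le_trans (sqr_le_chord (d := d) _ _) _.
  - by rewrite ler_norml; move: aI aI' ha0 ha1; lra.
  - by apply: le_trans h; rewrite lerDl mulr_ge0// ltW.
  rewrite ler_wpM2r// lerD2l (le_trans _ he)//.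
  by rewrite ler_pdivlMr// ler_piMr// mulr_ge0// sqr_ge0.
have h2 : (t - t') ^+ 2 <= (1 + e) * (4 * sin ((t - t') / 2) ^+ 2).
  apply: le_trans (sqr_le_chord (d := d / c) _ _) _.
  - by rewrite ler_norml; move: tI tI'; lra.
  - rewrite expr_div_n ler_pdivlMr// mulrC; apply: le_trans (ler_wpM2r s2 cc) _.
    by apply: le_trans h; rewrite lerDr.
  by rewrite ler_wpM2r// lerD2l expr_div_n mulrA.
rewrite D2; apply: le_trans (_ : _ <= (1 + e) * _) _; last first.
  apply: ler_wpM2l h; rewrite addr_ge0// (le_trans _ he)//.
  by apply: divr_ge0; [rewrite mulr_ge0// sqr_ge0|exact: ltW].
rewrite mulrDr; apply: lerD => //.
by rewrite [leRHS]mulrCA ler_pM2l.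
Qed.

(** Length, along its parallel, of the hull of the slice at latitude [a]. *)
Let M a := cos a * width (slice U a).

Let slice_bounded a t t' : slice U a t -> slice U a t' -> `|t - t'| <= pi.
Proof. by move=> [h _] [h' _]; rewrite ler_norml; lra. Qed.

Let M_ge0 a : a0 <= a <= a1 -> 0 <= M a.
Proof.
move=> aI; apply: mulr_ge0; first by rewrite (le_trans (ltW c0))// hc.
by apply: width_ge0 => t t'; exact: slice_bounded.
Qed.

(** [K] is the largest longitude difference that [coords_close] allows; the two widths sum to at
    most [2 K], so their product is at most [K^2]. Hence latitudes where [M >= y] lie within
    [sqrt (D^2 - y^2)] of each other, as in a disc of diameter [D]. *)
Let M_close a a' : a0 <= a <= a1 -> a0 <= a' <= a1 ->
  slice U a !=set0 -> slice U a' !=set0 -> (a - a') ^+ 2 + M a * M a' <= D ^+ 2.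
Proof.
move=> aI aI' Sa Sa'.
have cc0 : 0 < cos a * cos a'.
  by rewrite mulr_gt0// (lt_le_trans c0)// hc.
pose K : R := Num.sqrt ((D ^+ 2 - (a - a') ^+ 2) / (cos a * cos a')).
have K0 : 0 <= D ^+ 2 - (a - a') ^+ 2.
  case: Sa Sa' => t St [t' St'].
  have := coords_close aI aI' St St'; have := sqr_ge0 (t - t') => h0.
  by have := mulr_ge0 (ltW cc0) h0; lra.
have K2 : K ^+ 2 = (D ^+ 2 - (a - a') ^+ 2) / (cos a * cos a').
  by rewrite sqr_sqrtr// divr_ge0// ltW.
have := @widthD_le R _ _ K Sa Sa' => wK.
have {}wK : width (slice U a) + width (slice U a') <= 2 * K.
  apply: wK => t t' St St'; rewrite -ler_sqr ?nnegrE ?sqrtr_ge0//.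
  rewrite real_normK ?num_real// K2 ler_pdivlMr//.
  by have := coords_close aI aI' St St'; rewrite [_ ^+ 2 * _]mulrC; lra.
have w0 : 0 <= width (slice U a) by apply: width_ge0 => t t'; exact: slice_bounded.
have w0' : 0 <= width (slice U a') by apply: width_ge0 => t t'; exact: slice_bounded.
have -> : M a * M a' = (cos a * cos a') * (width (slice U a) * width (slice U a')).
  by rewrite /M; ring.
suff : width (slice U a) * width (slice U a') <= K ^+ 2.
  by move=> /(ler_wpM2l (ltW cc0)); rewrite K2 mulrC [X in _ <= X]mulrC divfK ?gt_eqF// mulrC; lra.
have Kn : 0 <= K by exact: sqrtr_ge0.
apply: mul_le_sqr_mean.
by rewrite -subr_ge0 subr_sqr mulr_ge0//; lra.
Qed.

(* Horizontal slicing of the subgraph of [M]: the set where [M >= j D / n] has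
   diameter at most [D sqrt (1 - (j / n)^2)]. *)
Lemma isodiametric_majorant (n : nat) : (0 < n)%N ->
  exists sigma : R -> R, [/\ measurable_fun [set: R] sigma,
    forall a, 0 <= sigma a,
    forall a, a0 <= a <= a1 -> cos a * width (slice U a) <= sigma a &
    (\int[lebesgue_measure]_x (sigma x)%:E <= ((pi / 4 + n%:R^-1) * D ^+ 2)%:E)%E].
Proof.
move=> n0; have n0' : 0 < n%:R :> R by rewrite ltr0n.
pose y (j : nat) : R := Num.sqrt (1 - (j%:R / n%:R) ^+ 2).
pose E (j : nat) := [set a | [/\ a0 <= a <= a1, slice U a !=set0 & j%:R * D / n%:R <= M a]].
have EI (j : nat) : exists I : set R, [/\ measurable I, E j `<=` I &
    (j <= n)%N -> (lebesgue_measure I <= (D * y j)%:E)%E].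
  have [jn|nj] := leqP j n; last by exists setT; split => //; rewrite leqNgt nj.
  have jD : 0 <= j%:R * D / n%:R by rewrite divr_ge0 ?mulr_ge0// ltW.
  have jn1 : j%:R / n%:R <= 1 :> R by rewrite ler_pdivrMr// mul1r ler_nat.
  have Ej x x' : E j x -> E j x' -> `|x - x'| <= D * y j.
    move=> [xI Sx Mx] [xI' Sx' Mx'].
    rewrite -ler_sqr ?nnegrE ?mulr_ge0 ?sqrtr_ge0// real_normK ?num_real// exprMn sqr_sqrtr; last first.
      by rewrite subr_ge0 expr_le1// divr_ge0.
    have := M_close xI xI' Sx Sx'.
    have : (j%:R * D / n%:R) * (j%:R * D / n%:R) <= M x * M x' by rewrite ler_pM.
    have -> : (j%:R * D / n%:R) * (j%:R * D / n%:R) = D ^+ 2 * (j%:R / n%:R) ^+ 2.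
      by field; rewrite gt_eqF.
    by rewrite mulrBr mulr1; lra.
  have [I [mI EjI lI]] := width_cover Ej; exists I; split => // _.
  rewrite lI lee_fin; have [->|/set0P E0] := eqVneq (E j) set0.
    by rewrite width_set0 mulr_ge0// sqrtr_ge0.
  by have [] := width_hull E0 Ej.
have [I HI] : {I : nat -> set R & forall j, [/\ measurable (I j), E j `<=` I j &
    (j <= n)%N -> (lebesgue_measure (I j) <= (D * y j)%:E)%E]}.
  exact: (@choice _ _ (fun j I => [/\ measurable I, E j `<=` I &
    (j <= n)%N -> (lebesgue_measure I <= (D * y j)%:E)%E])).
have mI j : measurable (I j) by have [] := HI j.
(* The levels run from 0 to [n] so that the staircase lies above [M]: if [M] reaches level [k] but
   not [k + 1], then [sigma >= (k + 1) D / n >= M]. Level 0 accounts for the term [1 / n] in the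
   bound. *)
pose sigma a : R := \sum_(j < n.+1) D / n%:R * \1_(I j) a.
have Dn0 : 0 <= D / n%:R by rewrite divr_ge0// ltW.
have term0 (j : 'I_n.+1) a : 0 <= D / n%:R * \1_(I j) a by rewrite mulr_ge0.
have mind j : measurable_fun [set: R] (fun a : R => \1_(I j) a : R).
  exact: measurable_indic.
have mterm j : measurable_fun [set: R] (fun a => D / n%:R * \1_(I j) a).
  by apply: measurable_funM => //; exact: mind.
have int_term j : (\int[lebesgue_measure]_x (D / n%:R * \1_(I j) x)%:E =
    (D / n%:R)%:E * lebesgue_measure (I j))%E.
  under eq_integral do rewrite EFinM.
  rewrite ge0_integralZl_EFin//; last first.
    by apply/measurable_EFinP; exact: mind.
  congr (_ * _)%E; rewrite integral_indic; [by rewrite setIT|exact: measurableT|exact: mI].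
exists sigma; split.
- by apply: measurable_sum => j.
- by move=> a; apply: sumr_ge0.
- move=> a aI; rewrite -/(M a).
  have [S0|/set0P S0] := eqVneq (slice U a) set0.
    by rewrite /M S0 width_set0 mulr0 sumr_ge0.
  have M0 := M_ge0 aI.
  have MD : M a <= D.
    rewrite -ler_sqr ?nnegrE//; have := M_close aI aI S0 S0.
    by rewrite subrr expr0n add0r expr2.
  have [D00|Dn] := eqVneq D 0; first by rewrite (le_trans MD)// D00 sumr_ge0// -D00.
  have Dp : 0 < D by rewrite lt_def Dn.
  have q0 : 0 <= M a * n%:R / D by rewrite divr_ge0// mulr_ge0.
  have /andP[k1 k2] := truncn_itv q0; set k := Num.truncn _ in k1 k2.
  have kn : (k <= n)%N.
    rewrite -(ler_nat R) (le_trans k1)// ler_pdivrMr// mulrC ler_pM2l//.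
  have : (k.+1%:R * (D / n%:R) <= sigma a).
    have -> : k.+1%:R * (D / n%:R) = \sum_(j < k.+1) D / n%:R :> R.
      by rewrite sumr_const card_ord mulr_natl.
    rewrite (big_ord_widen n.+1 (fun=> D / n%:R)) ?ltnS//.
    rewrite big_mkcond; apply: ler_sum => j _; case: ifPn => // jk.
    rewrite indicE mem_set ?mulr1//; have [_ EjI _] := HI j; apply: EjI; split => //.
    rewrite ler_pdivrMr// -ler_pdivlMr// (le_trans _ k1)// ler_nat.
    by rewrite -ltnS.
  apply: le_trans; apply: ltW.
  by rewrite mulrA ltr_pdivlMr// -ltr_pdivrMr.
under eq_integral => x _ do rewrite -sumEFin.
rewrite ge0_integral_sum//; last 2 first.
- by move=> j; apply/measurable_EFinP; exact: mterm.
- by move=> j x _; rewrite lee_fin term0.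
apply: (@le_trans _ _ (\sum_(j < n.+1) (D ^+ 2 * (y j / n%:R))%:E)%E).
  apply: lee_sum => j _.
  apply: (@le_trans _ _ ((D / n%:R)%:E * lebesgue_measure (I j))%E).
    by rewrite le_eqVlt; apply/orP; left; apply/eqP; exact: int_term.
  have [_ _ /(_ (ltn_ord j)) lI] := HI j.
  apply: le_trans (lee_wpmul2l _ lI) _; first by rewrite lee_fin.
  by rewrite -EFinM lee_fin le_eqVlt; apply/orP; left; apply/eqP; ring.
rewrite sumEFin lee_fin -mulr_sumr mulrC ler_wpM2r ?sqr_ge0//.
rewrite big_ord_recl/= addrC; apply: lerD.
  by have [] := @quarter_circle_sums R n n0.
by rewrite /y mul0r expr0n subr0 sqrtr1 mul1r.
Qed.

End one_set.
End isodiametric.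

(** * Lower bound for the area of half bands *)

Section area_lower_bound.
Context (R : realType).

Definition half_band (a0 a1 : R) : set (sphere R) :=
  [set p | exists a t, [/\ a0 <= a <= a1, 0 < t < pi & p = sph a t]].

Lemma width_slice_ge0 (U : set (sphere R)) (a : R) : 0 <= width (slice U a).
Proof.
apply: (@width_ge0 _ _ pi) => t t' [h _] [h' _]; rewrite ler_norml; lra.
Qed.

Lemma half_band_cover (U : (set (sphere R))^nat) (a0 a1 a : R) : a0 <= a <= a1 ->
  half_band a0 a1 `<=` \bigcup_k U k ->
  (pi%:E <= \sum_(k <oo) (width (slice (U k) a))%:E)%E.
Proof.
move=> aI BU.
have Ir k : exists I : set R, [/\ measurable I, slice (U k) a `<=` I &
    (lebesgue_measure I = (width (slice (U k) a))%:E)%E].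
  apply: (@width_cover _ _ pi) => t t' [h _] [h' _]; rewrite ler_norml; lra.
have [I HI] := @choice _ _ (fun k I => [/\ measurable I, slice (U k) a `<=` I &
    (lebesgue_measure I = (width (slice (U k) a))%:E)%E]) Ir.
have mI k : measurable (I k) by have [] := HI k.
have -> : (\sum_(k <oo) (width (slice (U k) a))%:E = \sum_(k <oo) (lebesgue_measure (I k)))%E.
  by apply: eq_eseriesr => k _; have [_ _ ->] := HI k.
have -> : pi%:E = lebesgue_measure (`]0, pi[%classic : set R).
  by rewrite lebesgue_measure_itv/= lte_fin pi_gt0 oppr0 adde0.
apply: (measure_sigma_subadditive lebesgue_measure mI) => // t.
rewrite /= in_itv/= => tI.
have [|k _ Uk] := BU (sph a t); first by exists a, t.
by exists k => //; have [_ sI _] := HI k; apply: sI; split.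
Qed.

Lemma integral_cos (a0 a1 : R) : a0 < a1 ->
  (\int[lebesgue_measure]_(x in `[a0, a1]) (cos x)%:E = (sin a1 - sin a0)%:E)%E.
Proof.
move=> a01; rewrite (@continuous_FTC2 _ _ sin)// ?EFinB//.
- by apply: continuous_subspaceT => x; exact: continuous_cos.
- split => //.
  + by apply: cvg_at_right_filter; exact: continuous_sin.
  + by apply: cvg_at_left_filter; exact: continuous_sin.
- by move=> x _; rewrite derive1E derive_val.
Qed.

(** Multiplying [half_band_cover] by [cos a] and integrating over the latitudes bounds
    [pi (sin a1 - sin a0)] by the integrals of the majorants [sigma], hence by [(1 + eta) pi / 4]
    times the sum of the squared diameters. Here [eta] is a tolerance. *)
Lemma le_hausdorff2_half_band (a0 a1 : R) : - (pi / 2) < a0 -> a0 < a1 -> a1 < pi / 2 ->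
  ((pi * (sin a1 - sin a0))%:E <= hausdorff2 (@sdist R) (half_band a0 a1))%E.
Proof.
move=> h0 h01 h1; set B := half_band a0 a1.
pose c : R := Num.min (cos a0) (cos a1).
have c0 : 0 < c by rewrite lt_min !cos_gt0_pihalf//; apply/andP; split=> //; lra.
have c1 : c <= 1 by rewrite ge_min cos_le1.
have pi0 : 0 < pi :> R := pi_gt0 R.
have hc a : a0 <= a <= a1 -> c <= cos a.
  move=> /andP[a0a aa1]; have [a_ge0|a_lt0] := leP 0 a.
    rewrite ge_min; apply/orP; right; rewrite leNgt ltr_cos ?in_itv/= -?leNgt//.
    - by rewrite (le_trans a_ge0)//= ltW// (lt_trans h1)// ltr_pdivrMr//; lra.
    - by rewrite a_ge0/= (le_trans aa1)// ltW// (lt_trans h1)// ltr_pdivrMr//; lra.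
  rewrite ge_min; apply/orP; left; rewrite -(cosN a0) -(cosN a) leNgt ltr_cos ?in_itv/= -?leNgt ?lerN2//.
  - by apply/andP; split; lra.
  - by apply/andP; split; lra.
have mcos : measurable_fun (`[a0, a1]%classic : set R) (fun x : R => cos x).
  by apply: measurable_funTS; apply: continuous_measurable_fun; exact: continuous_cos.
(* The mesh [d = c x / 2] makes the chord distortion [1 + 2 d^2 / c^2] at most [1 + x / 2], and [n]
   keeps the discretisation error below the fraction [eta / 2] of [pi / 4]. *)
have factor (eta : R) : 0 < eta -> exists (d : {posnum R}) (n : nat), (0 < n)%N /\
    (1 + 2 * d%:num ^+ 2 / c ^+ 2) * (pi / 4 + n%:R^-1) <= (1 + eta) * (pi / 4).
  move=> eta0; pose n := (Num.truncn (8 / (pi * eta))).+1.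
  have n0 : 0 < n%:R :> R by rewrite ltr0n.
  have ne : n%:R^-1 <= pi / 4 * (eta / 2).
    have : 8 / (pi * eta) < n%:R by rewrite truncnS_gt.
    rewrite ltr_pdivrMr ?mulr_gt0// => /ltW h.
    by rewrite -[leLHS]mul1r ler_pdivrMr//; lra.
  pose x := Num.min 1 (eta / (4 * (1 + eta / 2))).
  have x0 : 0 < x by rewrite lt_min ltr01 divr_gt0// mulr_gt0// addr_gt0// divr_gt0.
  have xe : x * (4 * (1 + eta / 2)) <= eta.
    by rewrite -ler_pdivlMr ?mulr_gt0 ?addr_gt0 ?divr_gt0// ge_min lexx orbT.
  have x1 : x <= 1 by rewrite ge_min lexx.
  have d0 : 0 < c * x / 2 by rewrite divr_gt0// mulr_gt0.
  exists (PosNum d0), n; split => //=.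
  have -> : 2 * (c * x / 2) ^+ 2 / c ^+ 2 = x ^+ 2 / 2 by field; rewrite gt_eqF.
  apply: (@le_trans _ _ ((1 + x / 2) * (pi / 4 + pi / 4 * (eta / 2)))).
    apply: ler_pM; rewrite ?addr_ge0 ?divr_ge0 ?sqr_ge0 ?invr_ge0 ?(ltW pi0)//.
      by rewrite lerD2l ler_pM2r// expr2 ler_piMl// ltW.
    by rewrite lerD2l.
  have -> : (1 + x / 2) * (pi / 4 + pi / 4 * (eta / 2)) =
    ((1 + x / 2) * (1 + eta / 2)) * (pi / 4) by ring.
  by rewrite ler_pM2r ?divr_gt0//; lra.
suff key (eta : R) : 0 < eta ->
    ((pi * (sin a1 - sin a0))%:E <= (1 + eta)%:E * hausdorff2 (@sdist R) B)%E.
  have H0 : (0 <= hausdorff2 (@sdist R) B)%E by exact: hausdorff2_ge0.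
  case: (hausdorff2 _ B) H0 key => [r r0 key||] //; last by move=> *; rewrite leey.
  rewrite lee_fin in r0 *; apply/ler_addgt0Pr => e e0.
  have e1 : 0 < e / (r + 1) by rewrite divr_gt0// ltr_wpDl.
  have := key _ e1; rewrite -EFinM lee_fin => /le_trans; apply.
  rewrite mulrDl mul1r lerD2l mulrAC ler_pdivrMr ?ltr_wpDl//.
  by rewrite ler_pM2l// lerDl.
move=> eta0; have [d [n [n0 fac]]] := factor eta eta0.
set e : R := 2 * d%:num ^+ 2 / c ^+ 2 in fac.
have e0 : 0 <= e by apply: divr_ge0; [rewrite mulr_ge0// sqr_ge0|exact: sqr_ge0].
apply: (@le_trans _ _ ((1 + eta)%:E * hausdorff2_preo (@sdist R) d B)%E); last first.
  rewrite lee_pmul2l// ?lte_fin ?addr_gt0//.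
  exact: hausdorff2_pre_le.
rewrite -lee_pdivrMl ?addr_gt0//; apply: le_ereal_inf_tmp => _ [U [BU dU] <-].
rewrite lee_pdivrMl ?addr_gt0//.
pose dk k := fine (diam (@sdist R) (U k)).
have dkE k : (diam (@sdist R) (U k) = (dk k)%:E)%E.
  rewrite fineK// ge0_fin_numE ?diam_ge0//; apply: le_lt_trans (dU k) _; exact: ltry.
have dk0 k : 0 <= dk k by rewrite -lee_fin -dkE diam_ge0.
have dkd k : dk k <= d%:num by rewrite -lee_fin -dkE.
have S k : exists sigma : R -> R, [/\ measurable_fun [set: R] sigma,
    forall a, 0 <= sigma a,
    forall a, a0 <= a <= a1 -> cos a * width (slice (U k) a) <= sigma a &
    (\int[lebesgue_measure]_x (sigma x)%:E <= ((1 + eta) * (pi / 4 * dk k ^+ 2))%:E)%E].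
  have D0 : 0 <= Num.sqrt (1 + e) * dk k by rewrite mulr_ge0// sqrtr_ge0.
  have D2 : (Num.sqrt (1 + e) * dk k) ^+ 2 = (1 + e) * dk k ^+ 2.
    by rewrite exprMn sqr_sqrtr// addr_ge0.
  have Udk : (diam (@sdist R) (U k) <= (dk k)%:E)%E by rewrite dkE.
  have he : 2 * dk k ^+ 2 / c ^+ 2 <= e.
    by rewrite ler_pM2r ?invr_gt0 ?exprn_gt0// ler_pM2l// ler_sqr ?nnegrE.
  have [sigma [s1 s2 s3 s4]] := isodiametric_majorant (ltW h0) (ltW h1) c0 c1 hc
    (dk0 k) Udk he D0 D2 n0.
  exists sigma; split => //; apply: le_trans s4 _; rewrite lee_fin D2 mulrA.
  by rewrite [_ * (1 + e)]mulrC [X in _ <= X]mulrA ler_wpM2r ?sqr_ge0.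
have [sigma Hs] := @choice _ _ (fun k (sigma : R -> R) => [/\ measurable_fun [set: R] sigma,
    forall a, 0 <= sigma a,
    forall a, a0 <= a <= a1 -> cos a * width (slice (U k) a) <= sigma a &
    (\int[lebesgue_measure]_x (sigma x)%:E <= ((1 + eta) * (pi / 4 * dk k ^+ 2))%:E)%E]) S.
have ms k : measurable_fun [set: R] (sigma k) by have [] := Hs k.
have s0 k a : 0 <= sigma k a by have [_ h _ _] := Hs k; exact: h.
have -> : ((pi * (sin a1 - sin a0))%:E =
    \int[lebesgue_measure]_(x in `[a0, a1]) (pi%:E * (cos x)%:E))%E.
  rewrite integralZl//; first by rewrite integral_cos// -EFinM.
  apply: continuous_compact_integrable; first exact: segment_compact.
  by apply: continuous_subspaceT => x; exact: continuous_cos.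
apply: (@le_trans _ _ (\int[lebesgue_measure]_(x in `[a0, a1])
    (\sum_(k <oo) (sigma k x)%:E))%E).
  apply: ge0_le_integral => //.
  - move=> x; rewrite /= in_itv/= => xI; rewrite -EFinM lee_fin mulr_ge0 ?(ltW pi0)//.
    by rewrite (le_trans _ (hc _ xI))// ltW.
  - by apply/measurable_EFinP; apply: measurable_funM.
  - by apply: ge0_emeasurable_sum => k //= *; [rewrite lee_fin s0|apply/measurable_EFinP; apply: measurable_funTS; exact: ms].
  - move=> x; rewrite /= in_itv/= => xI.
    have cx : 0 <= cos x by rewrite (le_trans _ (hc _ xI))// ltW.
    apply: (@le_trans _ _ ((cos x)%:E * \sum_(k <oo) (width (slice (U k) x))%:E)%E).
      by rewrite muleC; apply: lee_wpmul2l; [rewrite lee_fin|exact: half_band_cover BU].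
    rewrite -nneseriesZl//; last by move=> k _; rewrite lee_fin width_slice_ge0.
    apply: lee_nneseries => k _; first by rewrite -EFinM lee_fin mulr_ge0// width_slice_ge0.
    by rewrite -EFinM lee_fin; have [_ _ h _] := Hs k; exact: h.
rewrite integral_nneseries//; last 2 first.
- by move=> k; apply/measurable_EFinP; apply: measurable_funTS; exact: ms.
- by move=> k x _; rewrite lee_fin s0.
rewrite -nneseriesZl//; last by move=> k _; rewrite gauge_ge0// diam_ge0.
apply: lee_nneseries => k _.
  by move=> _; apply: integral_ge0 => x _; rewrite lee_fin s0.
rewrite dkE -EFin_expe -!EFinM; have [_ _ _] := Hs k; apply: le_trans.
apply: ge0_subset_integral => //.
- by apply/measurable_EFinP; exact: ms.
- by move=> x _; rewrite lee_fin s0.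
Qed.

End area_lower_bound.

(** * Archimedes' theorem *)

Section archimedes.
Context (R : realType).
Implicit Types (e p : S2 R) (a b : R).

Local Notation mu := (@area R).

Lemma area_le (A B : set (S2 R)) : A `<=` B -> (mu A <= mu B)%E.
Proof. exact: le_hausdorff2. Qed.

Lemma area_fin (A : set (S2 R)) : mu A \is a fin_num.
Proof.
rewrite ge0_fin_numE ?hausdorff2_ge0//; apply: (@le_lt_trans _ _ (4 * pi)%:E).
  by apply: le_trans (area_sphere_le R); exact: area_le.
exact: ltry.
Qed.

Lemma measurable_sdot_preimage e (A : set R) : measurable A ->
  measurable [set p : S2 R | A (sdot p e)].
Proof. by move=> mA; have := measurable_sdot e measurableT mA; rewrite setTI. Qed.

Lemma area_sdot_change e e' (A : set R) :
  mu [set p | A (sdot p e)] = mu [set p | A (sdot p e')].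
Proof.
rewrite -[LHS](area_reflection (val e - val e')); congr (mu _).
have eqA p : sdot (reflection (val e - val e') p) e = sdot p e'.
  by rewrite -[LHS](sdot_reflection (val e - val e')) reflectionK reflection_swap.
by apply/seteqP; split => p; rewrite /= eqA.
Qed.

Lemma le_area_band_aux a b : -1 < a -> a < b -> b < 1 ->
  ((2 * pi * (b - a))%:E <= mu [set p | a <= sdot p (axis R 2) <= b]%R)%E.
Proof.
move=> a1 ab b1; set X := [set p | _].
have aI : -1 <= a <= 1 by lra.
have bI : -1 <= b <= 1 by lra.
pose A := [set p : S2 R | 0 < sdot p (axis R 1)]%R.
have mA : measurable A.
  have := @measurable_sdot_preimage (axis R 1) `]0, +oo[%classic (measurable_itv _).
  by rewrite (_ : [set p | _] = A)//; apply/seteqP; split => p; rewrite /= in_itv/= andbT.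
have half : ((pi * (b - a))%:E <= mu (X `&` A))%E.
  have s1 : sin (asin a) = a by rewrite asinK// in_itv.
  have s2 : sin (asin b) = b by rewrite asinK// in_itv.
  have := @le_hausdorff2_half_band R (asin a) (asin b); rewrite s1 s2.
  rewrite asin_gtNpi2 ?asin_ltpi2; [|lra..] => /(_ isT).
  have lt : asin a < asin b.
    by rewrite -ltr_sin ?in_itv/= ?asin_geNpi2 ?asin_lepi2// s1 s2.
  move=> /(_ lt isT) /le_trans; apply; apply: area_le => _ [c [t [cI tI ->]]].
  have [_ h1 h2] := sdot_sph_axis c t.
  have cI' : - (pi / 2) < c < pi / 2.
    case/andP: cI => c1 c2; apply/andP; split.
      by apply: lt_le_trans c1; rewrite asin_gtNpi2//; lra.
    by apply: le_lt_trans c2 _; rewrite asin_ltpi2//; lra.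
  split; last by rewrite /A/= h1 mulr_gt0 ?cos_gt0_pihalf ?sin_gt0_pi.
  rewrite /X/= h2; suff : sin (asin a) <= sin c <= sin (asin b) by rewrite s1 s2.
  case/andP: cI => c1 c2; case/andP: cI' => c3 c4.
  by rewrite !leNgt !ltr_sin ?in_itv/= -?leNgt ?c1 ?c2// ?asin_geNpi2 ?asin_lepi2// ?(ltW c3) ?(ltW c4).
(* Caratheodory's equation for [A] splits the band into the half just measured and a part that
   contains its mirror image. *)
have := mA X; rewrite -[X in X = _ -> _]/(mu X) => ->.
have -> : 2 * pi * (b - a) = pi * (b - a) + pi * (b - a) by ring.
rewrite EFinD; apply: leeD => //; apply: (le_trans half).
rewrite -(area_reflection (val (axis R 1))); apply: area_le => p [Xp Ap]; split.
  move: Xp; rewrite /X/= sdot_reflectionl.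
  have -> : dot (val (axis R 1)) (val (axis R 2)) = 0.
    by rewrite -/(sdot _ _) sdot_axis mxE.
  by rewrite mulr0 subr0.
move: Ap; rewrite /A /=; have := sdot_reflection_self (axis R 1) p.
by rewrite /= => ->; rewrite oppr_gt0 => h1 h2; have := lt_trans h1 h2; rewrite ltxx.
Qed.

Lemma le_area_band e a b : -1 <= a -> a <= b -> b <= 1 ->
  ((2 * pi * (b - a))%:E <= mu [set p | a < sdot p e <= b]%R)%E.
Proof.
move=> a1; rewrite le_eqVlt => /predU1P[->|ab] b1.
  by rewrite subrr mulr0 hausdorff2_ge0.
have pi0 : 0 < pi :> R := pi_gt0 R.
rewrite (area_sdot_change e (axis R 2) [set x | a < x <= b]).
apply/lee_addgt0Pr => d' d0'; have [d d0 ->] : exists2 d : R, 0 < d & d' = d by exists d'.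
(* The closed band from [a + x] to [b - x] avoids the poles and lies in the half-open one; the bound
   on [x] keeps the loss [4 pi x] below [d]. *)
pose x := Num.min ((b - a) / 4) (d / (4 * pi)).
have x0 : 0 < x by rewrite lt_min !divr_gt0 ?mulr_gt0// subr_gt0.
have x1 : x <= (b - a) / 4 by rewrite ge_min lexx.
have x2 : 4 * pi * x <= d by rewrite mulrC -ler_pdivlMr ?mulr_gt0// ge_min lexx orbT.
apply: (@le_trans _ _ ((2 * pi * ((b - x) - (a + x)))%:E + d%:E)%E).
  by rewrite -EFinD lee_fin; lra.
rewrite leeD2r//; apply: le_trans (le_area_band_aux _ _ _) _; [lra..|].
apply: area_le => p /= /andP[h1 h2]; apply/andP; split; lra.
Qed.

Let nu e (A : set (measurableTypeR R)) := mu [set p : S2 R | A (sdot p e)].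

Let mu_bandU (A B : set R) e : measurable A -> measurable B -> A `&` B = set0 ->
  nu e (A `|` B) = (nu e A + nu e B)%E.
Proof.
move=> mA mB AB; rewrite /nu -measureU//.
- exact: measurable_sdot_preimage.
- exact: measurable_sdot_preimage.
- by apply/seteqP; split => // p /= [h1 h2]; have : (A `&` B) (sdot p e) by []; rewrite AB.
Qed.

(** The lower bounds for the three bands cut out by [-1], [a], [b] and 1 add up to [4 pi], the upper
    bound for the sphere, so each of them is an equality. *)
Lemma area_band e a b : -1 <= a -> a <= b -> b <= 1 ->
  mu [set p | a < sdot p e <= b]%R = (2 * pi * (b - a))%:E.
Proof.
move=> a1 ab b1; apply/eqP; rewrite eq_le le_area_band// andbT.
have E x y : [set p | (x < sdot p e <= y)%R] = [set p : S2 R | `]x, y]%classic (sdot p e)].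
  by apply/seteqP; split => p; rewrite /= in_itv.
have h1 := @le_area_band e (-1) a (lexx _) a1 (le_trans ab b1).
have h2 := @le_area_band e b 1 (le_trans a1 ab) b1 (lexx _).
have h3 := area_sphere_le R.
rewrite !E in h1 h2 *; rewrite -!/(nu _ _) in h1 h2 *.
set I1 : set R := `]-1, a]%classic in h1; set I2 : set R := `]a, b]%classic.
set I3 : set R := `]b, 1]%classic in h2.
have : (nu e I1 + nu e I2 + nu e I3 <= (4 * pi)%:E)%E.
  apply: le_trans h3; rewrite -!mu_bandU//.
  - exact: area_le.
  - by apply: measurableU; exact: measurable_itv.
  - exact: measurable_itv.
  - apply/seteqP; split => // x [[]]; rewrite /I1 /I2 /I3 /= !in_itv/= => /andP[_ xa] /andP[ax _].
    + by have := lt_le_trans ax (le_trans xa ab); rewrite ltxx.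
    + by have := lt_le_trans ax xa; rewrite ltxx.
  - exact: measurable_itv.
  - exact: measurable_itv.
  - apply/seteqP; split => // x []; rewrite /I1 /I2 /= !in_itv/= => /andP[_ xa] /andP[ax _].
    by have := lt_le_trans ax xa; rewrite ltxx.
move: h1 h2; rewrite /nu -(fineK (area_fin [set p | I1 (sdot p e)])).
rewrite -(fineK (area_fin [set p | I2 (sdot p e)])) -(fineK (area_fin [set p | I3 (sdot p e)])).
rewrite -!EFinD !lee_fin.
lra.
Qed.

Lemma area_sphere : mu [set: S2 R] = (4 * pi)%:E.
Proof.
apply/eqP; rewrite eq_le area_sphere_le/=.
have <- : 2 * pi * (1 - -1) = 4 * pi :> R by ring.
apply: le_trans (area_le (subsetT [set p | -1 < sdot p (axis R 2) <= 1])).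
by apply: le_area_band => //; lra.
Qed.

(** The law of [p . e] and [2 pi] times Lebesgue measure on []-1, 1]] agree on half-open intervals,
    hence on all Borel sets. [D] is half-open so that its traces on such intervals are the bands of
    [area_band]. *)
Lemma area_sdot e (A : set (measurableTypeR R)) : measurable A -> A `<=` `[-1, 1] ->
  mu [set p | A (sdot p e)] = ((2 * pi)%:E * lebesgue_measure A)%E.
Proof.
pose D : set (measurableTypeR R) := `]-1, 1]%classic.
have mD : measurable D by exact: measurable_itv.
have pi2 : 0 <= 2 * pi :> R by rewrite mulr_ge0// pi_ge0.
have N11 : -1 <= 1 :> R by lra.
have mf : measurable_fun [set: S2 R] (fun p : S2 R => sdot p e : measurableTypeR R).
  exact: measurable_sdot.
pose m1 : {measure set (measurableTypeR R) -> \bar R} :=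
  measure_function_pushforward__canonical__measure_function_Measure mu mf.
pose m2 : {measure set (measurableTypeR R) -> \bar R} :=
  mscale (NngNum pi2) (mrestr lebesgue_measure mD).
have m1D (X : set (measurableTypeR R)) : measurable X -> m1 X = m1 (X `&` D).
  move=> mX; have mXC : measurable (X `&` ~` D) by apply: measurableI => //; exact: measurableC.
  have m1DC : m1 (~` D) = 0%E.
    have := mu_bandU e mD (measurableC mD) (setICr D).
    rewrite setUCr -/(m1 (~` D)) /nu.
    have -> : [set p : S2 R | D (sdot p e)] = [set p | -1 < sdot p e <= 1].
      by apply/seteqP; split => p; rewrite /D /= in_itv.
    rewrite (area_band e (lexx _) N11 (lexx _)).
    have -> : [set p : S2 R | [set: measurableTypeR R] (sdot p e)] = setT by [].
    rewrite area_sphere.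
    have <- : 2 * pi * (1 - -1) = 4 * pi :> R by ring.
    have -> : m1 (~` D) = mu [set p : S2 R | (~` D) (sdot p e)] by [].
    move: (area_fin [set p : S2 R | (~` D) (sdot p e)]).
    case: (mu _) => [x _||]//; move: (2 * pi * _) => c; rewrite -EFinD => -[].
    by move=> h; congr EFin; lra.
  have := mu_bandU e (measurableI _ _ mX mD) mXC.
  rewrite -setIUr setUCr setIT setIACA setICr setI0 => /(_ erefl).
  move=> E; have {E} -> : m1 X = (m1 (X `&` D) + m1 (X `&` ~` D))%E by exact: E.
  have -> : m1 (X `&` ~` D) = 0%E.
    apply/eqP; rewrite eq_le measure_ge0 andbT -m1DC.
    by apply: area_le => p [].
  by rewrite adde0.
have m12 X : measurable X -> m1 X = m2 X.
  apply: (@measure_unique _ R (measurableTypeR R) (@ocitv R) (fun k : nat => `](- k%:R)%R, k%:R]%classic) _ _ _ _ m1 m2).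
  - by [].
  - exact: ocitvI.
  - by move=> k; exists (- k%:R, k%:R).
  - apply/seteqP; split => // x _; exists (Num.truncn `|x|).+1 => //=.
    have := truncnS_gt `|x|; rewrite in_itv/= ltr_norml => /andP[-> /ltW ->]//.
  - move=> Y [[x y] _ /= <-]; rewrite m1D; last exact: measurable_itv.
    pose a := Num.max x (-1); pose b := Num.min y 1.
    have EI : (`]x, y] `&` D) = `]a, b]%classic :> set (measurableTypeR R).
      apply/seteqP; split => z; rewrite /D/= !in_itv/= gt_max le_min.
        by move=> [/andP[-> ->] /andP[-> ->]].
      by move=> /andP[/andP[-> ->] /andP[-> ->]].
    have -> : m2 `]x, y]%classic = ((2 * pi)%:E * lebesgue_measure (`]a, b]%classic : set R))%E.
      by rewrite /m2 /= /mscale/= /mrestr EI.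
    rewrite EI; have [ab|ba] := ltP a b; last first.
      have -> : `]a, b]%classic = set0 :> set (measurableTypeR R).
        by apply/seteqP; split => // z; rewrite /= in_itv/= => /andP[h1 h2]; have := lt_le_trans (le_lt_trans ba h1) h2; rewrite ltxx.
      by rewrite !measure0 mule0.
    rewrite lebesgue_measure_itv/= lte_fin ab -EFinB -EFinM.
    rewrite -(@area_band e) ?(ltW ab)//; last 2 first.
    - by rewrite le_max lexx orbT.
    - by rewrite ge_min lexx orbT.
  - by move=> k; rewrite -ge0_fin_numE ?measure_ge0//; exact: area_fin.
move=> mA AI; have -> : mu [set p : S2 R | A (sdot p e)] = m2 A by exact: (m12 A mA).
rewrite /m2 /= /mscale/= /mrestr; congr (_ * _)%E; apply/eqP; rewrite eq_le.
rewrite le_measure ?inE//=; last exact: measurableI.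
(* The end point [-1], missing from [D], is added back as a null set. *)
pose s : set (measurableTypeR R) := [set (-1 : R)].
have ms : measurable s by exact: measurable_set1.
pose E : set (measurableTypeR R) := (A `&` D) `|` s.
apply: (@le_trans _ _ (lebesgue_measure E)).
  apply: le_measure; rewrite ?inE//.
    by apply: measurableU => //; apply: measurableI.
  move=> z Az; have := AI z Az; rewrite /= in_itv/= => /andP[z1 z2].
  have [<-|h] := eqVneq (-1) z; [by right|left; split => //].
  by rewrite /D/= in_itv/= z2 lt_neqAle h z1.
apply: (@le_trans _ _ (lebesgue_measure (A `&` D) + lebesgue_measure s)%E).
  by apply: measureU2 => //; exact: measurableI.
by rewrite /s lebesgue_measure_set1 adde0.
Qed.

Lemma area_sdot_null e (A : set (measurableTypeR R)) : measurable A ->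
  lebesgue_measure A = 0%E -> mu [set p | A (sdot p e)] = 0%E.
Proof.
move=> mA A0.
have -> : [set p : S2 R | A (sdot p e)] = [set p : S2 R | (A `&` `[-1, 1]) (sdot p e)].
  apply/seteqP; split => p /=; last by case.
  by move=> Ap; split=> //; rewrite in_itv/= sdot_le1.
rewrite area_sdot; [|by apply: measurableI|by move=> x []].
rewrite (_ : lebesgue_measure _ = 0%E) ?mule0//; apply/eqP.
rewrite eq_le measure_ge0 andbT -A0 le_measure ?inE//.
exact: measurableI.
Qed.

Lemma ge0_integral_sdot e (h : R -> \bar R) : measurable_fun [set: R] h ->
  (forall x, -1 <= x <= 1 -> (0 <= h x)%E) ->
  (\int[mu]_p h (sdot p e) = (2 * pi)%:E * \int[lebesgue_measure]_(x in `[(-1)%R, 1%R]) h x)%E.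
Proof.
move=> mh h0.
have mf : measurable_fun [set: S2 R] (fun p : S2 R => sdot p e : measurableTypeR R).
  exact: measurable_sdot.
have pi2 : 0 <= 2 * pi :> R by rewrite mulr_ge0// pi_ge0.
pose D : set (measurableTypeR R) := `[-1, 1]%classic.
have mD : measurable D by exact: measurable_itv.
have hD : {in D, forall y, (0 <= h y)%E}.
  by move=> y; rewrite inE /D/= in_itv/= => /h0.
have := @ge0_integral_pushforward _ _ _ (measurableTypeR R) R _ mf mu D h mD
  (measurable_funS measurableT (subsetT D) mh) hD.
have -> : (fun p : S2 R => sdot p e : measurableTypeR R) @^-1` D = setT.
  by apply/seteqP; split => // p _; rewrite /D/= in_itv/= sdot_le1.
move=> <-.
rewrite (eq_measure_integral (mscale (NngNum pi2) lebesgue_measure)); last first.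
  by move=> A mA AD; rewrite /= /mscale/=; exact: area_sdot.
rewrite ge0_integral_mscale//; first exact: (measurable_funS measurableT (subsetT D) mh).

Qed.

End archimedes.

(** * Volume of a uniaxial density *)

Section finite_measure_integrals.
Context d (T : measurableType d) (R : realType) (mu : {measure set T -> \bar R}).
Hypothesis mu_fin : (mu setT < +oo)%E.
Implicit Types f g h : T -> R.

Local Notation intg f := (mu.-integrable [set: T] (EFin \o f)).

Lemma bounded_on_setT f (M : R) : (forall x, `|f x| <= M) -> [bounded f x | x in [set: T]].
Proof.
move=> fM; exists M; split; first exact: num_real.
by move=> y My x _ /=; rewrite (le_trans (fM x))// ltW.
Qed.

Lemma intg_measurable f : intg f -> measurable_fun [set: T] f.
Proof. by move=> /measurable_int /measurable_EFinP. Qed.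

Lemma intg_bounded f (M : R) : measurable_fun [set: T] f -> (forall x, `|f x| <= M) -> intg f.
Proof. by move=> mf fM; apply: measurable_bounded_integrable => //; exact: bounded_on_setT fM. Qed.

Lemma intg_cst (r : R) : intg (fun=> r).
Proof. by apply: (@intg_bounded _ `|r|) => //. Qed.

Lemma intgM_bounded f h (M : R) : intg f -> measurable_fun [set: T] h ->
  (forall x, `|h x| <= M) -> intg (fun x => h x * f x).
Proof.
move=> If mh hM.
have -> : EFin \o (fun x => h x * f x) = ((EFin \o h) \* (EFin \o f))%E.
  by apply/funext => x /=; rewrite EFinM.
by apply: integrableMr => //; exact: bounded_on_setT hM.
Qed.

Lemma intgZ (a : R) f : intg f -> intg (fun x => a * f x).
Proof. by move=> If; apply: (@intgM_bounded f (fun=> a) `|a|). Qed.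

Lemma intgD f g : intg f -> intg g -> intg (fun x => f x + g x).
Proof. move=> If Ig; have -> : EFin \o (fun x => f x + g x) = ((EFin \o f) \+ (EFin \o g))%E.
  by apply/funext => x /=; rewrite EFinD.
exact: integrableD. Qed.

Lemma intgB f g : intg f -> intg g -> intg (fun x => f x - g x).
Proof. move=> If Ig; have -> : EFin \o (fun x => f x - g x) = ((EFin \o f) \- (EFin \o g))%E.
  by apply/funext => x /=; rewrite EFinB.
exact: integrableB. Qed.

Lemma RintD f g : intg f -> intg g ->
  \int[mu]_x (f x + g x) = \int[mu]_x f x + \int[mu]_x g x.
Proof. by move=> If Ig; rewrite RintegralD. Qed.

Lemma RintB f g : intg f -> intg g ->
  \int[mu]_x (f x - g x) = \int[mu]_x f x - \int[mu]_x g x.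
Proof. by move=> If Ig; rewrite RintegralB. Qed.

Lemma RintZ (a : R) f : intg f -> \int[mu]_x (a * f x) = a * \int[mu]_x f x.
Proof. by move=> If; rewrite RintegralZl. Qed.

Lemma le_Rint f g : intg f -> intg g -> (forall x, f x <= g x) ->
  \int[mu]_x f x <= \int[mu]_x g x.
Proof. by move=> If Ig fg; apply: le_Rintegral => // x _. Qed.

Lemma EFin_Rint f : intg f -> ((\int[mu]_x f x)%:E = \int[mu]_x (f x)%:E)%E.
Proof. by move=> If; rewrite /Rintegral fineK//; apply: integrable_fin_num. Qed.

Lemma eq_Rint_ae f g : measurable_fun [set: T] f -> measurable_fun [set: T] g ->
  {ae mu, forall x, f x = g x} -> \int[mu]_x f x = \int[mu]_x g x.
Proof.
move=> mf mg fg; rewrite /Rintegral; congr fine.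
apply: ae_eq_integral => //; [exact/measurable_EFinP..|].
by apply: filterS fg => x /= -> _.
Qed.

Lemma Rint_le0_ae f : intg f -> {ae mu, forall x, 0 <= f x} -> \int[mu]_x f x <= 0 ->
  {ae mu, forall x, f x = 0}.
Proof.
move=> If f0 int0; have mf := intg_measurable If.
have : (\int[mu]_x `|(EFin \o f) x| = 0)%E.
  have -> : (\int[mu]_x `|(EFin \o f) x| = \int[mu]_x (f x)%:E)%E.
    apply: ae_eq_integral => //.
    - by apply: measurableT_comp => //; exact/measurable_EFinP.
    - exact/measurable_EFinP.
    - by apply: filterS f0 => x /= fx _; rewrite ger0_norm.
  apply/eqP; rewrite -EFin_Rint// eqe eq_le int0 /=.
  rewrite (@eq_Rint_ae _ (fun x => `|f x|))//.
  - by apply: Rintegral_ge0.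
  - exact: measurableT_comp.
  - by apply: filterS f0 => x fx; rewrite ger0_norm.
move=> /ae_eq_integral_abs => /(_ measurableT).
have mEf : measurable_fun [set: T] (EFin \o f) by exact/measurable_EFinP.
by move=> /(_ mEf); apply: filterS => x /(_ I) [].
Qed.

Lemma Rint_ae_ge0 f : measurable_fun [set: T] f -> {ae mu, forall x, 0 <= f x} ->
  0 <= \int[mu]_x f x.
Proof.
move=> mf f0; rewrite (@eq_Rint_ae _ (fun x => `|f x|))//.
- by apply: Rintegral_ge0.
- exact: measurableT_comp.
- by apply: filterS f0 => x fx; rewrite ger0_norm.
Qed.

Lemma norm_Rint_le f (M : R) : measurable_fun [set: T] f -> (forall x, `|f x| <= M) ->
  `|\int[mu]_x f x| <= M * fine (mu setT).
Proof.
move=> mf fM; have If := intg_bounded mf fM.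
rewrite -Rintegral_cst//; apply: le_trans (le_normr_Rintegral _ _) _ => //.
apply: le_Rint => //; [|exact: intg_cst].
by apply: (@intg_bounded _ M) => [|x]; [exact: measurableT_comp|rewrite normr_id].
Qed.

End finite_measure_integrals.

Section uniaxial_volume.
Context (R : realType).
Implicit Types (e p q : S2 R) (f : S2 R -> R).
Local Notation mu := (@area R).
Local Notation intg f := (mu.-integrable [set: S2 R] (EFin \o f)).

Lemma area_lty : (mu setT < +oo)%E.
Proof. by rewrite area_sphere ltry. Qed.

Lemma measurable_sdotr p : measurable_fun [set: S2 R] (fun q : S2 R => sdot p q).
Proof. by under eq_fun do rewrite sdotC; exact: measurable_sdot. Qed.

Lemma normr_sdot_le1 (p q : S2 R) : `|sdot p q| <= 1.
Proof. by rewrite ler_norml sdot_le1. Qed.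

Lemma Rint_reflection w f : measurable_fun [set: S2 R] f ->
  \int[mu]_q f (reflection w q) = \int[mu]_q f q.
Proof.
move=> mf; rewrite /Rintegral; congr fine.
have mr := measurable_reflection w.
have pE A : measurable A -> A `<=` [set: S2 R] -> pushforward mu (reflection w : S2 R -> S2 R) A = mu A.
  by move=> _ _; exact: area_reflection.
have push (h : S2 R -> \bar R) : measurable_fun [set: S2 R] h -> (forall q, 0 <= h q)%E ->
    (\int[mu]_q h (reflection w q) = \int[mu]_q h q)%E.
  move=> mh h0.
  have := @ge0_integral_pushforward _ _ _ _ R _ mr mu setT h measurableT mh (fun q _ => h0 q).
  by rewrite preimage_setT => <-; exact: eq_measure_integral.
rewrite integralE [RHS]integralE.
have mEf : measurable_fun [set: S2 R] (EFin \o f) by exact/measurable_EFinP.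
have hp := push _ (measurable_funepos mEf) (fun q => funepos_ge0 (EFin \o f) q).
have hn := push _ (measurable_funeneg mEf) (fun q => funeneg_ge0 (EFin \o f) q).
rewrite (_ : (fun q : S2 R => (f (reflection w q))%:E) =
  (EFin \o f) \o (reflection w : S2 R -> S2 R))//.
by rewrite funepos_comp funeneg_comp; congr (_ - _)%E.
Qed.

Lemma measurable_P2 : measurable_fun [set: R] (@P2 R).
Proof.
apply: measurable_funM => //; apply: measurable_funB => //.
by apply: measurable_funM => //; exact: measurable_funX.
Qed.

Lemma ae_reflection w (P : S2 R -> Prop) :
  {ae mu, forall q, P q} -> {ae mu, forall q, P (reflection w q)}.
Proof.
move=> [N [mN N0 PN]]; exists (reflection w @^-1` N); split.
- by have := measurable_reflection w measurableT mN; rewrite setTI.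
- by rewrite area_reflection.
- by move=> q /= nP; exact: PN.
Qed.

Definition axial_mean e f : R := \int[mu]_q (P2 (sdot q e) * f q).

Lemma sdotE p q : sdot p q =
  sdot p (axis R 0) * sdot q (axis R 0) + sdot p (axis R 1) * sdot q (axis R 1) +
  sdot p (axis R 2) * sdot q (axis R 2).
Proof.
by rewrite !sdot_axis /sdot {1}(vec3E (val p)) {1}(vec3E (val q)) dot_vec3.
Qed.

Lemma sdot_axis_neq (i j : 'I_3) : i != j -> sdot (axis R i) (axis R j) = 0.
Proof. by move=> ij; rewrite sdot_axis mxE eqxx eq_sym (negbTE ij). Qed.

(** The normal [w] is orthogonal to the axis, so the reflection leaves [f] unchanged almost
    everywhere and acts on the test function alone. *)
Lemma Rint_reflection_fixed e w f (ft : R -> R) (G : S2 R -> R) :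
  dot w (val e) = 0 -> measurable_fun [set: S2 R] f ->
  {ae mu, forall q, f q = ft (sdot q e)} -> measurable_fun [set: S2 R] G ->
  \int[mu]_q (G (reflection w q) * f q) = \int[mu]_q (G q * f q).
Proof.
move=> we mf fE mG; have mr := measurable_reflection w.
have mGr := measurableT_comp mG mr; have mfr := measurableT_comp mf mr.
have mGf := measurable_funM mG mf.
rewrite -[RHS](Rint_reflection w mGf).
apply: eq_Rint_ae; [exact: measurable_funM mGr mf|exact: measurable_funM mGr mfr|].
apply: filterS2 fE (ae_reflection w fE) => q /= -> ->.
by rewrite sdot_reflectionl we mulr0 subr0.
Qed.

(* Reflections fixing the axis kill the mixed terms of [(p . q)^2] and
   identify the two transversal ones. *)
Lemma available_volume_axis eta f p (ft : R -> R) : intg f ->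
  {ae mu, forall q, f q = ft (sdot q (axis R 2))} ->
  available_volume eta f p =
    2 / 3 * axial_mean (axis R 2) f * P2 (sdot p (axis R 2)) - eta.
Proof.
move=> If fE; have mf := intg_measurable If.
pose x (i : 'I_3) (q : S2 R) : R := sdot q (axis R i).
have mx i : measurable_fun [set: S2 R] (x i) by exact: measurable_sdot.
have mxx i j : measurable_fun [set: S2 R] (fun q => x i q * x j q) by exact: measurable_funM.
have xx1 i j q : `|x i q * x j q| <= 1.
  by rewrite normrM mulr_ile1// normr_sdot_le1.
pose X i j := \int[mu]_q (x i q * x j q * f q).
have Ixx i j : intg (fun q => x i q * x j q * f q).
  exact: (intgM_bounded If (mxx i j) (xx1 i j)).
have cross i j : i != j -> i != 2 -> X i j = 0.
  move=> ij i2.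
  have := @Rint_reflection_fixed (axis R 2) (val (axis R i)) f ft _ (sdot_axis_neq i2) mf fE (mxx i j).
  rewrite -/(X i j); under eq_Rintegral => q _.
    rewrite /x sdot_reflection_self sdot_reflectionl -/(sdot (axis R i) (axis R j)).
    rewrite (sdot_axis_neq ij) mulr0 subr0 mulNr mulNr -mulN1r.
    over.
  rewrite RintZ; last exact: Ixx.
  by rewrite -/(X i j) => h; lra.
have diag : X 0 0 = X 1 1.
  have w2 : dot (val (axis R 0) - val (axis R 1)) (val (axis R 2)) = 0.
    by rewrite dotBl -!/(sdot _ _) !sdot_axis_neq// subrr.
  rewrite /X -(Rint_reflection_fixed w2 mf fE (mxx 1 1)).
  apply: eq_Rintegral => q _; congr (_ * _).
  suff -> : x 1 (reflection (val (axis R 0) - val (axis R 1)) q) = x 0 q by [].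
  have sw : reflection (val (axis R 0) - val (axis R 1)) (axis R 1) = axis R 0.
    by rewrite -[X in reflection _ X](reflection_swap (axis R 0) (axis R 1)) reflectionK.
  by rewrite /x -[LHS](sdot_reflection (val (axis R 0) - val (axis R 1))) reflectionK sw.
have norm1 q : x 0 q * x 0 q + x 1 q * x 1 q + x 2 q * x 2 q = 1.
  by rewrite -(sdotpp q) [RHS]sdotE.
pose F := \int[mu]_q f q.
(* The trace, with [diag], expresses all second moments through [F] and [X 2 2], that is, through
   the total mass and the axial mean. *)
have sumX : X 0 0 + X 1 1 + X 2 2 = F.
  rewrite /X -!RintD//; last exact: intgD.
  by apply: eq_Rintegral => q _; rewrite -!mulrDl norm1 mul1r.
have mean : axial_mean (axis R 2) f = (3 * X 2 2 - F) / 2.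
  rewrite /axial_mean.
  rewrite (@eq_Rintegral _ _ _ _ _ (fun q => 3 / 2 * (x 2 q * x 2 q * f q) - 1 / 2 * f q)); last first.
    by move=> q _; rewrite /P2 /x; field.
  rewrite RintB ?RintZ//; [|exact: intgZ..].
  by rewrite -/(X 2 2) -/F; field.
pose a := x 0 p; pose b := x 1 p; pose c := x 2 p.
have vol : available_volume eta f p = a ^+ 2 * X 0 0 + b ^+ 2 * X 1 1 + c ^+ 2 * X 2 2 - F / 3 - eta.
  rewrite /available_volume; congr (_ - _).
  rewrite (@eq_Rintegral _ _ _ _ _ (fun q => (a ^+ 2 * (x 0 q * x 0 q * f q) +
     b ^+ 2 * (x 1 q * x 1 q * f q) + c ^+ 2 * (x 2 q * x 2 q * f q) +
     2 * a * b * (x 0 q * x 1 q * f q) + 2 * a * c * (x 0 q * x 2 q * f q) +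
     2 * b * c * (x 1 q * x 2 q * f q)) - 1 / 3 * f q)); last first.
    move=> q _ /=; have -> : sdot p q = a * x 0 q + b * x 1 q + c * x 2 q by exact: sdotE.
    by field.
  have IZ r i j : intg (fun q => r * (x i q * x j q * f q)) by exact: intgZ.
  have I2 := intgD (IZ (a ^+ 2) 0 0) (IZ (b ^+ 2) 1 1).
  have I3 := intgD I2 (IZ (c ^+ 2) 2 2).
  have I4 := intgD I3 (IZ (2 * a * b) 0 1).
  have I5 := intgD I4 (IZ (2 * a * c) 0 2).
  have I6 := intgD I5 (IZ (2 * b * c) 1 2).
  rewrite (RintB I6 (intgZ (1 / 3) If)) (RintD I5 (IZ _ _ _)) (RintD I4 (IZ _ _ _)).
  rewrite (RintD I3 (IZ _ _ _)) (RintD I2 (IZ _ _ _)) (RintD (IZ _ _ _) (IZ _ _ _)).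
  rewrite !RintZ//.
  rewrite -!/(X _ _) -/F (cross 0 1)// (cross 0 2)// (cross 1 2)//.
  by ring.
rewrite vol mean /P2 -/(x 2 p) -/c.
have := norm1 p; rewrite -/a -/b -/c -!expr2 => abc.
have -> : a ^+ 2 = 1 - c ^+ 2 - b ^+ 2 by rewrite -abc; ring.
have F2 : F = 2 * X 0 0 + X 2 2 by rewrite -sumX -diag; ring.
by rewrite -diag F2; field.
Qed.

(** The reflection exchanging [e] with the third axis reduces the claim to that axis; the volume is
    unchanged when the density and the point are reflected together. *)
Lemma available_volumeE eta e f p (ft : R -> R) : intg f ->
  {ae mu, forall q, f q = ft (sdot q e)} ->
  available_volume eta f p = 2 / 3 * axial_mean e f * P2 (sdot p e) - eta.
Proof.
move=> If fE; have mf := intg_measurable If.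
pose w := val e - val (axis R 2).
have mr := measurable_reflection w; have mfr := measurableT_comp mf mr.
have we q : sdot (reflection w q) e = sdot q (axis R 2).
  by rewrite -[LHS](sdot_reflection w) reflectionK reflection_swap.
have If' : intg (f \o reflection w).
  move/integrableP: If => [mEf fi]; apply/integrableP; split; first exact/measurable_EFinP.
  have := ge0_integral_pushforward mr mu measurableT (measurableT_comp (@abse_measurable R _) mEf)
    (fun q _ => abse_ge0 _).
  rewrite preimage_setT => <-; rewrite (eq_measure_integral mu)//.
  by move=> A _ _; exact: area_reflection.
have fE' : {ae mu, forall q, (f \o reflection w) q = ft (sdot q (axis R 2))}.
  by apply: filterS (ae_reflection w fE) => q /=; rewrite we.
have := available_volume_axis eta (reflection w p) If' fE'.
have -> : available_volume eta (f \o reflection w) (reflection w p) = available_volume eta f p.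
  rewrite /available_volume; congr (_ - _).
  have mk : measurable_fun [set: S2 R] (fun q => (sdot p q ^+ 2 - 1 / 3) * f q).
    have mg : measurable_fun [set: R] (fun t : R => t ^+ 2 - 1 / 3).
      by apply: measurable_funB => //; exact: measurable_funX.
    exact: measurable_funM (measurableT_comp mg (measurable_sdotr p)) mf.
  rewrite -[RHS](Rint_reflection w mk); apply: eq_Rintegral => q _ /=.
  by rewrite -[sdot (reflection w p) q](sdot_reflection w) reflectionK.
move=> ->; congr (_ * _ * _ - _).
  have mk : measurable_fun [set: S2 R] (fun q => P2 (sdot q e) * f q).
    exact: measurable_funM (measurableT_comp measurable_P2 (measurable_sdot e)) mf.
  rewrite /axial_mean -[RHS](Rint_reflection w mk); apply: eq_Rintegral => q _ /=.
  by rewrite we.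
by rewrite -[in RHS](reflectionK w p) we.
Qed.

End uniaxial_volume.

(** * Gibbs weights *)

Section gibbs_weight.
Context (R : realType).
Implicit Types (l s v x y K : R).

Lemma expR_lipschitz x y K : x <= K -> y <= K ->
  `|expR x - expR y| <= expR K * `|x - y|.
Proof.
have aux a b : a <= b -> b <= K -> `|expR a - expR b| <= expR K * `|a - b|.
  move=> ab bK; rewrite !ler0_norm ?subr_le0 ?ler_expR// !opprB.
  have -> : expR b - expR a = expR b * (1 - expR (a - b)).
    by rewrite mulrBr mulr1 -expRD; congr (_ - expR _); ring.
  apply: ler_pM; rewrite ?expR_ge0 ?ler_expR//.
    by rewrite subr_ge0 -expR0 ler_expR subr_le0.
  by have := expR_ge1Dx (a - b); lra.
move=> xK yK; have [xy|yx] := leP x y; first exact: aux.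
by rewrite distrC (distrC x); apply: aux => //; exact: ltW.
Qed.

Lemma locally_lipschitz_continuous (f : R -> R) :
  (forall K : R, exists C : R,
    forall x y, `|x| <= K -> `|y| <= K -> `|f x - f y| <= C * `|x - y|) ->
  continuous f.
Proof.
move=> fL x; have [C fC] := fL (`|x| + 1).
have C1 : 0 < `|C| + 1 by rewrite ltr_wpDl.
apply/cvgrPdist_le => e e0; apply/nbhs_ballP.
exists (Num.min 1 (e / (`|C| + 1))) => /=; first by rewrite lt_min ltr01 divr_gt0.
move=> y; rewrite /= lt_min => /andP[/ltW xy1 /ltW xye].
apply: le_trans (fC x y _ _) _.
- by rewrite lerDl.
- rewrite -lerBlDl; apply: le_trans xy1; rewrite distrC; exact: lerB_dist.
apply: (@le_trans _ _ ((`|C| + 1) * `|x - y|)).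
  by rewrite ler_wpM2r// (le_trans (ler_norm _))// lerDl.
by rewrite mulrC -ler_pdivlMr.
Qed.

Variable eta : R.

Definition gibbs_wt l s v : R := expR (l * v) * Num.max (s * v - eta) 0.

Lemma gibbs_wt_ge0 l s v : 0 <= gibbs_wt l s v.
Proof. by rewrite mulr_ge0 ?expR_ge0// le_max lexx orbT. Qed.

Lemma gibbs_wtD l t s v : gibbs_wt (l + t) s v = expR (t * v) * gibbs_wt l s v.
Proof. by rewrite /gibbs_wt mulrDl expRD mulrA (mulrC (expR (t * v))). Qed.

Lemma measurable_gibbs_wt l s : measurable_fun [set: R] (gibbs_wt l s).
Proof.
apply: measurable_funM.
  by apply: measurableT_comp; [exact: measurable_expR|exact: measurable_funM].
apply: measurable_maxr => //; apply: measurable_funB => //; exact: measurable_funM.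
Qed.

(** Serves both as a bound for [gibbs_wt] and as a Lipschitz constant of it in [l] and [s], for
    [|l|, |s| <= K] and [|v| <= 1]. *)
Definition gibbs_lip K := expR K * (K + `|eta| + 1).

Lemma gibbs_lip_ge0 K : 0 <= K -> 0 <= gibbs_lip K.
Proof. by move=> K0; rewrite mulr_ge0 ?expR_ge0// !addr_ge0. Qed.

Lemma max_le K s v : `|s| <= K -> `|v| <= 1 ->
  0 <= Num.max (s * v - eta) 0 <= K + `|eta|.
Proof.
move=> sK v1; have K0 := le_trans (normr_ge0 _) sK.
rewrite le_max lexx orbT ge_max addr_ge0 ?normr_ge0// andbT.
apply: lerD; last by rewrite -normrN ler_norm.
apply: le_trans (ler_norm _) _; rewrite normrM -[leRHS]mulr1; exact: ler_pM.
Qed.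

Lemma mul_le_bound K l v : `|l| <= K -> `|v| <= 1 -> `|l * v| <= K.
Proof. by move=> lK v1; rewrite normrM -[leRHS]mulr1; exact: ler_pM. Qed.

Lemma gibbs_wt_le K l s v : `|l| <= K -> `|s| <= K -> `|v| <= 1 ->
  gibbs_wt l s v <= gibbs_lip K.
Proof.
move=> lK sK v1; have /andP[m0 m1] := max_le sK v1.
apply: ler_pM; rewrite ?expR_ge0//; last by rewrite (le_trans m1)// lerDl.
by rewrite ler_expR (le_trans (ler_norm _))// mul_le_bound.
Qed.

Lemma max_lipschitz s s' v : `|v| <= 1 ->
  `|Num.max (s * v - eta) 0 - Num.max (s' * v - eta) 0| <= `|s - s'|.
Proof.
move=> v1; have : `|(s * v - eta) - (s' * v - eta)| <= `|s - s'|.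
  have -> : (s * v - eta) - (s' * v - eta) = (s - s') * v by ring.
  by rewrite normrM ler_piMr.
move: (s * v - eta) (s' * v - eta) `|s - s'| => a b c.
by rewrite !ler_norml => /andP[h1 h2]; case: (ltP a 0); case: (ltP b 0) => hb ha; lra.
Qed.

Lemma gibbs_wt_lipschitz K l l' s s' v : `|l| <= K -> `|l'| <= K ->
  `|s| <= K -> `|s'| <= K -> `|v| <= 1 ->
  `|gibbs_wt l s v - gibbs_wt l' s' v| <= gibbs_lip K * (`|l - l'| + `|s - s'|).
Proof.
move=> lK lK' sK sK' v1; rewrite /gibbs_wt.
set m := Num.max _ 0; set m' := Num.max _ 0.
have /andP[m0 m1] : 0 <= m <= K + `|eta| by exact: max_le.
have K0 := le_trans (normr_ge0 _) sK.
have -> : expR (l * v) * m - expR (l' * v) * m' =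
  (expR (l * v) - expR (l' * v)) * m + expR (l' * v) * (m - m') by ring.
apply: le_trans (ler_normD _ _) _; rewrite [leRHS]mulrDr; apply: lerD; rewrite normrM.
  have -> : gibbs_lip K * `|l - l'| = (expR K * `|l - l'|) * (K + `|eta| + 1).
    by rewrite /gibbs_lip; ring.
  apply: ler_pM => //; last by rewrite (ger0_norm m0) (le_trans m1)// lerDl.
  apply: le_trans (expR_lipschitz (K := K) _ _) _.
  - by rewrite (le_trans (ler_norm _))// mul_le_bound.
  - by rewrite (le_trans (ler_norm _))// mul_le_bound.
  - by rewrite ler_pM2l ?expR_gt0// -mulrBl normrM ler_piMr.
rewrite ger0_norm ?expR_ge0//; apply: ler_pM; rewrite ?expR_ge0//; last exact: max_lipschitz.
rewrite /gibbs_lip -[leLHS]mulr1; apply: ler_pM; rewrite ?expR_ge0//.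
  by rewrite ler_expR (le_trans (ler_norm _))// mul_le_bound.
by rewrite lerDr addr_ge0.
Qed.

(** Convexity of the positive part. At the kink the subgradient 0 is chosen, in agreement with
    [volume_quotient], which vanishes where the volume is not positive. *)
Lemma max_subgradient s s' v :
  (s' - s) * (if 0 < s * v - eta then v else 0) <=
  Num.max (s' * v - eta) 0 - Num.max (s * v - eta) 0.
Proof.
case: ifPn => [h|]; last first.
  by rewrite -leNgt => h; rewrite mulr0 subr_ge0 [X in X <= _]max_r// le_max lexx orbT.
rewrite (max_l (ltW h)).
apply: (@le_trans _ _ ((s' * v - eta) - (s * v - eta))); last by rewrite lerD2r le_max lexx.
by rewrite le_eqVlt; apply/orP; left; apply/eqP; ring.
Qed.

(** For [v >= 0] this is [1 + y <= exp y]. For negative [v] the gain is less than [t v^2], so the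
    quadratic term keeps the positive part only. *)
Lemma mul_expR_ge t v : 0 <= t -> v + t * Num.max v 0 ^+ 2 <= v * expR (t * v).
Proof.
move=> t0; have [v0|v0] := leP 0 v.
  have := expR_ge1Dx (t * v) => /(ler_wpM2l v0); lra.
rewrite expr0n mulr0 addr0 -subr_ge0.
have -> : v * expR (t * v) - v = (- v) * (1 - expR (t * v)) by ring.
by rewrite mulr_ge0 ?oppr_ge0 ?(ltW v0)// subr_ge0 -expR0 ler_expR mulr_ge0_le0// ltW.
Qed.

Lemma mul_expR_le t v : 0 <= t -> v * expR (- t * v) <= v - t * Num.max (- v) 0 ^+ 2.
Proof. by move=> /(@mul_expR_ge t (- v)); rewrite mulrN mulNr mulNr; lra. Qed.

End gibbs_weight.

(** * Moments of the Gibbs weight as functions of the parameters *)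

Section gibbs_integrals.
Context d (T : measurableType d) (R : realType) (mu : {measure set T -> \bar R}).
Hypothesis mu_fin : (mu setT < +oo)%E.
Context (u : T -> R) (eta : R).
Hypotheses (mu_ : measurable_fun [set: T] u) (u1 : forall x, `|u x| <= 1).
Implicit Types (l s c K : R).

Local Notation intg f := (mu.-integrable [set: T] (EFin \o f)).
Local Notation wt l s x := (gibbs_wt eta l s (u x)).
Local Notation m := (fine (mu [set: T])).

(** [Zint] is the partition function; formally [Uint] is its derivative in [l] and [Bint] its
    derivative in [s]. *)
Definition Zint l s := \int[mu]_x wt l s x.
Definition Uint l s := \int[mu]_x (u x * wt l s x).
Definition Bint l s := \int[mu]_x ((if 0 < s * u x - eta then u x else 0) * expR (l * u x)).

Lemma measurable_wt l s : measurable_fun [set: T] (fun x => wt l s x).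
Proof. exact: measurableT_comp (measurable_gibbs_wt eta l s) mu_. Qed.

Lemma norm_wt_le l s x : `|wt l s x| <= gibbs_lip eta (`|l| + `|s|).
Proof.
by rewrite ger0_norm ?gibbs_wt_ge0// gibbs_wt_le// ?lerDl ?lerDr.
Qed.

Lemma intg_wt l s : intg (fun x => wt l s x).
Proof. exact: intg_bounded mu_fin _ _ (measurable_wt l s) (norm_wt_le l s). Qed.

Lemma intgM_wt (k : T -> R) (M : R) l s : measurable_fun [set: T] k ->
  (forall x, `|k x| <= M) -> intg (fun x => k x * wt l s x).
Proof. exact: intgM_bounded (intg_wt l s). Qed.

Lemma intg_uwt l s : intg (fun x => u x * wt l s x).
Proof. exact: intgM_wt mu_ u1. Qed.

Lemma intg_usubwt c l s : intg (fun x => (u x - c) * wt l s x).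
Proof.
apply: (@intgM_wt _ (1 + `|c|)); first exact: measurable_funB.
by move=> x; rewrite (le_trans (ler_normB _ _))// lerD2r.
Qed.

Lemma Rint_usubwt c l s : \int[mu]_x ((u x - c) * wt l s x) = Uint l s - c * Zint l s.
Proof.
rewrite -(RintZ c (intg_wt l s)) -RintB//; [|exact: intg_uwt|exact: intgZ (intg_wt l s)].
by apply: eq_Rintegral => x _; rewrite mulrBl.
Qed.

Lemma Rint_wt_lipschitz (k : T -> R) K l l' s s' : measurable_fun [set: T] k ->
  (forall x, `|k x| <= 1) -> `|l| <= K -> `|l'| <= K -> `|s| <= K -> `|s'| <= K ->
  `|\int[mu]_x (k x * wt l s x) - \int[mu]_x (k x * wt l' s' x)| <=
  gibbs_lip eta K * m * (`|l - l'| + `|s - s'|).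
Proof.
move=> mk k1 lK lK' sK sK'; rewrite -RintB//; [|exact: intgM_wt mk k1..].
rewrite mulrAC; apply: norm_Rint_le => //.
  by apply: measurable_funB; apply: measurable_funM => //; exact: measurable_wt.
move=> x; rewrite -mulrBr normrM -[leRHS]mul1r; apply: ler_pM => //.
exact: gibbs_wt_lipschitz.
Qed.

Lemma Zint_lipschitz K l l' s s' :
  `|l| <= K -> `|l'| <= K -> `|s| <= K -> `|s'| <= K ->
  `|Zint l s - Zint l' s'| <= gibbs_lip eta K * m * (`|l - l'| + `|s - s'|).
Proof.
move=> lK lK' sK sK'; have := @Rint_wt_lipschitz (fun=> 1) K l l' s s' _ _ lK lK' sK sK'.
rewrite /Zint; under eq_Rintegral do rewrite mul1r.
under [in X in _ - X]eq_Rintegral do rewrite mul1r.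
by apply => // x; rewrite normr1.
Qed.

Lemma Uint_lipschitz K l l' s s' :
  `|l| <= K -> `|l'| <= K -> `|s| <= K -> `|s'| <= K ->
  `|Uint l s - Uint l' s'| <= gibbs_lip eta K * m * (`|l - l'| + `|s - s'|).
Proof. exact: Rint_wt_lipschitz. Qed.

Lemma intg_B (l s : R) : intg (fun x => (if 0 < s * u x - eta then u x else 0) * expR (l * u x)).
Proof.
apply: (@intg_bounded _ _ _ _ mu_fin _ (expR `|l|)).
  apply: measurable_funM.
    apply: measurable_fun_ifT => //.
    apply: measurable_fun_ltr => //; apply: measurable_funB => //.
    exact: measurable_funM.
  by apply: measurableT_comp; [exact: measurable_expR|exact: measurable_funM].
move=> x; rewrite normrM -[leRHS]mul1r; apply: ler_pM => //.
  by case: ifP => // _; rewrite normr0.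
by rewrite ger0_norm ?expR_ge0// ler_expR (le_trans (ler_norm _))// mul_le_bound.
Qed.

Lemma Bint_lipschitz K l l' s : `|l| <= K -> `|l'| <= K ->
  `|Bint l s - Bint l' s| <= expR K * m * `|l - l'|.
Proof.
move=> lK lK'; rewrite /Bint -RintB//; [|exact: intg_B..].
rewrite mulrAC; apply: norm_Rint_le => //.
  by apply: measurable_funB; exact: intg_measurable (intg_B _ _).
move=> x; rewrite -mulrBr normrM -[leRHS]mul1r; apply: ler_pM => //.
  by case: ifP => // _; rewrite normr0.
apply: le_trans (expR_lipschitz (K := K) _ _) _.
- by rewrite (le_trans (ler_norm _))// mul_le_bound.
- by rewrite (le_trans (ler_norm _))// mul_le_bound.
- by rewrite ler_pM2l ?expR_gt0// -mulrBl normrM ler_piMr.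
Qed.

Lemma continuous_Uint_Zint c s : continuous (fun l => Uint l s - c * Zint l s).
Proof.
apply: locally_lipschitz_continuous => K.
pose K' := Num.max K `|s|.
exists ((1 + `|c|) * (gibbs_lip eta K' * m)) => x y xK yK.
have xK' : `|x| <= K' by rewrite le_max xK.
have yK' : `|y| <= K' by rewrite le_max yK.
have sK' : `|s| <= K' by rewrite le_max lexx orbT.
have hU := Uint_lipschitz xK' yK' sK' sK'; have hZ := Zint_lipschitz xK' yK' sK' sK'.
rewrite subrr normr0 addr0 in hU hZ.
have -> : Uint x s - c * Zint x s - (Uint y s - c * Zint y s) =
  (Uint x s - Uint y s) - c * (Zint x s - Zint y s) by ring.
apply: le_trans (ler_normB _ _) _; rewrite normrM.
have := ler_wpM2l (normr_ge0 c) hZ; lra.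
Qed.

(** One-sided second moments about [c]. They measure how fast [Uint - c Zint] moves when [l] is
    raised or lowered, in place of a variance. *)
Definition upper_var c l s := \int[mu]_x (Num.max (u x - c) 0 ^+ 2 * wt l s x).
Definition lower_var c l s := \int[mu]_x (Num.max (- (u x - c)) 0 ^+ 2 * wt l s x).

Lemma intg_var c l s (k : T -> R) : measurable_fun [set: T] k ->
  (forall x, `|k x| <= 1 + `|c|) -> intg (fun x => Num.max (k x) 0 ^+ 2 * wt l s x).
Proof.
move=> mk kM; apply: (@intgM_wt _ ((1 + `|c|) ^+ 2)).
  by apply: measurable_funX; exact: measurable_maxr.
move=> x; rewrite normrX; apply: lerXn2r; rewrite ?nnegrE ?normr_ge0 ?addr_ge0//.
rewrite ger0_norm ?le_max ?lexx ?orbT// ge_max addr_ge0// andbT.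
exact: le_trans (ler_norm _) (kM x).
Qed.

Lemma usub_le c x : `|u x - c| <= 1 + `|c|.
Proof. by rewrite (le_trans (ler_normB _ _))// lerD2r. Qed.

Lemma measurable_usub c : measurable_fun [set: T] (fun x => u x - c).
Proof. exact: measurable_funB. Qed.

Lemma intg_upper c l s : intg (fun x => Num.max (u x - c) 0 ^+ 2 * wt l s x).
Proof. by apply: (@intg_var c); [exact: measurable_usub|exact: usub_le]. Qed.

Lemma intg_lower c l s : intg (fun x => Num.max (- (u x - c)) 0 ^+ 2 * wt l s x).
Proof.
apply: (@intg_var c) => [|x]; last by rewrite normrN usub_le.
by apply: measurableT_comp => //; exact: measurable_usub.
Qed.

(** After [exp (t c)] is factored out, [mul_expR_ge] applies with [v = u - c]: the bound in brackets
    grows at least linearly in [t], so it eventually becomes nonnegative. *)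
Lemma tilt_ge c l s t : 0 <= t ->
  expR (t * c) * ((Uint l s - c * Zint l s) + t * upper_var c l s) <=
  Uint (l + t) s - c * Zint (l + t) s.
Proof.
move=> t0; rewrite -!Rint_usubwt /upper_var.
rewrite -(RintZ t (intg_upper c l s)) -RintD; [|exact: intg_usubwt|exact: intgZ (intg_upper c l s)].
have I1 := intgD (intg_usubwt c l s) (intgZ t (intg_upper c l s)).
rewrite -(RintZ _ I1); apply: le_Rint => [||x]; [exact: intgZ I1|exact: intg_usubwt|].
rewrite gibbs_wtD.
have -> : (u x - c) * (expR (t * u x) * wt l s x) =
  expR (t * c) * (((u x - c) * expR (t * (u x - c))) * wt l s x).
  have -> : expR (t * u x) = expR (t * c) * expR (t * (u x - c)) by rewrite -expRD; congr expR; ring.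
  by ring.
rewrite ler_pM2l ?expR_gt0// [t * (_ * _)]mulrA -mulrDl ler_wpM2r ?gibbs_wt_ge0//.
exact: mul_expR_ge.
Qed.

Lemma tilt_le c l s t : 0 <= t ->
  Uint (l - t) s - c * Zint (l - t) s <=
  expR (- t * c) * ((Uint l s - c * Zint l s) - t * lower_var c l s).
Proof.
move=> t0; rewrite -!Rint_usubwt /lower_var.
rewrite -(RintZ t (intg_lower c l s)) -RintB; [|exact: intg_usubwt|exact: intgZ (intg_lower c l s)].
have I1 := intgB (intg_usubwt c l s) (intgZ t (intg_lower c l s)).
rewrite -(RintZ _ I1); apply: le_Rint => [||x]; [exact: intg_usubwt|exact: intgZ I1|].
rewrite gibbs_wtD.
have -> : (u x - c) * (expR (- t * u x) * wt l s x) =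
  expR (- t * c) * (((u x - c) * expR (- t * (u x - c))) * wt l s x).
  have -> : expR (- t * u x) = expR (- t * c) * expR (- t * (u x - c)) by rewrite -expRD; congr expR; ring.
  by ring.
rewrite ler_pM2l ?expR_gt0// [t * (_ * _)]mulrA -mulrBl ler_wpM2r ?gibbs_wt_ge0//.
exact: mul_expR_le.
Qed.

Lemma zero_tilt c s a b : a <= b -> Uint a s - c * Zint a s <= 0 ->
  0 <= Uint b s - c * Zint b s -> exists2 l, a <= l <= b & Uint l s - c * Zint l s = 0.
Proof.
move=> ab ha hb.
have [|l lab lE] := @IVT R (fun l => Uint l s - c * Zint l s) a b 0 ab
  (continuous_subspaceT (@continuous_Uint_Zint c s)).
  by rewrite ge_min ha le_max hb orbT.
by exists l => //; move: lab; rewrite in_itv.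
Qed.

Lemma exists_tilt c s : 0 < upper_var c 0 s -> 0 < lower_var c 0 s ->
  exists l, Uint l s - c * Zint l s = 0.
Proof.
move=> up lo; pose h := Uint 0 s - c * Zint 0 s.
(* Tilts large enough for the linear gain in [tilt_ge] and [tilt_le] to outweigh the value [h] at
   [l = 0]. *)
pose t := `|h| / upper_var c 0 s; pose t' := `|h| / lower_var c 0 s.
have t0 : 0 <= t by rewrite divr_ge0// ltW.
have t0' : 0 <= t' by rewrite divr_ge0// ltW.
have h1 : 0 <= Uint (0 + t) s - c * Zint (0 + t) s.
  apply: le_trans (tilt_ge c 0 s t0); rewrite mulr_ge0 ?expR_ge0// -/h /t divfK ?gt_eqF//.
  by have := ler_norm (- h); rewrite normrN; lra.
have h2 : Uint (0 - t') s - c * Zint (0 - t') s <= 0.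
  apply: le_trans (tilt_le c 0 s t0') _; rewrite mulr_ge0_le0 ?expR_ge0// -/h /t' divfK ?gt_eqF//.
  by have := ler_norm h; lra.
by have [|l _ lE] := zero_tilt _ h2 h1; [lra|exists l].
Qed.

End gibbs_integrals.

Lemma le0_of_small (R : realFieldType) (x C e0 : R) : 0 < e0 -> 0 <= C ->
  (forall e, 0 < e -> e <= e0 -> x <= C * e) -> x <= 0.
Proof.
move=> e00 C0 h; rewrite leNgt; apply/negP => x0.
have C1 : 0 < C + 1 by rewrite ltr_wpDl.
pose e := Num.min e0 (x / (2 * (C + 1))).
have e_gt0 : 0 < e by rewrite lt_min e00 divr_gt0// mulr_gt0.
have e_le : e <= x / (2 * (C + 1)) by rewrite ge_min lexx orbT.
have := h e e_gt0; rewrite ge_min lexx => /(_ isT); apply/negP; rewrite -ltNge.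
move: e_le; rewrite ler_pdivlMr ?mulr_gt0// => e_le.
by have := mulr_ge0 C0 (ltW e_gt0); lra.
Qed.

Lemma ln_le_subr1 (R : realType) (x : R) : 0 < x -> ln x <= x - 1.
Proof. by move=> x0; have := expR_ge1Dx (ln x); rewrite lnK// => ?; lra. Qed.

(** * Stationarity along self-consistent pairs *)

Section gibbs_stationarity.
Context d (T : measurableType d) (R : realType) (mu : {measure set T -> \bar R}).
Hypothesis mu_fin : (mu setT < +oo)%E.
Context (u : T -> R) (eta : R).
Hypotheses (mu_ : measurable_fun [set: T] u) (u1 : forall x, `|u x| <= 1).
Implicit Types (l s c K : R).

Local Notation wt l s x := (gibbs_wt eta l s (u x)).
Local Notation m := (fine (mu [set: T])).
Local Notation Z := (Zint mu u eta).
Local Notation U := (Uint mu u eta).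
Local Notation B := (Bint mu u eta).

Lemma wt_tilt_ge l s x : expR (- `|l|) * wt 0 s x <= wt l s x.
Proof.
rewrite /gibbs_wt mul0r expR0 mul1r ler_wpM2r ?le_max ?lexx ?orbT//.
rewrite ler_expR; have := mul_le_bound (lexx `|l|) (u1 x).
by rewrite ler_norml => /andP[].
Qed.

(** Since [|u| <= 1], tilting multiplies the weight by at least [exp (- |l|)], so positivity at
    [l = 0] persists. *)
Lemma Rint_tilt_gt0 (k : T -> R) (M : R) l s : measurable_fun [set: T] k ->
  (forall x, `|k x| <= M) -> (forall x, 0 <= k x) ->
  0 < \int[mu]_x (k x * wt 0 s x) -> 0 < \int[mu]_x (k x * wt l s x).
Proof.
move=> mk kM k0 h; have I0 := intgM_wt mu_fin eta mu_ u1 0 s mk kM.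
have Il := intgM_wt mu_fin eta mu_ u1 l s mk kM.
apply: (@lt_le_trans _ _ (expR (- `|l|) * \int[mu]_x (k x * wt 0 s x))).
  by rewrite mulr_gt0 ?expR_gt0.
rewrite -(RintZ _ I0); apply: le_Rint => //; first exact: intgZ.
by move=> x; rewrite mulrCA ler_wpM2l// wt_tilt_ge.
Qed.

Lemma upper_var_gt0 c l s : 0 < upper_var mu u eta c 0 s -> 0 < upper_var mu u eta c l s.
Proof.
apply: (@Rint_tilt_gt0 _ ((1 + `|c|) ^+ 2)) => [|x|x]; last exact: sqr_ge0.
  by apply: measurable_funX; apply: measurable_maxr => //; exact: measurable_usub.
rewrite normrX; apply: lerXn2r; rewrite ?nnegrE ?normr_ge0 ?addr_ge0//.
rewrite ger0_norm ?le_max ?lexx ?orbT// ge_max addr_ge0// andbT.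
exact: le_trans (ler_norm _) (usub_le u1 c x).
Qed.

Lemma lower_var_gt0 c l s : 0 < lower_var mu u eta c 0 s -> 0 < lower_var mu u eta c l s.
Proof.
apply: (@Rint_tilt_gt0 _ ((1 + `|c|) ^+ 2)) => [|x|x]; last exact: sqr_ge0.
  apply: measurable_funX; apply: measurable_maxr => //.
  by apply: measurableT_comp => //; exact: measurable_usub.
rewrite normrX; apply: lerXn2r; rewrite ?nnegrE ?normr_ge0 ?addr_ge0//.
rewrite ger0_norm ?le_max ?lexx ?orbT// ge_max addr_ge0// andbT.
by apply: le_trans (ler_norm _) _; rewrite normrN usub_le.
Qed.

(* Jensen's inequality for the Gibbs measure, from [1 + y <= exp y]. *)
Lemma Zint_tilt_ge c l t s : U l s = c * Z l s -> expR (t * c) * Z l s <= Z (l + t) s.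
Proof.
move=> Uc; have I0 := intg_wt mu_fin eta mu_ u1 l s.
have I1 := intgZ t (intg_usubwt mu_fin eta mu_ u1 c l s).
have -> : Z l s = \int[mu]_x (wt l s x + t * ((u x - c) * wt l s x)).
  rewrite RintD// RintZ//; last exact: intg_usubwt.
  by rewrite Rint_usubwt// Uc subrr mulr0 addr0.
rewrite -RintZ//; last exact: intgD.
apply: le_Rint => [||x].
- by apply: intgZ => //; exact: intgD.
- exact: intg_wt.
rewrite gibbs_wtD; have -> : t * u x = t * c + t * (u x - c) by ring.
rewrite expRD -mulrA ler_pM2l ?expR_gt0//.
rewrite (_ : _ + _ = (1 + t * (u x - c)) * wt l s x); last by ring.
by rewrite ler_wpM2r ?gibbs_wt_ge0// expR_ge1Dx.
Qed.

Lemma Zint_subgradient l s s' : (s' - s) * B l s <= Z l s' - Z l s.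
Proof.
have IB := intg_B mu_fin eta mu_ u1 l s.
have I0 := intg_wt mu_fin eta mu_ u1 l s; have I0' := intg_wt mu_fin eta mu_ u1 l s'.
rewrite /Bint /Zint -RintZ// -RintB//; apply: le_Rint => [||x].
- exact: intgZ.
- exact: intgB.
rewrite mulrA /gibbs_wt -mulrBr mulrC ler_pM2l ?expR_gt0//.
exact: max_subgradient.
Qed.

Lemma Zint_bound K l s : `|l| <= K -> `|s| <= K -> `|Z l s| <= gibbs_lip eta K * m.
Proof.
move=> lK sK; apply: norm_Rint_le => [//||x]; first exact: measurable_wt.
by rewrite ger0_norm ?gibbs_wt_ge0// gibbs_wt_le.
Qed.

(** Jensen's inequality from [(l, s)] to [(l', s)] yields [3 / 2 * s] times [l' - l], exactly the
    change of [3 / 2 * l * s]. What remains is the change of [ln Z] in [s], which [ln x <= x - 1]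
    turns into a difference of [Z], bounded below by the subgradient. *)
Lemma stationarity_step l s l' s' : 0 < Z l s -> 0 < Z l' s' ->
  U l s = 3 / 2 * s * Z l s ->
  3 / 2 * l * s - ln (Z l s) <= 3 / 2 * l' * s' - ln (Z l' s') ->
  (s' - s) * B l' s <= (s' - s) * (3 / 2 * l' * Z l' s').
Proof.
move=> Z0 Z0' Us le.
have J : expR ((l' - l) * (3 / 2 * s)) * Z l s <= Z l' s.
  by have := Zint_tilt_ge (l' - l) Us; rewrite subrKC.
have Zs0 : 0 < Z l' s by apply: lt_le_trans J; rewrite mulr_gt0 ?expR_gt0.
have lJ : (l' - l) * (3 / 2 * s) + ln (Z l s) <= ln (Z l' s).
  rewrite -[X in X + _ <= _]expRK -lnM ?posrE ?expR_gt0//.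
  by rewrite ler_ln ?posrE ?mulr_gt0 ?expR_gt0.
have lq : ln (Z l' s) - ln (Z l' s') <= Z l' s / Z l' s' - 1.
  by rewrite -ln_div ?posrE// ln_le_subr1// divr_gt0.
have : 1 - Z l' s / Z l' s' <= 3 / 2 * l' * (s' - s).
  move: (ln (Z l s)) (ln (Z l' s)) (ln (Z l' s')) (Z l' s / Z l' s') lJ lq le.
  by clear=> x y z w; lra.
move=> /(ler_wpM2r (ltW Z0')); rewrite mulrBl mul1r divfK ?gt_eqF// => h.
by have := Zint_subgradient l' s s'; clear -h; lra.
Qed.

(** At [l + e] and [l - e] the defect [G] has strict opposite signs, with margins [a] and [b] from
    the tilt estimates. Being Lipschitz in [s], it keeps these signs for nearby [s'], and vanishes
    somewhere in between. *)
Lemma selfconsistent_tilt l s e : 0 < e -> U l s = 3 / 2 * s * Z l s ->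
  0 < upper_var mu u eta (3 / 2 * s) l s -> 0 < lower_var mu u eta (3 / 2 * s) l s ->
  exists2 k, 0 < k & forall s', `|s' - s| <= k ->
    exists2 l', `|l' - l| <= e & U l' s' = 3 / 2 * s' * Z l' s'.
Proof.
move=> e0 Us up lo.
pose G l s := U l s - 3 / 2 * s * Z l s.
pose K := `|l| + e + `|s| + 1; pose A := gibbs_lip eta K * m.
have K0 : 0 <= K by rewrite !addr_ge0// ltW.
have A0 : 0 <= A by rewrite mulr_ge0 ?gibbs_lip_ge0// fine_ge0.
pose L := A + 3 / 2 * (A + `|s| * A).
have L0 : 0 <= L by rewrite addr_ge0// mulr_ge0// addr_ge0// mulr_ge0.
have GL l' s' : `|l' - l| <= e -> `|s' - s| <= 1 -> `|G l' s' - G l' s| <= L * `|s' - s|.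
  move=> hl hs.
  have lK : `|l'| <= K.
    have := ler_normD (l' - l) l; rewrite subrK /K.
    by have := normr_ge0 s; lra.
  have sK : `|s| <= K by rewrite /K; have := normr_ge0 l; lra.
  have sK' : `|s'| <= K.
    have := ler_normD (s' - s) s; rewrite subrK /K.
    by have := normr_ge0 l; lra.
  have hU := Uint_lipschitz mu_fin eta mu_ u1 lK lK sK' sK.
  have hZ := Zint_lipschitz mu_fin eta mu_ u1 lK lK sK' sK.
  have hB := Zint_bound lK sK'.
  rewrite subrr normr0 add0r -/A in hU hZ hB.
  have -> : G l' s' - G l' s = (U l' s' - U l' s) -
    3 / 2 * ((s' - s) * Z l' s' + s * (Z l' s' - Z l' s)) by rewrite /G; ring.
  apply: le_trans (ler_normB _ _) _; rewrite normrM (@ger0_norm _ (3 / 2))//.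
  have h3 : `|(s' - s) * Z l' s' + s * (Z l' s' - Z l' s)| <=
      `|s' - s| * A + `|s| * (A * `|s' - s|).
    apply: le_trans (ler_normD _ _) _; rewrite !normrM; apply: lerD; exact: ler_wpM2l.
  by rewrite /L; lra.
have G0 : G l s = 0 by rewrite /G Us subrr.
pose a := expR (e * (3 / 2 * s)) * (e * upper_var mu u eta (3 / 2 * s) l s).
pose b := expR (- e * (3 / 2 * s)) * (e * lower_var mu u eta (3 / 2 * s) l s).
have a0 : 0 < a by rewrite !mulr_gt0 ?expR_gt0.
have b0 : 0 < b by rewrite !mulr_gt0 ?expR_gt0.
have Ga : a <= G (l + e) s.
  have := tilt_ge mu_fin eta mu_ u1 (3 / 2 * s) l s (ltW e0).
  by rewrite Us subrr add0r.
have Gb : G (l - e) s <= - b.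
  have := tilt_le mu_fin eta mu_ u1 (3 / 2 * s) l s (ltW e0).
  by rewrite Us subrr sub0r mulrN.
have L1 : 0 < L + 1 by rewrite ltr_wpDl.
exists (Num.min 1 (Num.min a b / (L + 1))).
  by rewrite lt_min ltr01 divr_gt0// lt_min a0.
move=> s'; rewrite le_min => /andP[s1]; rewrite ler_pdivlMr// le_min => /andP[sa sb].
have Ls : L * `|s' - s| <= `|s' - s| * (L + 1) by have := normr_ge0 (s' - s); clear; lra.
have h1 : 0 <= G (l + e) s'.
  have := GL (l + e) s' _ s1; rewrite addrAC subrr add0r (gtr0_norm e0) => /(_ (lexx _)).
  by rewrite ler_norml => /andP[]; clear -Ga Ls sa; lra.
have h2 : G (l - e) s' <= 0.
  have := GL (l - e) s' _ s1; rewrite addrAC subrr add0r normrN (gtr0_norm e0) => /(_ (lexx _)).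
  by rewrite ler_norml => /andP[]; clear -Gb Ls sb; lra.
have [|l' l'b l'E] := zero_tilt mu_fin mu_ u1 _ h2 h1; first
  by rewrite lerD2l (@le_trans _ _ 0) ?oppr_le0 ?ltW.
exists l'; last by apply/eqP; rewrite -subr_eq0 l'E.
by rewrite ler_distl.
Qed.

(** [stationarity_step] is applied with [s'] on either side of [s]. Its two sides differ from their
    values at [(l, s)] by at most [C e], so letting [e] tend to 0 gives both inequalities. *)
Lemma gibbs_stationary l s k : 0 < k -> 0 < Z l s ->
  U l s = 3 / 2 * s * Z l s ->
  0 < upper_var mu u eta (3 / 2 * s) 0 s -> 0 < lower_var mu u eta (3 / 2 * s) 0 s ->
  (forall l' s', `|l' - l| <= k -> `|s' - s| <= k -> 0 < Z l' s' ->
     U l' s' = 3 / 2 * s' * Z l' s' ->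
     3 / 2 * l * s - ln (Z l s) <= 3 / 2 * l' * s' - ln (Z l' s')) ->
  3 / 2 * l * Z l s = B l s.
Proof.
move=> k0 Z0 Us up lo loc.
have {}up := upper_var_gt0 l up; have {}lo := lower_var_gt0 l lo.
pose K := `|l| + `|s| + 1; pose A := gibbs_lip eta K * m; pose A' := expR K * m.
have m0 : 0 <= m by rewrite fine_ge0.
have K0 : 0 <= K by rewrite !addr_ge0.
have A0 : 0 <= A by rewrite mulr_ge0 ?gibbs_lip_ge0.
have A0' : 0 <= A' by rewrite mulr_ge0 ?expR_ge0.
have A1 : 0 < 2 * A + 1 by rewrite ltr_wpDl// mulr_ge0.
pose C := A' + 3 / 2 * (A + `|l| * (2 * A)).
have C0 : 0 <= C by rewrite addr_ge0// mulr_ge0// addr_ge0// mulr_ge0// mulr_ge0.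
(* The last entry keeps [Z l' s'] positive, the change of [Z] being at most [2 A e]. *)
pose e0 := Num.min (Num.min 1 k) (Z l s / (2 * A + 1) / 2).
have e00 : 0 < e0 by rewrite !lt_min ltr01 k0 !divr_gt0.
have main (t : R) : `|t| = 1 -> t * (B l s - 3 / 2 * l * Z l s) <= 0.
  move=> t1; apply: (le0_of_small e00 C0) => e e_gt0; rewrite !le_min -andbA => /and3P[e1 ek].
  rewrite ler_pdivlMr// ler_pdivlMr// => eZ.
  have [k' k'0 hk'] := selfconsistent_tilt e_gt0 Us up lo.
  pose r := Num.min e k'; pose s' := s + t * r.
  have r0 : 0 < r by rewrite lt_min e_gt0.
  have ssE : s' - s = t * r by rewrite /s' addrAC subrr add0r.
  have ss : `|s' - s| = r by rewrite ssE normrM t1 mul1r gtr0_norm.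
  have re : r <= e by rewrite ge_min lexx.
  have rk' : r <= k' by rewrite ge_min lexx orbT.
  have [|l' ll Us'] := hk' s'; first by rewrite ss.
  have lK : `|l| <= K by rewrite /K; have := normr_ge0 s; lra.
  have sK : `|s| <= K by rewrite /K; have := normr_ge0 l; lra.
  have lK' : `|l'| <= K.
    by have := ler_normD (l' - l) l; rewrite subrK /K; have := normr_ge0 s; lra.
  have sK' : `|s'| <= K.
    by have := ler_normD (s' - s) s; rewrite subrK /K; have := normr_ge0 l; lra.
  have hZ := Zint_lipschitz mu_fin eta mu_ u1 lK' lK sK' sK.
  have hB := Bint_lipschitz mu_fin eta mu_ u1 s lK' lK.
  rewrite -/A -/A' ss in hZ hB.
  have hZ2 : `|Z l' s' - Z l s| <= 2 * A * e.
    apply: le_trans hZ _; rewrite -mulrA mulrCA ler_wpM2l//; lra.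
  have hB2 : `|B l' s - B l s| <= A' * e by apply: le_trans hB _; rewrite ler_wpM2l.
  have Z0' : 0 < Z l' s'.
    move: hZ2; rewrite ler_norml => /andP[h _].
    by have := mulr_ge0 A0 (ltW e_gt0); lra.
  have h : t * B l' s <= t * (3 / 2 * (l' * Z l' s')).
    have := stationarity_step Z0 Z0' Us (loc l' s' (le_trans ll ek) _ Z0' Us').
    by rewrite ss => /(_ (le_trans re ek)); rewrite ssE ![t * r]mulrC -!mulrA ler_pM2l.
  have hZb := Zint_bound lK' sK'; rewrite -/A in hZb.
  have -> : t * (B l s - 3 / 2 * l * Z l s) = (t * B l' s - t * (3 / 2 * (l' * Z l' s')))
     + t * (- (B l' s - B l s) + 3 / 2 * ((l' - l) * Z l' s' + l * (Z l' s' - Z l s))) by ring.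
  rewrite -[leRHS]add0r; apply: lerD; first by rewrite subr_le0.
  apply: le_trans (ler_norm _) _; rewrite normrM t1 mul1r.
  apply: le_trans (ler_normD _ _) _; rewrite normrN /C [leRHS]mulrDl; apply: lerD => //.
  rewrite normrM (@ger0_norm _ (3 / 2))// -[leRHS]mulrA ler_wpM2l//.
  apply: le_trans (ler_normD _ _) _; rewrite !normrM [leRHS]mulrDl -[X in _ <= _ + X]mulrA; apply: lerD.
    by rewrite mulrC; exact: ler_pM.
  exact: ler_wpM2l.
have := main 1 (normr1 _); have := main (-1) (normrN1 _).
rewrite mul1r mulN1r => h1 h2; lra.
Qed.

End gibbs_stationarity.

Section finite_measure_ae.
Context d (T : measurableType d) (R : realType) (mu : {measure set T -> \bar R}).
Implicit Types f g : T -> R.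

Local Notation intg f := (mu.-integrable [set: T] (EFin \o f)).

Lemma Rint0 : \int[mu]_(x in [set: T]) (0 : R) = 0.
Proof. by rewrite /Rintegral integral0. Qed.

Lemma intg_le_ae f g : measurable_fun [set: T] f -> intg g ->
  {ae mu, forall x, `|f x| <= g x} -> intg f.
Proof.
move=> mf Ig fg; apply/integrableP; split; first exact/measurable_EFinP.
move/integrableP : (Ig) => [mg]; apply: le_lt_trans.
apply: ae_ge0_le_integral => //.
- by apply: measurableT_comp => //; exact/measurable_EFinP.
- exact: measurableT_comp.
- by apply: filterS fg => x fgx _ /=; rewrite lee_fin (le_trans fgx)// ler_norm.
Qed.

Lemma le_Rint_ae f g : intg f -> intg g -> {ae mu, forall x, f x <= g x} ->
  \int[mu]_x f x <= \int[mu]_x g x.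
Proof.
move=> If Ig fg; rewrite -subr_ge0 -RintB//; apply: Rint_ae_ge0.
  exact: measurable_funB (intg_measurable Ig) (intg_measurable If).
by apply: filterS fg => x; rewrite subr_ge0.
Qed.

End finite_measure_ae.

(** * L^r norms over a finite measure *)

Section Lnorm_finite_measure.
Context d (T : measurableType d) (R : realType) (mu : {measure set T -> \bar R}).
Hypothesis mu_fin : (mu setT < +oo)%E.
Context (r : \bar R).
Hypothesis r1 : (1 <= r)%E.
Implicit Types f g : T -> R.

Local Notation nrm f := (Lnorm mu r (EFin \o f)).

Lemma le_Lnorm f g : measurable_fun [set: T] f -> measurable_fun [set: T] g ->
  {ae mu, forall x, `|f x| <= `|g x|} -> (nrm f <= nrm g)%E.
Proof.
move=> mf mg fg; rewrite unlock /Lnorm; case: r r1 => [s|_|//].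
  rewrite lee_fin => s1; have s0 : 0 < s by exact: lt_le_trans s1.
  apply: gt0_ler_poweR; rewrite ?invr_ge0 ?(ltW s0)//.
  - by rewrite in_itv/= leey integral_ge0// => x _; exact: poweR_ge0.
  - by rewrite in_itv/= leey integral_ge0// => x _; exact: poweR_ge0.
  apply: ae_ge0_le_integral => //.
  - by move=> x _; exact: poweR_ge0.
  - apply: (@measurableT_comp _ _ _ _ _ _ (fun x => x `^ s)%E); first exact: measurable_poweR.
    by apply: measurableT_comp => //; exact/measurable_EFinP.
  - by move=> x _; exact: poweR_ge0.
  - apply: (@measurableT_comp _ _ _ _ _ _ (fun x => x `^ s)%E); first exact: measurable_poweR.
    by apply: measurableT_comp => //; exact/measurable_EFinP.
  - apply: filterS fg => x fgx _ /=.
    by rewrite lee_fin ge0_ler_powR// ?nnegrE// ltW.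
by case: ifPn => // _; apply: ess_sup_inf.le_ess_sup; apply: filterS fg => x fgx /=; rewrite lee_fin.
Qed.

Lemma Lnorm_cst1_lty : (nrm (cst 1%R) < +oo)%E.
Proof.
rewrite unlock /Lnorm; case: r r1 => [s|_|//].
  move=> _; apply: poweR_lty.
  under eq_integral do rewrite /= normr1 powR1.
  by rewrite integral_cst// mul1e.
case: ifPn => // h.
have -> : abse \o (EFin \o cst 1%R) = cst 1%E :> (T -> \bar R).
  by apply/funext => x /=; rewrite normr1.
by rewrite ess_sup_inf.ess_sup_cst// ltry.
Qed.

Lemma LnormZ_fin (a : R) f : measurable_fun [set: T] f -> (nrm f < +oo)%E ->
  (nrm (fun x => (a * f x)%R) = `|a|%:E * nrm f)%E.
Proof.
move=> mf ff; have fL : f \in Lfun mu r.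
  by apply/andP; split; rewrite inE.
by have := @LnormZ _ _ _ mu r r1 (Lfun_Sub r1 fL) a.
Qed.

Lemma Lnorm_bounded f (M : R) : measurable_fun [set: T] f -> 0 <= M ->
  {ae mu, forall x, `|f x| <= M} -> (nrm f <= M%:E * nrm (cst 1%R))%E.
Proof.
move=> mf M0 fM; rewrite -{1}(ger0_norm M0) -LnormZ_fin//; last exact: Lnorm_cst1_lty.
apply: le_Lnorm => //; first exact: measurable_funM.
by apply: filterS fM => x; rewrite mulr1 (ger0_norm M0).
Qed.

Lemma Lnorm_bounded_lty f (M : R) : measurable_fun [set: T] f ->
  {ae mu, forall x, `|f x| <= M} -> (nrm f < +oo)%E.
Proof.
move=> mf fM; apply: (@le_lt_trans _ _ (`|M|%:E * nrm (cst 1%R))%E).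
  apply: Lnorm_bounded => //.
  by apply: filterS fM => x /le_trans; apply; exact: ler_norm.
by rewrite lte_mul_pinfty//; exact: Lnorm_cst1_lty.
Qed.

Lemma LnormD_lty f g : measurable_fun [set: T] f -> measurable_fun [set: T] g ->
  (nrm f < +oo)%E -> (nrm g < +oo)%E -> (nrm (fun x => (f x + g x)%R) < +oo)%E.
Proof.
move=> mf mg ff gf; apply: le_lt_trans (eminkowski mu mf mg r1) _.
by rewrite lte_add_pinfty.
Qed.

Lemma LnormB_lty f g : measurable_fun [set: T] f -> measurable_fun [set: T] g ->
  (nrm f < +oo)%E -> (nrm g < +oo)%E -> (nrm (fun x => (f x - g x)%R) < +oo)%E.
Proof.
move=> mf mg ff gf.
have -> : (fun x => f x - g x) = (fun x => f x + (-1) * g x).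
  by apply/funext => x; rewrite mulN1r.
apply: LnormD_lty => //; first exact: measurable_funM.
by rewrite LnormZ_fin// lte_mul_pinfty.
Qed.

End Lnorm_finite_measure.

(** * The relative entropy integrand *)

Section relative_entropy.
Context (R : realType).
Implicit Types a b t : R.

(* The integrand of the relative entropy, corrected by [b - a] so that it is
   nonnegative pointwise. *)
Definition klf a b : R := if 0 < b then a * ln a - a * ln b - a + b else 0.

(** [a ln a] lies above its tangent at [z]; at [a = 0] the left side is [- z]. *)
Lemma mul_ln_ge a z : 0 <= a -> 0 < z -> a * ln z + a - z <= a * ln a.
Proof.
rewrite le_eqVlt => /predU1P[<-|a0] z0; first by rewrite !mul0r addr0 sub0r oppr_le0 ltW.
have := ln_le_subr1 (divr_gt0 z0 a0); rewrite ln_div ?posrE// => /(ler_wpM2l (ltW a0)).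
have -> : a * (z / a - 1) = z - a by field; rewrite gt_eqF.
by lra.
Qed.

Lemma klf_ge0 a b : 0 <= a -> 0 <= klf a b.
Proof. by move=> a0; rewrite /klf; case: ifPn => // b0; have := mul_ln_ge a0 b0; lra. Qed.

Lemma klf_id b : klf b b = 0.
Proof. by rewrite /klf; case: ifPn => // _; ring. Qed.

Lemma klf_eq0 a b : 0 <= a -> 0 < b -> klf a b = 0 -> a = b.
Proof.
rewrite le_eqVlt => /predU1P[<-|a0] b0; rewrite /klf b0; first by rewrite !mul0r; lra.
have [->//|ba] := eqVneq a b.
have q0 : 0 < b / a by rewrite divr_gt0.
have ln0 : ln (b / a) != 0.
  apply/eqP => h; move: (lnK q0); rewrite h expR0 => /esym ba1.
  by move/eqP: ba; apply; rewrite -[b](divfK (lt0r_neq0 a0)) ba1 mul1r.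
have := expR_gt1Dx ln0; rewrite lnK// -(ltr_pM2l a0) ln_div ?posrE//.
have -> : a * (b / a) = b by field; rewrite gt_eqF.
by lra.
Qed.

(** Convexity in the first argument, with [klf b b = 0]: the tangent of [x ln x] at the mixture is
    evaluated at both [a] and [b]. *)
Lemma klf_mix t a b : 0 < t -> t <= 1 -> 0 <= a ->
  klf ((1 - t) * a + t * b) b <= (1 - t) * klf a b.
Proof.
move=> t0 t1 a0; rewrite /klf; case: ifPn => [b0|_]; last by rewrite mulr0.
have t1' : 0 <= 1 - t by rewrite subr_ge0.
set z := (1 - t) * a + t * b.
have z0 : 0 < z by rewrite ltr_wpDl ?mulr_ge0 ?mulr_gt0.
have h1 := ler_wpM2l t1' (mul_ln_ge a0 z0); have h2 := ler_wpM2l (ltW t0) (mul_ln_ge (ltW b0) z0).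
move: h1 h2; rewrite /z; move: (ln _) (ln a) (ln b) => x y w; lra.
Qed.

End relative_entropy.

Lemma measurable_klf d (T : measurableType d) (R : realType) (f g : T -> R) :
  measurable_fun [set: T] f -> measurable_fun [set: T] g ->
  measurable_fun [set: T] (fun x => klf (f x) (g x)).
Proof.
move=> mf mg; have ml h : measurable_fun [set: T] h -> measurable_fun [set: T] (fun x => ln (h x : R)).
  by move=> mh; exact: measurableT_comp (@measurable_ln R) mh.
apply: measurable_fun_ifT => //; first exact: measurable_fun_ltr.
apply: measurable_funD => //; apply: measurable_funB => //.
by apply: measurable_funB; apply: measurable_funM => //; exact: ml.
Qed.

(** * Energy on the sphere *)

Section sphere_gibbs.
Context (R : realType) (eta : R) (e : S2 R).
Implicit Types (p : S2 R) (f g : S2 R -> R) (l s : R).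
Local Notation mu := (@area R).
Local Notation intg f := (mu.-integrable [set: S2 R] (EFin \o f)).

Definition leg p : R := P2 (sdot p e).

Lemma measurable_leg : measurable_fun [set: S2 R] leg.
Proof. exact: measurableT_comp (@measurable_P2 R) (measurable_sdot e). Qed.

Lemma normr_P2_le1 (x : R) : `|x| <= 1 -> `|P2 x| <= 1.
Proof.
move=> x1; have : x ^+ 2 <= 1 by rewrite -real_normK ?num_real// expr_le1.
by have := sqr_ge0 x; rewrite /P2 ler_norml => h1 h2; apply/andP; split; lra.
Qed.

Lemma normr_leg_le1 p : `|leg p| <= 1.
Proof. exact: normr_P2_le1 (normr_sdot_le1 p e). Qed.

(** [P2 x = c] has at most the two solutions [a] and [- a], and a finite set of values of [p . e]
    has a null preimage. *)
Lemma leg_level_null (c : R) : {ae mu, forall p, leg p != c}.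
Proof.
pose a := Num.sqrt ((2 * c + 1) / 3).
pose A : set (measurableTypeR R) := [set a] `|` [set - a].
have mA : measurable A by apply: measurableU; exact: measurable_set1.
have A0 : lebesgue_measure A = 0%E.
  apply: countable_lebesgue_measure0; apply: finite_set_countable.
  by rewrite /A finite_setU; split; exact: finite_set1.
exists [set p | A (sdot p e)]; split.
- exact: measurable_sdot_preimage.
- exact: area_sdot_null.
- move=> p /= /negP; rewrite negbK => /eqP; rewrite /leg /P2 => h.
  have xE : sdot p e ^+ 2 = (2 * c + 1) / 3 by rewrite -h; field.
  have aE : a = `|sdot p e| by rewrite /a -xE sqrtr_sqr.
  rewrite /A aE; case: (ler0P (sdot p e)) => _; last by left.
  by right; rewrite /= opprK.
Qed.

Local Notation u := leg.
Local Notation Z := (Zint mu u eta).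
Local Notation U := (Uint mu u eta).
Local Notation wt l s p := (gibbs_wt eta l s (u p)).

Definition gd l s p : R := wt l s p / Z l s.

Lemma measurable_gd l s : measurable_fun [set: S2 R] (gd l s).
Proof.
have mw := measurable_wt eta measurable_leg l s.
exact: measurable_funM mw (measurable_cst _).
Qed.

Lemma intg_gd l s : intg (gd l s).
Proof.
have := intgZ ((Z l s)^-1) (intg_wt (area_lty R) eta measurable_leg normr_leg_le1 l s).
by have -> : (fun p => (Z l s)^-1 * wt l s p) = gd l s
  by apply/funext => p; rewrite mulrC.
Qed.

Lemma gd_ge0 l s p : 0 < Z l s -> 0 <= gd l s p.
Proof. by move=> Z0; rewrite divr_ge0 ?gibbs_wt_ge0// ltW. Qed.

Lemma gd_gt0 l s p : 0 < Z l s -> (0 < gd l s p) = (0 < s * u p - eta).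
Proof.
move=> Z0; rewrite /gd pmulr_lgt0 ?invr_gt0// /gibbs_wt pmulr_rgt0 ?expR_gt0//.
by rewrite lt_max ltxx orbF.
Qed.

Lemma gd_eq0 l s p : s * u p - eta <= 0 -> gd l s p = 0.
Proof. by move=> h; rewrite /gd /gibbs_wt max_r// mulr0 mul0r. Qed.

Lemma Rint_gd l s : 0 < Z l s -> \int[mu]_p gd l s p = 1.
Proof.
have I := intg_wt (area_lty R) eta measurable_leg normr_leg_le1 l s.
move=> Z0; rewrite (@eq_Rintegral _ _ _ _ _ (fun p => (Z l s)^-1 * wt l s p)).
  rewrite (RintZ _ I).
  by rewrite mulVf// gt_eqF.
by move=> p _; rewrite mulrC.
Qed.

Lemma axial_mean_gd l s : axial_mean e (gd l s) = U l s / Z l s.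
Proof.
have I := intg_uwt (area_lty R) eta measurable_leg normr_leg_le1 l s.
rewrite /axial_mean (@eq_Rintegral _ _ _ _ _ (fun p => (Z l s)^-1 * (u p * wt l s p))).
  by rewrite (RintZ _ I) mulrC.
by move=> p _; rewrite /gd /leg; ring.
Qed.

Lemma density_of_Rint f : intg f -> {ae mu, forall p, 0 <= f p} ->
  \int[mu]_p f p = 1 -> density mu setT f.
Proof.
move=> If f0 f1; split => //; first by apply: filterS f0 => p fp _.
by rewrite -EFin_Rint// f1.
Qed.

Lemma Rint_of_density f : density mu setT f ->
  [/\ intg f, {ae mu, forall p, 0 <= f p} & \int[mu]_p f p = 1].
Proof.
move=> [If f0 f1]; split => //; last by rewrite /Rintegral f1.
by apply: filterS f0 => p; exact.
Qed.

Lemma uniaxial_gd l s : 0 < Z l s -> uniaxial_density (gd l s).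
Proof.
move=> Z0; split.
  apply: density_of_Rint (intg_gd l s) _ (Rint_gd Z0).
  by apply: aeW => p; exact: gd_ge0.
by exists (fun x => gibbs_wt eta l s (P2 x) / Z l s), e; exact: aeW.
Qed.

Lemma axial_volume f (ft : R -> R) p : intg f -> {ae mu, forall q, f q = ft (sdot q e)} ->
  available_volume eta f p = 2 / 3 * axial_mean e f * u p - eta.
Proof. exact: available_volumeE. Qed.

(** Where the volume [V] is positive, [ln (gd l s p) = l u + ln V - ln Z], so that [x ln x - x ln V]
    is the entropy integrand plus terms affine in [x]. Elsewhere [x = 0] and both sides vanish, by
    [0 * (+oo) = 0]. *)
Lemma energy_integrand l s p (x : R) : 0 < Z l s -> 0 <= x ->
  (s * u p - eta <= 0 -> x = 0) ->
  ((x * ln x)%:E + x%:E * neg_ln (s * u p - eta) =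
   (klf x (gd l s p) + (x - gd l s p) + (l * (u p * x) - ln (Z l s) * x))%:E)%E.
Proof.
move=> Z0 x0; rewrite /klf gd_gt0// /neg_ln; case: ltP => [V0 _|V0 /(_ isT) ->].
  rewrite -EFinM -EFinD; congr EFin.
  rewrite [ln (gd l s p)]ln_div ?posrE//; last first.
    by rewrite /gibbs_wt mulr_gt0 ?expR_gt0// lt_max V0.
  rewrite /gibbs_wt lnM ?posrE ?expR_gt0 ?lt_max ?V0// expRK max_l ?ltW//.
  by ring.
by rewrite gd_eq0// !mul0r mul0e adde0 !mulr0 !subr0 !addr0.
Qed.

Section energy.
Context (f : S2 R -> R) (l s : R).
Hypotheses (Z0 : 0 < Z l s) (If : intg f) (f0 : {ae mu, forall p, 0 <= f p})
  (f1 : \int[mu]_p f p = 1)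
  (vol : forall p, available_volume eta f p = s * u p - eta).

Local Notation k p := (klf (f p) (gd l s p)).

Let measurable_f : measurable_fun [set: S2 R] f.
Proof. exact: intg_measurable If. Qed.

Let measurable_k : measurable_fun [set: S2 R] (fun p => k p).
Proof. exact: measurable_klf measurable_f (measurable_gd l s). Qed.

Let rest p : R := (f p - gd l s p) + (l * (u p * f p) - ln (Z l s) * f p).

Let intg_uf : intg (fun p => u p * f p).
Proof. exact: intgM_bounded If measurable_leg normr_leg_le1. Qed.

Let intg_rest : intg rest.
Proof.
exact: intgD (intgB If (intg_gd l s)) (intgB (intgZ l intg_uf) (intgZ (ln (Z l s)) If)).
Qed.

Let Rint_rest : \int[mu]_p rest p = l * axial_mean e f - ln (Z l s).
Proof.
rewrite (RintD (intgB If (intg_gd l s)) (intgB (intgZ l intg_uf) (intgZ (ln (Z l s)) If))).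
rewrite (RintB If (intg_gd l s)) (RintB (intgZ l intg_uf) (intgZ (ln (Z l s)) If)).
by rewrite (RintZ _ intg_uf) (RintZ _ If) f1 Rint_gd// subrr add0r mulr1.
Qed.

Lemma measurable_energy : measurable_fun [set: S2 R]
  (fun p => ((f p * ln (f p))%:E + (f p)%:E * neg_ln (available_volume eta f p))%E).
Proof.
have ml (h : S2 R -> R) : measurable_fun [set: S2 R] h ->
    measurable_fun [set: S2 R] (fun p => ln (h p)).
  by move=> mh; exact: measurableT_comp (@measurable_ln R) mh.
have mf := measurable_f.
have mV : measurable_fun [set: S2 R] (fun p => s * u p - eta).
  exact: measurable_funB (measurable_funM (measurable_cst _) measurable_leg) (measurable_cst _).
have mneg : measurable_fun [set: R] (@neg_ln R).
  apply: measurable_fun_ifT; first exact: measurable_fun_ltr.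
    apply/measurable_EFinP; apply: measurableT_comp => //; exact: measurable_ln.
  exact: measurable_cst.
have mfl := measurable_funM mf (ml _ mf).
apply: emeasurable_funD; first exact/measurable_EFinP.
apply: emeasurable_funM; first exact/measurable_EFinP.
rewrite (_ : (fun p => _) = @neg_ln R \o (fun p => s * u p - eta)).
  exact: measurableT_comp mneg mV.
by apply/funext => p /=; rewrite vol.
Qed.

Lemma energyE : {ae mu, forall p, s * u p - eta <= 0 -> f p = 0} -> intg (fun p => k p) ->
  free_energy eta f = (\int[mu]_p k p + (l * axial_mean e f - ln (Z l s)))%:E.
Proof.
move=> fV Ik; rewrite -Rint_rest -(RintD Ik intg_rest) (EFin_Rint (intgD Ik intg_rest)).
have m2 : measurable_fun [set: S2 R] (fun p => (k p + rest p)%:E).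
  exact: (measurable_int mu (intgD Ik intg_rest)).
rewrite /free_energy; refine (@ae_eq_integral _ _ _ mu setT _ _ measurableT measurable_energy m2 _).
apply: filterS2 f0 fV => p fp fVp _.
by rewrite vol (energy_integrand Z0 fp fVp) /rest -addrA.
Qed.

Let h p : \bar R := ((f p * ln (f p))%:E + (f p)%:E * neg_ln (s * u p - eta))%E.

Let measurable_h : measurable_fun [set: S2 R] h.
Proof.
rewrite (_ : h = (fun p => ((f p * ln (f p))%:E + (f p)%:E * neg_ln (available_volume eta f p))%E)).
  exact: measurable_energy.
by apply/funext => p; rewrite vol.
Qed.

(* The integrand is bounded below by an integrable function, since [x ln x]
   is at least [-1] and the volume is bounded above. *)
Lemma integrable_energy : (free_energy eta f < +oo)%E -> mu.-integrable [set: S2 R] h.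
Proof.
move=> fin; have mh := measurable_h.
have finh : (\int[mu]_p h p < +oo)%E.
  by move: fin; rewrite /free_energy; under eq_integral do rewrite vol.
(* Bounds [ln V] through [ln V <= V - 1], since [|u| <= 1]. *)
pose C := `|s| + `|eta|.
have C0 : 0 <= C by rewrite addr_ge0.
have Ib : intg (fun p => 1 + C * `|f p|).
  apply: intgD; first exact: intg_cst (area_lty R) 1.
  by apply: intgZ; have := integrable_norm If.
have hneg : {ae mu, forall p, (h^\- p <= (1 + C * `|f p|)%:E)%E}.
  apply: filterS f0 => p fp; rewrite funenegE ge_max; apply/andP; split; last first.
    by rewrite lee_fin addr_ge0// mulr_ge0.
  rewrite /h /neg_ln; case: ltP => [V0|V0]; last first.
    have [->|fp0] := eqVneq (f p) 0.
      by rewrite mul0r mul0e adde0 oppe0 lee_fin normr0 mulr0 addr0.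
    by rewrite gt0_muley ?lte_fin ?lt0r ?fp0//= leNye.
  rewrite -EFinM -EFinD -EFinN lee_fin (ger0_norm fp).
  have h1 := mul_ln_ge fp (@ltr01 R); rewrite ln1 mulr0 add0r in h1.
  have h2 : ln (s * u p - eta) <= C.
    apply: le_trans (ln_le_subr1 V0) _.
    have := ler_norm (s * u p); rewrite normrM.
    have := ler_wpM2l (normr_ge0 s) (normr_leg_le1 p).
    have := ler_norm (- eta); rewrite normrN /C.
    move: (s * u p) (`|s| * `|u p|) => a b; lra.
  have := ler_wpM2l fp h2; move: h1.
  move: (f p * ln (f p)) (ln (s * u p - eta)) => a b; lra.
have hn : (\int[mu]_p h^\- p < +oo)%E.
  apply: (@le_lt_trans _ _ (\int[mu]_p (1 + C * `|f p|)%:E)%E).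
    apply: (ae_ge0_le_integral measurableT _ (measurable_funeneg mh) _ (measurable_int mu Ib)).
    - by move=> p _.
    - by move=> p _; rewrite lee_fin addr_ge0// mulr_ge0.
    - by apply: filterS hneg => p hp _.
  by rewrite -(EFin_Rint Ib) ltry.
apply/integrableP; split => //.
rewrite integralE in finh.
rewrite (_ : (fun p => `|h p|)%E = (h^\+ \+ h^\-)%E); last by rewrite -fune_abse.
rewrite (ge0_integralD _ measurableT _ (measurable_funepos mh) _ (measurable_funeneg mh))//.
rewrite lte_add_pinfty//.
have hfin : (\int[mu]_p h^\- p)%E \is a fin_num.
  by rewrite ge0_fin_numE//; apply: integral_ge0 => p _; exact: funeneg_ge0.
by move: finh; rewrite lteBlDr// => /lt_le_trans; apply; exact: leey.
Qed.

(** Where [f] is positive and the volume is not, the integrand is infinite; an integrable function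
    is finite almost everywhere. *)
Lemma finite_energy_support : (free_energy eta f < +oo)%E ->
  {ae mu, forall p, s * u p - eta <= 0 -> f p = 0}.
Proof.
move=> fin; have Ih := integrable_energy fin.
have hfin : {ae mu, forall p, h p \is a fin_num}.
  by apply: filterS (integrable_ae measurableT Ih) => p; exact.
apply: filterS2 f0 hfin => p fp hp V0; apply/eqP; apply: contraT => fp0.
by move: hp; rewrite /h /neg_ln ltNge V0/= gt0_muley// lte_fin lt0r fp0.
Qed.

(** Almost everywhere the entropy integrand is the energy integrand minus [rest], and both are
    integrable. *)
Lemma finite_energy_klf : (free_energy eta f < +oo)%E -> intg (fun p => k p).
Proof.
move=> fin; have Ih := integrable_energy fin; have fV := finite_energy_support fin.
have mh := measurable_h; pose h' p := fine (h p).
have mh' : measurable_fun [set: S2 R] h' by exact: measurableT_comp (@fine_measurable R setT measurableT) mh.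
have Ih' : intg h'.
  have mE : measurable_fun [set: S2 R] (EFin \o h') by apply/measurable_EFinP; exact: mh'.
  have hh p : [set: S2 R] p -> (`|(EFin \o h') p| <= `|h p|)%E.
    by move=> _; rewrite /= /h'; case: (h p) => [x||] /=; rewrite ?normr0 ?lexx ?leey.
  exact: (le_integrable measurableT mE hh Ih).
apply: (intg_le_ae measurable_k (g := fun p => `|h' p - rest p|)).
  exact: (integrable_norm (intgB Ih' intg_rest)).
apply: filterS2 f0 fV => p fp fVp.
rewrite /h' /h (energy_integrand Z0 fp fVp) /=.
by rewrite (_ : _ - rest p = k p)// /rest; ring.
Qed.

End energy.
End sphere_gibbs.

(** * Dependence of the Gibbs density on its parameters *)

Section gibbs_close.
Context (R : realType) (eta : R) (e : S2 R).
Implicit Types (l s : R).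
Local Notation mu := (@area R).
Local Notation m := (fine (mu [set: S2 R])).
Local Notation Z := (Zint mu (leg e) eta).

(** The estimate is uniform in [p] because the area is finite: it then controls the L^r norm for
    every [r] in [[1, +oo]]. *)
Lemma gd_close l s e1 : 0 < Z l s -> 0 < e1 ->
  exists2 k, 0 < k & forall l' s', `|l' - l| <= k -> `|s' - s| <= k ->
    forall p, `|gd eta e l s p - gd eta e l' s' p| <= e1.
Proof.
move=> Z0 e10; pose K := `|l| + `|s| + 1; pose G := gibbs_lip eta K.
have K0 : 0 <= K by rewrite !addr_ge0.
have G0 : 0 <= G by exact: gibbs_lip_ge0.
have m0 : 0 <= m by rewrite fine_ge0.
(* [A] exceeds the Lipschitz constant of [Z], and [C] that of the quotient once [Z l' s'] is at
   least half of [Z l s]; the summands 1 keep both positive. *)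
pose A := 2 * (G * m) + 1; have A0 : 0 < A by rewrite ltr_wpDl// mulr_ge0// mulr_ge0.
pose C := (2 * G * Z l s + G * A) * 2 / Z l s ^+ 2 + 1.
have C0 : 0 < C.
  rewrite ltr_wpDl// divr_ge0 ?sqr_ge0// mulr_ge0// addr_ge0// mulr_ge0 ?(ltW Z0) ?(ltW A0)//.
  exact: mulr_ge0.
exists (Num.min 1 (Num.min (Z l s / 2 / A) (e1 / C))).
  by rewrite !lt_min ltr01 !divr_gt0.
move=> l' s'; rewrite !le_min => /and3P[l1 lZ le] /and3P[s1 sZ se] p.
pose k := Num.max `|l' - l| `|s' - s|.
have lk : `|l' - l| <= k by rewrite le_max lexx.
have sk : `|s' - s| <= k by rewrite le_max lexx orbT.
have kZ : k <= Z l s / 2 / A by rewrite ge_max lZ.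
have ke : k <= e1 / C by rewrite ge_max le.
have k0 : 0 <= k by rewrite (le_trans _ lk).
have lK : `|l| <= K by rewrite /K -addrA lerDl addr_ge0.
have sK : `|s| <= K by rewrite /K addrAC lerDr addr_ge0.
have lK' : `|l'| <= K.
  rewrite -[l'](subrK l) (le_trans (ler_normD _ _))// addrC /K.
  by rewrite -addrA lerD2l (le_trans l1)// lerDr.
have sK' : `|s'| <= K.
  rewrite -[s'](subrK s) (le_trans (ler_normD _ _))// addrC /K.
  apply: (@le_trans _ _ (`|s| + 1)); first by rewrite lerD2l.
  by rewrite -addrA lerDr.
have hZ : `|Z l' s' - Z l s| <= A * k.
  have := Zint_lipschitz (area_lty R) eta (measurable_leg e) (normr_leg_le1 e) lK' lK sK' sK.
  move=> /le_trans; apply; rewrite -/G.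
  apply: (@le_trans _ _ (G * m * (k + k))).
    by apply: ler_wpM2l; [exact: mulr_ge0|exact: lerD].
  have -> : G * m * (k + k) = 2 * (G * m) * k by ring.
  by rewrite ler_wpM2r// lerDl.
have Z2 : Z l s / 2 <= Z l' s'.
  have h : A * k <= Z l s / 2 by rewrite mulrC -ler_pdivlMr.
  by move: hZ; rewrite ler_norml => /andP[h1 _]; move: h h1; clear; lra.
have Z0' : 0 < Z l' s' by rewrite (lt_le_trans _ Z2)// divr_gt0.
set w := gibbs_wt eta l s (leg e p); set w' := gibbs_wt eta l' s' (leg e p).
have ww : `|w - w'| <= G * (k + k).
  apply: le_trans (gibbs_wt_lipschitz eta lK lK' sK sK' (normr_leg_le1 e p)) _.
  by rewrite -/G ler_wpM2l// distrC (distrC s) lerD.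
have wG : w <= G by exact: gibbs_wt_le lK sK (normr_leg_le1 e p).
have w0 : 0 <= w by exact: gibbs_wt_ge0.
have -> : gd eta e l s p - gd eta e l' s' p =
   ((w - w') * Z l s + w * (Z l' s' - Z l s)) / (Z l s * Z l' s').
  by rewrite /gd -/w -/w'; field; rewrite !gt_eqF.
rewrite normrM normfV (@ger0_norm _ (_ * Z l' s')) ?mulr_ge0 ?(ltW Z0) ?(ltW Z0')//.
rewrite ler_pdivrMr ?mulr_gt0//.
apply: le_trans (ler_normD _ _) _; rewrite (normrM (w - w')) (normrM w) (gtr0_norm Z0) (ger0_norm w0).
apply: (@le_trans _ _ ((2 * G * Z l s + G * A) * k)).
  rewrite mulrDl; apply: lerD.
    rewrite mulrAC ler_wpM2r ?(ltW Z0)//; apply: le_trans ww _.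
    by have -> : 2 * G * k = G * (k + k) by ring.
  by rewrite -mulrA; apply: ler_pM.
apply: (@le_trans _ _ (e1 * (Z l s * (Z l s / 2)))); last first.
  by rewrite ler_pM2l// ler_pM2l.
have ZZ : 0 < Z l s * (Z l s / 2) by rewrite mulr_gt0// divr_gt0.
rewrite -ler_pdivrMr//; apply: le_trans (_ : C * k <= _); last first.
  by rewrite mulrC -ler_pdivlMr.
rewrite /C [leRHS]mulrDl mul1r.
apply: (@le_trans _ _ ((2 * G * Z l s + G * A) * 2 / Z l s ^+ 2 * k)); last by rewrite lerDl.
rewrite le_eqVlt; apply/orP; left; apply/eqP; field.
by rewrite gt_eqF.
Qed.

End gibbs_close.

(** * The minimiser is a Gibbs density *)

Section gibbs_minimiser.
Context (R : realType) (eta : R) (e : S2 R).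
Implicit Types (f : S2 R -> R) (l s : R).
Local Notation mu := (@area R).
Local Notation intg f := (mu.-integrable [set: S2 R] (EFin \o f)).
Local Notation u := (leg e).
Local Notation Z := (Zint mu u eta).
Local Notation U := (Uint mu u eta).
Local Notation wt l s p := (gibbs_wt eta l s (u p)).

Lemma Zint_gt0 c l s : 0 < upper_var mu u eta c l s -> 0 < Z l s.
Proof.
have Iw := intg_wt (area_lty R) eta (measurable_leg e) (normr_leg_le1 e) l s.
move=> up; have : upper_var mu u eta c l s <= (1 + `|c|) ^+ 2 * Z l s.
  rewrite /upper_var /Zint -(RintZ _ Iw).
  apply: le_Rint.
  - exact: (intg_upper (area_lty R) eta (measurable_leg e) (normr_leg_le1 e) c l s).
  - exact: (intgZ _ Iw).
  - move=> p; rewrite ler_wpM2r ?gibbs_wt_ge0// lerXn2r ?nnegrE ?le_max ?lexx ?orbT ?addr_ge0//.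
    rewrite ge_max addr_ge0// andbT.
    exact: le_trans (ler_norm _) (usub_le (normr_leg_le1 e) c p).
by move=> /(lt_le_trans up); rewrite pmulr_rgt0// exprn_gt0// ltr_pwDl.
Qed.

(* A density supported where the volume is positive cannot have all its mass
   on one side of its own mean: level sets of the axial coordinate are null. *)
Lemma half_var_gt0 f (k : S2 R -> R) (c s : R) : intg f -> {ae mu, forall p, 0 <= f p} ->
  \int[mu]_p f p = 1 -> {ae mu, forall p, s * u p - eta <= 0 -> f p = 0} ->
  measurable_fun [set: S2 R] k -> (forall p, `|k p| <= 1 + `|c|) ->
  {ae mu, forall p, k p != 0} -> \int[mu]_p (k p * f p) = 0 ->
  0 < \int[mu]_p (Num.max (k p) 0 ^+ 2 * wt 0 s p).
Proof.
move=> If f0 f1 fV mk kc kn0 kf; rewrite ltNge; apply/negP => le0.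
have Iv := intg_var (area_lty R) eta (measurable_leg e) (normr_leg_le1 e) 0 s mk kc.
have v0 : {ae mu, forall p, 0 <= Num.max (k p) 0 ^+ 2 * wt 0 s p}.
  by apply: aeW => p; rewrite mulr_ge0 ?sqr_ge0// gibbs_wt_ge0.
have v := Rint_le0_ae Iv v0 le0.
have Ikf := intgM_bounded If mk kc.
have Inkf := intgZ (-1) Ikf.
have nk0 : {ae mu, forall p, 0 <= -1 * (k p * f p)}.
  apply: filterS3 f0 fV v => p fp fVp /eqP; rewrite mulf_eq0 sqrf_eq0.
  have [V0|V0] := leP (s * u p - eta) 0; first by rewrite fVp// !mulr0.
  rewrite [wt 0 s p == 0]gt_eqF ?orbF; last first.
    by rewrite /gibbs_wt mulr_gt0 ?expR_gt0// lt_max V0.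
  case: (leP (k p) 0) => [kp _|kp]; last by rewrite gt_eqF.
  by rewrite mulN1r oppr_ge0 mulr_le0_ge0.
have := Rint_le0_ae Inkf nk0; rewrite (RintZ _ Ikf) kf mulr0 => /(_ (lexx _)) kf0.
have fz : {ae mu, forall p, f p = 0}.
  apply: filterS2 kf0 kn0 => p /eqP; rewrite mulf_eq0 oppr_eq0 oner_eq0/= mulf_eq0.
  by move=> /orP[->//|/eqP].
have m0 : measurable_fun [set: S2 R] (fun=> 0 : R) by exact: measurable_cst.
have := eq_Rint_ae (intg_measurable If) m0 fz.
by rewrite f1 Rint0 => /eqP; rewrite oner_eq0.
Qed.

Lemma axial_var_gt0 f s : intg f -> {ae mu, forall p, 0 <= f p} ->
  \int[mu]_p f p = 1 -> {ae mu, forall p, s * u p - eta <= 0 -> f p = 0} ->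
  0 < upper_var mu u eta (axial_mean e f) 0 s /\ 0 < lower_var mu u eta (axial_mean e f) 0 s.
Proof.
move=> If f0 f1 fV; set c := axial_mean e f.
have Iuf := intgM_bounded If (measurable_leg e) (normr_leg_le1 e).
have mean0 : \int[mu]_p ((u p - c) * f p) = 0.
  rewrite (@eq_Rintegral _ _ _ _ _ (fun p => u p * f p - c * f p)); last first.
    by move=> p _; rewrite mulrBl.
  by rewrite (RintB Iuf (intgZ c If)) (RintZ _ If) f1 mulr1 subrr.
have mk := measurable_usub (measurable_leg e) c.
have kc := usub_le (normr_leg_le1 e) c.
have k0 : {ae mu, forall p, u p - c != 0}.
  by apply: filterS (leg_level_null e c) => p; rewrite subr_eq0.
split; first exact: half_var_gt0 If f0 f1 fV mk kc k0 mean0.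
apply: (half_var_gt0 If f0 f1 fV (c := c)).
- exact: (measurableT_comp (@oppr_measurable R setT) mk).
- by move=> p; rewrite normrN.
- by apply: filterS k0 => p; rewrite oppr_eq0.
rewrite (@eq_Rintegral _ _ _ _ _ (fun p => -1 * ((u p - c) * f p))); last first.
  by move=> p _; rewrite mulN1r mulNr.
by rewrite (RintZ _ (intgM_bounded If mk kc)) mean0 mulr0.
Qed.

(* A uniaxial minimiser is compared with its mixtures with the Gibbs density of
   the same axial mean; these leave the volume unchanged. *)
Lemma minimiser_eq_gd r f (ft : R -> R) l s : (1 <= r)%E ->
  uniaxial_local_minimiser eta r f -> {ae mu, forall p, f p = ft (sdot p e)} ->
  s = 2 / 3 * axial_mean e f -> 0 < Z l s -> U l s = axial_mean e f * Z l s ->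
  {ae mu, forall p, f p = gd eta e l s p}.
Proof.
move=> r1 [[fd _] fr fF [eps eps0 fmin]] fE sE Z0 Us.
have [If f0 f1] := Rint_of_density fd.
pose g := gd eta e l s; pose c := axial_mean e f.
have Ig : intg g by exact: intg_gd.
have g0 p : 0 <= g p by exact: gd_ge0.
have mf := intg_measurable If; have mg := intg_measurable Ig.
have gc : axial_mean e g = c by rewrite axial_mean_gd Us mulfK// gt_eqF.
have vol p : available_volume eta f p = s * u p - eta by rewrite (axial_volume eta p If fE) -sE.
have fV := finite_energy_support If f0 vol fF.
have Ik := finite_energy_klf Z0 If f0 vol fF.
have grn : (Lnorm mu r (EFin \o g) < +oo)%E.
  apply: (Lnorm_bounded_lty (area_lty R) r1 mg (M := gibbs_lip eta (`|l| + `|s|) / Z l s)).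
  apply: aeW => p; rewrite ger0_norm// /g /gd ler_pM2r ?invr_gt0//.
  by rewrite gibbs_wt_le ?normr_leg_le1// ?lerDl ?lerDr.
have mfg : measurable_fun [set: S2 R] (fun p => f p - g p) by exact: measurable_funB.
have fgr := LnormB_lty r1 mf mg fr grn.
pose D := fine (Lnorm mu r (EFin \o (fun p => f p - g p))).
have D0 : 0 <= D by rewrite fine_ge0// Lnorm_ge0.
have DE : Lnorm mu r (EFin \o (fun p => f p - g p)) = D%:E.
  by rewrite fineK// ge0_fin_numE// Lnorm_ge0.
(* A weight in []0, 1]] with [t D < eps], so that the mixture stays in the ball of local
   minimality. *)
pose t := eps / (D + 1 + eps).
have De : 0 < D + 1 + eps by rewrite addr_gt0// ltr_wpDl.
have t0 : 0 < t by rewrite divr_gt0.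
have t1 : t <= 1 by rewrite ler_pdivrMr// mul1r lerDr addr_ge0.
have tD : t * D < eps.
  by rewrite /t mulrAC ltr_pdivrMr// ltr_pM2l// -addrA ltrDl addr_gt0.
pose h p := (1 - t) * f p + t * g p.
have Ih : intg h by exact: intgD (intgZ (1 - t) If) (intgZ t Ig).
have mh := intg_measurable Ih.
have h0 : {ae mu, forall p, 0 <= h p}.
  by apply: filterS f0 => p fp; rewrite addr_ge0// mulr_ge0// ?subr_ge0// ltW.
have h1 : \int[mu]_p h p = 1.
  rewrite (RintD (intgZ (1 - t) If) (intgZ t Ig)) (RintZ _ If) (RintZ _ Ig) f1.
  by rewrite (Rint_gd Z0) !mulr1 subrK.
pose ht (x : R) := (1 - t) * ft x + t * (gibbs_wt eta l s (P2 x) / Z l s).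
have hE : {ae mu, forall p, h p = ht (sdot p e)}.
  by apply: filterS fE => p fp; rewrite /h fp.
have hc : axial_mean e h = c.
  have Iuf := intgM_bounded If (measurable_leg e) (normr_leg_le1 e).
  have Iug := intgM_bounded Ig (measurable_leg e) (normr_leg_le1 e).
  rewrite /axial_mean (@eq_Rintegral _ _ _ _ _ (fun p => (1 - t) * (u p * f p) + t * (u p * g p))).
    rewrite (RintD (intgZ (1 - t) Iuf) (intgZ t Iug)) (RintZ _ Iuf) (RintZ _ Iug).
    have -> : \int[mu]_p (u p * g p) = c by exact: gc.
    have -> : \int[mu]_p (u p * f p) = c by [].
    by rewrite -mulrDl subrK mul1r.
  by move=> p _; rewrite /h -/(u p) mulrDr !(mulrCA (u p)).
have volh p : available_volume eta h p = s * u p - eta.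
  by rewrite (axial_volume eta p Ih hE) hc sE.
have hV : {ae mu, forall p, s * u p - eta <= 0 -> h p = 0}.
  by apply: filterS fV => p fp V0; rewrite /h fp// /g gd_eq0// !mulr0 addr0.
have kle : {ae mu, forall p, klf (h p) (g p) <= (1 - t) * klf (f p) (g p)}.
  by apply: filterS f0 => p fp; exact: klf_mix.
have k0 : {ae mu, forall p, 0 <= klf (h p) (g p)}.
  by apply: filterS h0 => p hp; exact: klf_ge0.
have Ikt := intgZ (1 - t) Ik.
have Ikh : intg (fun p => klf (h p) (g p)).
  apply: (intg_le_ae (measurable_klf mh mg) Ikt).
  by apply: filterS2 kle k0 => p kp kp0; rewrite ger0_norm.
have hr : (Lnorm mu r (EFin \o h) < +oo)%E.
  apply: (LnormD_lty r1).
  - exact: measurable_funM (measurable_cst _) mf.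
  - exact: measurable_funM (measurable_cst _) mg.
  - by rewrite (LnormZ_fin r1 _ mf fr) lte_mul_pinfty.
  - by rewrite (LnormZ_fin r1 _ mg grn) lte_mul_pinfty.
have fh : (Lnorm mu r (fun p => (f p - h p)%:E) < eps%:E)%E.
  rewrite (_ : (fun p => (f p - h p)%:E) = EFin \o (fun p => t * (f p - g p))).
    by rewrite (LnormZ_fin r1 _ mfg fgr) DE gtr0_norm// -EFinM lte_fin.
  by apply/funext => p; rewrite /h /=; congr EFin; ring.
have ud : uniaxial_density h.
  split; first exact: density_of_Rint.
  by exists ht, e.
have := fmin h ud hr fh.
(* The mean and hence the volume are those of [f], so both energies contain the same constant.
   Minimality bounds the entropy of [f] by that of [h], which is at most [1 - t] times it; it
   therefore vanishes. *)
rewrite (energyE Z0 If f0 f1 vol fV Ik) (energyE Z0 Ih h0 h1 volh hV Ikh) hc lee_fin lerD2r.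
move=> /le_trans /(_ (le_Rint_ae Ikh Ikt kle)); rewrite (RintZ _ Ik) => kk.
have {kk} kk : \int[mu]_p klf (f p) (g p) <= 0.
  have aux (I : R) : I <= (1 - t) * I -> I <= 0.
    by rewrite mulrBl mul1r -subr_ge0 addrAC subrr add0r oppr_ge0 pmulr_rle0.
  exact: aux kk.
have k0f : {ae mu, forall p, 0 <= klf (f p) (g p)}.
  by apply: filterS f0 => p fp; exact: klf_ge0.
apply: filterS3 f0 fV (Rint_le0_ae Ik k0f kk) => p fp fVp kp.
(* [klf] is 0 by definition where the Gibbs density vanishes; there the finite energy already forces
   [f p = 0]. *)
have [V0|V0] := leP (s * u p - eta) 0; first by rewrite fVp// gd_eq0.
by apply: klf_eq0 => //; rewrite gd_gt0.
Qed.

(** Self-consistency: the axial mean is [3 / 2 * s], and the factor [2 / 3] in the volume turns it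
    back into the parameter [s] of the weight. *)
Lemma gd_volume l s p : 0 < Z l s -> U l s = 3 / 2 * s * Z l s ->
  available_volume eta (gd eta e l s) p = s * u p - eta.
Proof.
move=> Z0 Us; pose ft (x : R) := gibbs_wt eta l s (P2 x) / Z l s.
have gE : {ae mu, forall q, gd eta e l s q = ft (sdot q e)} by exact: aeW.
rewrite (axial_volume eta p (intg_gd eta e l s) gE) axial_mean_gd Us mulfK ?gt_eqF//.
by congr (_ * _ - _); field.
Qed.

Lemma energy_gd l s : 0 < Z l s -> U l s = 3 / 2 * s * Z l s ->
  free_energy eta (gd eta e l s) = (3 / 2 * l * s - ln (Z l s))%:E.
Proof.
move=> Z0 Us; have Ig := intg_gd eta e l s.
have gc : axial_mean e (gd eta e l s) = 3 / 2 * s by rewrite axial_mean_gd Us mulfK// gt_eqF.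
have g0 : {ae mu, forall p, 0 <= gd eta e l s p} by apply: aeW => p; exact: gd_ge0.
have vol p := gd_volume p Z0 Us.
have gV : {ae mu, forall p, s * u p - eta <= 0 -> gd eta e l s p = 0}.
  by apply: aeW => p; exact: gd_eq0.
have k0 : (fun p => klf (gd eta e l s p) (gd eta e l s p)) = cst 0.
  by apply/funext => p; rewrite klf_id.
have Ik : intg (fun p => klf (gd eta e l s p) (gd eta e l s p)).
  by rewrite k0; exact: intg_cst (area_lty R) 0.
rewrite (energyE Z0 Ig g0 (Rint_gd Z0) vol gV Ik) k0 Rint0 add0r gc.
by congr (_ - _)%:E; ring.
Qed.

End gibbs_minimiser.

Lemma minimiser_gibbs (R : realType) (eta : R) (r : \bar R) (f : S2 R -> R) :
  (1 <= r)%E -> uniaxial_local_minimiser eta r f ->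
  exists (e : S2 R) (s l : R),
    let Z := Zint (@area R) (leg e) eta l s in
    [/\ 0 < Z, Uint (@area R) (leg e) eta l s = 3 / 2 * s * Z,
        {ae @area R, forall p, f p = gd eta e l s p} &
        3 / 2 * l * Z = Bint (@area R) (leg e) eta l s].
Proof.
move=> r1 fm; have [[fd [ft [e fE]]] fr fF [eps eps0 fmin]] := fm.
have [If f0 f1] := Rint_of_density fd; have mf := intg_measurable If.
pose c := axial_mean e f; pose s := 2 / 3 * c.
have cE : c = 3 / 2 * s by rewrite /s; field.
have vol p : available_volume eta f p = s * leg e p - eta by rewrite (axial_volume eta p If fE).
have fV := finite_energy_support If f0 vol fF.
have [up lo] := axial_var_gt0 If f0 f1 fV.
(* With [s] fixed by the mean [c] of [f], the tilt [l] is chosen to give the Gibbs density that same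
   mean. *)
have [l lE] := exists_tilt (area_lty R) (measurable_leg e) (normr_leg_le1 e) up lo.
have Z0 := Zint_gt0 (upper_var_gt0 (area_lty R) (measurable_leg e) (normr_leg_le1 e) l up).
have {lE} Us : Uint (@area R) (leg e) eta l s = c * Zint (@area R) (leg e) eta l s.
  by apply/eqP; rewrite -subr_eq0 lE.
have fg := minimiser_eq_gd r1 fm fE (erefl s) Z0 Us.
rewrite -/c cE in Us up lo.
exists e, s, l; split => //.
pose N := fine (Lnorm (@area R) r (EFin \o cst 1)).
have N1 := Lnorm_cst1_lty (area_lty R) r1.
have N0 : 0 <= N by rewrite fine_ge0// Lnorm_ge0.
have NE : Lnorm (@area R) r (EFin \o cst 1) = N%:E.
  by rewrite fineK// ge0_fin_numE// Lnorm_ge0.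
(* A uniform distance [e1] costs at most [e1 N < eps] in L^r, with [N] the norm of the constant
   1. *)
pose e1 := eps / (N + 1).
have e10 : 0 < e1 by rewrite divr_gt0// ltr_wpDl.
have [k k0 close] := gd_close Z0 e10.
have Ff : free_energy eta f = (3 / 2 * l * s - ln (Zint (@area R) (leg e) eta l s))%:E.
  rewrite -(energy_gd Z0 Us).
  have mg := measurable_gd eta e l s.
  have volg p := gd_volume p Z0 Us.
  rewrite /free_energy.
  refine (@ae_eq_integral _ _ _ (@area R) setT _ _ measurableT
    (measurable_energy If vol) (measurable_energy (intg_gd eta e l s) volg) _).
  by apply: filterS fg => p fp _; rewrite vol volg fp.
(* The competitors are Gibbs densities about the same axis; self-consistency is what puts their
   energies in closed form. *)
apply: (gibbs_stationary (area_lty R) (measurable_leg e) (normr_leg_le1 e) k0 Z0 Us up lo).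
move=> l' s' lk sk Z0' Us'.
have mg' := measurable_gd eta e l' s'.
have mh : measurable_fun [set: S2 R] (fun p => f p - gd eta e l' s' p) by exact: measurable_funB.
have gr' : (Lnorm (@area R) r (EFin \o gd eta e l' s') < +oo)%E.
  apply: (Lnorm_bounded_lty (area_lty R) r1 mg'
    (M := gibbs_lip eta (`|l'| + `|s'|) / Zint (@area R) (leg e) eta l' s')).
  apply: aeW => p; rewrite (ger0_norm (gd_ge0 _ Z0')) /gd ler_pM2r ?invr_gt0//.
  by rewrite gibbs_wt_le ?normr_leg_le1// ?lerDl ?lerDr.
have := fmin _ (uniaxial_gd Z0') gr'; rewrite Ff (energy_gd Z0' Us') lee_fin; apply.
apply: (@le_lt_trans _ _ (e1%:E * N%:E)%E).
  rewrite -NE; apply: (Lnorm_bounded (area_lty R) r1 mh (ltW e10)).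
  by apply: filterS fg => p ->; exact: close.
rewrite -EFinM lte_fin /e1 mulrAC ltr_pdivrMr ?ltr_wpDl// ltr_pM2l//.
by rewrite ltrDl.
Qed.

(** * Densities on the interval *)

Section axial_profile.
Context (R : realType) (e : S2 R).
Local Notation mu := (@area R).
Local Notation leb := (@lebesgue_measure R).
Local Notation I := (`[(-1)%R, 1%R]%classic : set R).

Lemma lebesgue_I : leb I = 2%:E.
Proof.
rewrite lebesgue_measure_itv /= lte_fin ifT; last by lra.
by rewrite -EFinD; congr EFin; ring.
Qed.

Lemma intg_itv (h : R -> R) (M : R) : measurable_fun [set: R] h ->
  (forall x, -1 <= x <= 1 -> `|h x| <= M) -> leb.-integrable I (EFin \o h).
Proof.
have Ifin : (leb I < +oo)%E by rewrite lebesgue_I ltry.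
move=> mh hM; apply: measurable_bounded_integrable => //.
- exact: measurable_funS mh.
exists M; split; first exact: num_real.
by move=> y My x Ix /=; rewrite (le_trans _ (ltW My))// hM//; move: Ix; rewrite /= in_itv.
Qed.

Lemma Rint_sdot (h : R -> R) (M : R) : measurable_fun [set: R] h ->
  (forall x, -1 <= x <= 1 -> `|h x| <= M) ->
  \int[mu]_p h (sdot p e) = 2 * pi * \int[leb]_(x in I) h x.
Proof.
move=> mh hM.
have Ih := intg_itv mh hM.
have Ic : leb.-integrable I (EFin \o cst M) by exact: (@intg_itv _ `|M|).
have mhe : measurable_fun [set: S2 R] (fun p => h (sdot p e)).
  exact: measurableT_comp mh (measurable_sdot e).
have Ihe : mu.-integrable [set: S2 R] (EFin \o (fun p => h (sdot p e))).
  apply: (intg_bounded (area_lty R) mhe (M := M)) => p.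
  by apply: hM; rewrite -ler_norml normr_sdot_le1.
have Ime := intg_cst (area_lty R) M.
(* Adding [M] makes the integrand nonnegative on [[-1, 1]]; it contributes [4 pi M] to both sides,
   since the interval has length 2. *)
have mk : measurable_fun [set: R] (fun x => (h x + M)%:E).
  by apply/measurable_EFinP; exact: measurable_funD.
have k0 x : -1 <= x <= 1 -> (0 <= (h x + M)%:E)%E.
  by move=> /hM; rewrite lee_fin ler_norml => /andP[? _]; lra.
have := ge0_integral_sdot e mk k0.
rewrite -(EFin_Rint (intgD Ihe Ime)) (RintD Ihe Ime).
have Ihc : leb.-integrable I (EFin \o (fun x => h x + M)).
  by rewrite (_ : EFin \o _ = (EFin \o h) \+ (EFin \o cst M))%E//; exact: integrableD.
rewrite (_ : \int[leb]_(x in I) (h x + M)%:E = (\int[leb]_(x in I) (h x + M))%R%:E)%E; last first.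
  by rewrite /Rintegral fineK//; exact: integrable_fin_num Ihc.
rewrite -EFinM RintegralD//.
rewrite Rintegral_cst// Rintegral_cst// => -[].
have -> : fine (mu setT) = 4 * pi by rewrite area_sphere.
have -> : fine (leb I) = 2 by rewrite lebesgue_I.
by lra.
Qed.

End axial_profile.

(* The factor 2 / 3 in S comes from y ^+ 2 - 1 / 3 = 2 / 3 * P2 y: with it,
   S * P2 (sdot p n) - eta is available_volume eta f p. *)
Theorem proposition5p6 (R : realType) (eta : R) (r : \bar R) (f : S2 R -> R)
    (hr : (1 <= r)%E) (hf : uniaxial_local_minimiser eta r f) :
  exists (fhat : R -> R) (n : S2 R) (S l Z : R),
    density (@lebesgue_measure R) `[-1, 1] fhat /\
    {ae @area R, forall p, (2 * pi)^-1 * fhat (sdot p n) = f p} /\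
    0 < Z /\
    {ae @lebesgue_measure R, forall x, `[-1, 1]%classic x ->
      fhat x = Z^-1 * expR (l * P2 x) * Num.max (S * P2 x - eta) 0} /\
    S = 2 / 3 * \int[@lebesgue_measure R]_(x in `[-1, 1]) (P2 x * fhat x) /\
    l = 2 / 3 * \int[@lebesgue_measure R]_(x in `[-1, 1])
                  (P2 x * volume_quotient eta S fhat x).
Proof.
have [e [s [l [Z0 Us fg Bs]]]] := minimiser_gibbs hr hf.
have pi2 : 0 < 2 * pi :> R by rewrite mulr_gt0// pi_gt0.
pose K := `|l| + `|s|.
pose h0 (x : R) := gibbs_wt eta l s (P2 x).
have mh0 : measurable_fun [set: R] h0.
  exact: measurableT_comp (measurable_gibbs_wt eta l s) (@measurable_P2 R).
have P2le (x : R) : -1 <= x <= 1 -> `|P2 x| <= 1.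
  by move=> x1; apply: normr_P2_le1; rewrite ler_norml.
have h0b (x : R) : -1 <= x <= 1 -> `|h0 x| <= gibbs_lip eta K.
  move=> x1; rewrite ger0_norm ?gibbs_wt_ge0//.
  by apply: gibbs_wt_le; rewrite ?P2le// ?lerDl ?lerDr.
pose h1 (x : R) := P2 x * h0 x.
have mh1 : measurable_fun [set: R] h1 by exact: measurable_funM (@measurable_P2 R) mh0.
have h1b (x : R) : -1 <= x <= 1 -> `|h1 x| <= gibbs_lip eta K.
  by move=> x1; rewrite normrM (le_trans _ (h0b x x1))// ler_piMl// P2le.
pose h2 (x : R) := (if 0 < s * P2 x - eta then P2 x else 0) * expR (l * P2 x).
have mh2 : measurable_fun [set: R] h2.
  apply: measurable_funM.
    apply: measurable_fun_ifT => //; last exact: measurable_P2.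
    apply: measurable_fun_ltr => //; apply: measurable_funB => //.
    by apply: measurable_funM => //; exact: measurable_P2.
  apply: measurableT_comp; first exact: measurable_expR.
  by apply: measurable_funM => //; exact: measurable_P2.
have h2b (x : R) : -1 <= x <= 1 -> `|h2 x| <= expR `|l|.
  move=> x1; rewrite normrM -[leRHS]mul1r; apply: ler_pM => //.
    by case: ifP => // _; rewrite ?normr0 ?P2le.
  by rewrite ger0_norm ?expR_ge0// ler_expR (le_trans (ler_norm _))// mul_le_bound ?P2le.
pose J0 := \int[@lebesgue_measure R]_(x in `[-1, 1]) h0 x.
pose J1 := \int[@lebesgue_measure R]_(x in `[-1, 1]) h1 x.
pose J2 := \int[@lebesgue_measure R]_(x in `[-1, 1]) h2 x.
have ZE : Zint (@area R) (leg e) eta l s = 2 * pi * J0.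
  exact: Rint_sdot mh0 h0b.
have UE : Uint (@area R) (leg e) eta l s = 2 * pi * J1.
  exact: Rint_sdot mh1 h1b.
have BE : Bint (@area R) (leg e) eta l s = 2 * pi * J2.
  exact: Rint_sdot mh2 h2b.
have I0 := intg_itv mh0 h0b; have I1 := intg_itv mh1 h1b; have I2 := intg_itv mh2 h2b.
rewrite BE UE ZE in Us Bs; rewrite ZE in Z0.
have J00 : 0 < J0 by move: Z0; rewrite pmulr_rgt0.
have J1E : J1 = 3 / 2 * s * J0.
  by apply: (mulfI (lt0r_neq0 pi2)); rewrite Us; ring.
have J2E : J2 = 3 / 2 * l * J0.
  by apply: (mulfI (lt0r_neq0 pi2)); rewrite -Bs; ring.
(* Normalised by the integral [J0] over the interval, so [fhat] is [2 pi] times the profile of the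
   density on the sphere. *)
pose fhat (x : R) := J0^-1 * expR (l * P2 x) * Num.max (s * P2 x - eta) 0.
have fhatE x : fhat x = J0^-1 * h0 x by rewrite /fhat -mulrA.
have Ifhat : (@lebesgue_measure R).-integrable `[-1, 1] (EFin \o fhat).
  rewrite (_ : fhat = fun x => J0^-1 * h0 x); last exact/funext.
  apply: (@intg_itv _ _ (`|J0^-1| * gibbs_lip eta K)); first exact: measurable_funM.
  by move=> x x1; rewrite normrM ler_wpM2l// h0b.
exists fhat, e, s, l, J0; split; first split => //.
- by apply: aeW => x _; rewrite fhatE mulr_ge0 ?gibbs_wt_ge0// invr_ge0 ltW.
- rewrite -[LHS]fineK; last exact: integrable_fin_num Ifhat.
  congr EFin; transitivity (\int[@lebesgue_measure R]_(x in `[-1, 1]) (J0^-1 * h0 x)).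
    by apply: eq_Rintegral => x _; rewrite fhatE.
  by rewrite RintegralZl// mulVf// gt_eqF.
split.
  apply: filterS fg => p ->; rewrite fhatE /gd ZE -/(h0 (sdot p e)).
  by rewrite mulrA mulrC -invfM.
split => //; split; first by apply: aeW.
split.
  under eq_Rintegral => x _ do rewrite fhatE mulrCA -/(h1 x).
  by rewrite RintegralZl// -/J1 J1E; field; rewrite gt_eqF.
(* Where the volume is positive it cancels from [fhat], and elsewhere the quotient and [h2] are both
   0: the integral is [J2 / J0], which stationarity evaluates to [3 / 2 * l]. *)
have -> : \int[@lebesgue_measure R]_(x in `[-1, 1]) (P2 x * volume_quotient eta s fhat x) =
    \int[@lebesgue_measure R]_(x in `[-1, 1]) (J0^-1 * h2 x).
  apply: eq_Rintegral => x _; rewrite /volume_quotient /h2 /fhat; case: leP => [V0|V0].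
    by rewrite -subr_le0 V0 mul0r !mulr0.
  rewrite -subr_le0 leNgt V0/=; field.
  by rewrite (gt_eqF V0) gt_eqF.
by rewrite RintegralZl// -/J2 J2E; field; rewrite gt_eqF.
Qed.
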